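(* Suppose that $f(z)=h(z)+\overline{g(z)}=\sum_{n=0}^\infty a_nz^n+\overline{\sum_{n=1}^\infty b_nz^n}$ is a sense-preserving $K$-quasiconformal harmonic mapping of the disk $\mathbb{D}$ for some $K\ge 1$, with $k=\frac{K-1}{K+1}$ (or, more generally, that $f=h+\overline{g}$ is a harmonic mapping in $\mathbb{D}$ of this form whose dilatation $\omega_f=g'/h'$ satisfies $|\omega_f(z)|\le k$ in $\mathbb{D}$, i.e. $|g'(z)|\le k|h'(z)|$ in $\mathbb{D}$, for some $k\in[0,1]$), where $|h(z)|\le 1$ in $\mathbb{D}$. Then $$\frac{1-r\bigl(|a_0|+(k+1)(1-|a_0|^2)\bigr)}{1-r|a_0|}+\sum_{n=1}^\infty |a_n|r^n+\sum_{n=1}^\infty |b_n|r^n\le 1\quad\text{for all } 0\le r\le\frac13 .$$ Moreover, the inequality is sharp for all $a_0\in\mathbb{D}$ and all $0\le r\le\frac13$: for each $k\in[0,1]$ and $a_0\in\mathbb{D}$, taking $$h(z)=\frac{z+a_0}{1+\overline{a_0}z},\qquad g(z)=\lambda\,\bigl(h(z)-a_0\bigr),\qquad 0\le\lambda\le k,$$ the left-hand side of the inequality tends to $1$ as $\lambda\to k$, for every $0\le r\le\frac13$.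
   Context: $\mathbb{D}=\{z\in\mathbb{C}:|z|<1\}$. A harmonic mapping in $\mathbb{D}$ is a complex-valued function $f$ with $\Delta f=4f_{z\overline z}=0$; it has a canonical representation $f=h+\overline g$ with $h,g$ analytic in $\mathbb{D}$ and $f(0)=h(0)$ (so $g(0)=0$). It is sense-preserving if $|h'|^2-|g'|^2>0$ in $\mathbb{D}$. A sense-preserving homeomorphism $f$ from $\mathbb{D}$ onto a domain, belonging to the Sobolev class $W^{1,2}_{loc}(\mathbb{D})$, is $K$-quasiconformal ($K\ge1$) if $\frac{|f_z|+|f_{\overline z}|}{|f_z|-|f_{\overline z}|}\le K$ in $\mathbb{D}$, i.e. for harmonic $f=h+\overline g$, $|\omega_f(z)|=|g'(z)/h'(z)|\le k=\frac{K-1}{K+1}$ in $\mathbb{D}$. *)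

(* Defs.v *)
From Stdlib Require Import Reals.
From Coquelicot Require Import Coquelicot.

Local Open Scope R_scope.

Definition disk (z : C) : Prop := Cmod z < 1.

(* Analyticity of [h] and [g] in the disk is carried by their convergent power
   series; [b 0 = 0] makes the decomposition canonical, [f 0 = h 0]. *)
Definition harmonic_mapping (f h g : C -> C) (a b : nat -> C) : Prop :=
  (forall z, disk z ->
     is_pseries (K := C_AbsRing) (V := C_NormedModule) a z (h z)) /\
  (forall z, disk z ->
     is_pseries (K := C_AbsRing) (V := C_NormedModule) b z (g z)) /\
  b 0%nat = RtoC 0 /\
  (forall z, disk z -> f z = (h z + Cconj (g z))%C).

Definition sense_preserving (h g : C -> C) : Prop :=
  forall z, disk z -> 0 < Cmod (C_derive h z) ^ 2 - Cmod (C_derive g z) ^ 2.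

(* [|g' / h'| <= k], in the form that makes sense at the zeros of [h']. *)
Definition dilatation_le (k : R) (h g : C -> C) : Prop :=
  forall z, disk z -> Cmod (C_derive g z) <= k * Cmod (C_derive h z).

Definition partial_x (f : C -> C) (z : C) : C :=
  (Derive (fun t => Re (f (t, Im z))) (Re z),
   Derive (fun t => Im (f (t, Im z))) (Re z)).

Definition partial_y (f : C -> C) (z : C) : C :=
  (Derive (fun t => Re (f (Re z, t))) (Im z),
   Derive (fun t => Im (f (Re z, t))) (Im z)).

Definition d_z (f : C -> C) (z : C) : C :=
  ((partial_x f z - Ci * partial_y f z) / RtoC 2)%C.

Definition d_zbar (f : C -> C) (z : C) : C :=
  ((partial_x f z + Ci * partial_y f z) / RtoC 2)%C.

Definition connected_set (A : C -> Prop) : Prop :=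
  forall U V : C -> Prop, open U -> open V ->
    (forall z, A z -> U z \/ V z) ->
    (exists z, A z /\ U z) -> (exists z, A z /\ V z) ->
    exists z, A z /\ U z /\ V z.

Definition domain (A : C -> Prop) : Prop :=
  (exists z, A z) /\ open A /\ connected_set A.

Definition homeomorphism (f : C -> C) (A B : C -> Prop) : Prop :=
  exists finv : C -> C,
    (forall z, A z -> B (f z) /\ finv (f z) = z) /\
    (forall w, B w -> A (finv w) /\ f (finv w) = w) /\
    continuous_on A f /\ continuous_on B finv.

(* Intended for [f] harmonic in the disk with parts [h] and [g]: such an [f] is
   smooth, so membership in W^{1,2}_loc holds automatically and the classical
   derivatives [d_z f] and [d_zbar f] are the weak ones. *)
Definition quasiconformal (K : R) (f h g : C -> C) : Prop :=
  1 <= K /\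
  sense_preserving h g /\
  (exists A, domain A /\ homeomorphism f disk A) /\
  (forall z, disk z ->
     (Cmod (d_z f z) + Cmod (d_zbar f z)) /
     (Cmod (d_z f z) - Cmod (d_zbar f z)) <= K).

Definition bohr_lhs (k : R) (a b : nat -> C) (r : R) : R :=
  let A := Cmod (a 0%nat) in
  (1 - r * (A + (k + 1) * (1 - A ^ 2))) / (1 - r * A)
  + Series (fun n => Cmod (a (S n)) * r ^ S n)
  + Series (fun n => Cmod (b (S n)) * r ^ S n).

Definition extremal_h (a0 z : C) : C :=
  ((z + a0) / (RtoC 1 + Cconj a0 * z))%C.

Definition extremal_g (lam : R) (a0 z : C) : C :=
  (RtoC lam * (extremal_h a0 z - a0))%C.

Definition extremal_f (lam : R) (a0 z : C) : C :=
  (extremal_h a0 z + Cconj (extremal_g lam a0 z))%C.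

(* Main.v *)
(* Let h = sum a_n z^n be bounded by 1 and |g'| <= k |h'| in the disk. If |G| <= |H| for
   power series on the disk, then G = W H with W analytic and |W| <= 1, and Bohr's
   inequality says that the majorant sum |w_n| r^n is at most 1 for r <= 1/3, so that
   majorants satisfy M_r(G) <= M_r(H) there.
   Applied to h - a_0 = W (1 - conj a_0 h), with W = z phi, this yields
   sum_{n>=1} |a_n| r^n <= r (1 - |a_0|^2) / (1 - r |a_0|). Applied to g' = W (k h'), it yields
   sum_{n>=1} |b_n| r^n <= k sum_{n>=1} |a_n| r^n, after dividing the coefficient
   (n+1) b_{n+1} = k sum_j w_{n-j} (j+1) a_{j+1} by n+1 >= j+1.

   Cauchy's integral formula is replaced by averages over the N-th roots of unity, N -> oo.
   The quotient W is obtained by removing the zeros of H in a disk one at a time with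
   Blaschke factors; a zero-free H is inverted by a Neumann series that enlarges the disk of
   convergence of the formal power series 1/H by a fixed amount at each step. *)
Require Import Defs.
From Stdlib Require Import Arith Reals Lra Lia Psatz Classical FunctionalExtensionality Ring.
From Coquelicot Require Import Coquelicot.

Local Open Scope R_scope.

(** The constant 1/3 comes from the bound |w_n| <= 2 (1 - |w_0|) for a function bounded by 1,
    because the powers 3^-n, n >= 1, sum to 1/2. The two majorant estimates add up to the claim: the
    first term of the left-hand side is 1 - (k+1) B with B = r (1 - |a_0|^2) / (1 - r |a_0|), and
    the two series are at most B and k B. For the extremal maps they equal B and lam B, whence the
    sharpness. The obstacle is that H may have infinitely many zeros accumulating at the unit
    circle. So W is constructed only on disks of radius rho < 1, and nothing relates the W of
    different rho. Every estimate is therefore made for a partial sum of fixed length N, at radius t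
    r with t < rho, at the cost of a power of t that depends on N alone; then t -> 1 with N fixed,
    and N -> oo last. Functions are handled as coefficient sequences: G = W H is an identity in a
    ring, and common factors cancel formally, before any convergence is known. *)

Notation is_Cseries := (is_series (K := C_AbsRing) (V := C_NormedModule)).

(* [ring] looks up the ring on the syntactic type of the left-hand side, which may be
   a projection of a Coquelicot structure. *)
Ltac cring := match goal with |- @eq _ ?x ?y =>
  let H := fresh in assert (H : @eq C x y); [solve [ring | symmetry; ring]|exact H] end.

Ltac rring := match goal with |- @eq _ ?x ?y =>
  let H := fresh in assert (H : @eq R x y) by ring; exact H end.

(** * Series of complex numbers *)

Lemma sum_n_C (u : nat -> C) (N : nat) :
  sum_n u N = (sum_n (fun n => Re (u n)) N, sum_n (fun n => Im (u n)) N).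
Proof.
  induction N as [|N IH].
  - rewrite !sum_O. now destruct (u 0%nat).
  - rewrite !sum_Sn, IH. reflexivity.
Qed.

Lemma is_Cseries_components (u : nat -> C) (l : C) :
  is_Cseries u l <->
  is_series (fun n => Re (u n)) (Re l) /\ is_series (fun n => Im (u n)) (Im l).
Proof.
  unfold is_series; split.
  - intros H. split; apply filterlim_locally; intros eps;
      generalize (proj1 (filterlim_locally _ _) H eps); apply filter_imp;
      intros N; rewrite sum_n_C; intros [B1 B2]; assumption.
  - intros [H1 H2]. apply filterlim_locally. intros eps.
    generalize (filter_and _ _ (proj1 (filterlim_locally _ _) H1 eps)
                 (proj1 (filterlim_locally _ _) H2 eps)).
    apply filter_imp. intros N [B1 B2]. rewrite sum_n_C. split; assumption.
Qed.

(** Componentwise [Series] makes the sum total; its value is arbitrary without convergence, so the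
    rules for sums and products ask for [abs_summable]. *)
Definition Csum (u : nat -> C) : C :=
  (Series (fun n => Re (u n)), Series (fun n => Im (u n))).

Lemma is_Cseries_unique (u : nat -> C) (l : C) : is_Cseries u l -> Csum u = l.
Proof.
  intros [H1 H2]%is_Cseries_components.
  unfold Csum. rewrite (is_series_unique _ _ H1), (is_series_unique _ _ H2).
  now destruct l.
Qed.

Lemma im_le_Cmod (c : C) : Rabs (Im c) <= Cmod c.
Proof. generalize (Rmax_Cmod c). intros H. apply Rle_trans with (2 := H), Rmax_r. Qed.

Definition abs_summable (u : nat -> C) : Prop := ex_series (fun n => Cmod (u n)).

Lemma ex_series_Re (u : nat -> C) : abs_summable u ->
  ex_series (fun n => Rabs (Re (u n))).
Proof.
  apply (ex_series_le (V := R_CompleteNormedModule)). intros n.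
  unfold norm; simpl. rewrite Rabs_Rabsolu. apply re_le_Cmod.
Qed.

Lemma ex_series_Im (u : nat -> C) : abs_summable u ->
  ex_series (fun n => Rabs (Im (u n))).
Proof.
  apply (ex_series_le (V := R_CompleteNormedModule)). intros n.
  unfold norm; simpl. rewrite Rabs_Rabsolu. apply im_le_Cmod.
Qed.

Lemma Csum_correct (u : nat -> C) : abs_summable u -> is_Cseries u (Csum u).
Proof.
  intros H. apply is_Cseries_components.
  split; apply Series_correct, ex_series_Rabs.
  - now apply ex_series_Re.
  - now apply ex_series_Im.
Qed.

Lemma Csum_ext (u v : nat -> C) : (forall n, u n = v n) -> Csum u = Csum v.
Proof. intros H. now replace v with u by now apply functional_extensionality. Qed.

Lemma abs_summable_le (u : nat -> C) (v : nat -> R) :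
  (forall n, Cmod (u n) <= v n) -> ex_series v -> abs_summable u.
Proof.
  intros H. apply (ex_series_le (V := R_CompleteNormedModule)). intros n.
  unfold norm; simpl. unfold abs; simpl.
  rewrite Rabs_pos_eq by apply Cmod_ge_0. apply H.
Qed.

Lemma abs_summable_plus (u v : nat -> C) :
  abs_summable u -> abs_summable v -> abs_summable (fun n => (u n + v n)%C).
Proof.
  intros Hu Hv. apply abs_summable_le with (fun n => Cmod (u n) + Cmod (v n)).
  - intros n. apply Cmod_triangle.
  - exact (ex_series_plus _ _ Hu Hv).
Qed.

Lemma abs_summable_scal (c : C) (u : nat -> C) :
  abs_summable u -> abs_summable (fun n => (c * u n)%C).
Proof.
  intros Hu. apply abs_summable_le with (fun n => Cmod c * Cmod (u n)).
  - intros n. rewrite Cmod_mult. apply Rle_refl.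
  - exact (ex_series_scal_l (Cmod c) _ Hu).
Qed.

Lemma Csum_plus (u v : nat -> C) : abs_summable u -> abs_summable v ->
  Csum (fun n => (u n + v n)%C) = (Csum u + Csum v)%C.
Proof.
  intros Hu Hv. apply is_Cseries_unique.
  exact (is_series_plus _ _ _ _ (Csum_correct _ Hu) (Csum_correct _ Hv)).
Qed.

Lemma Csum_scal (c : C) (u : nat -> C) : abs_summable u ->
  Csum (fun n => (c * u n)%C) = (c * Csum u)%C.
Proof.
  intros Hu. apply is_Cseries_unique.
  exact (is_series_scal c _ _ (Csum_correct _ Hu)).
Qed.

Lemma Csum_minus (u v : nat -> C) : abs_summable u -> abs_summable v ->
  Csum (fun n => (u n - v n)%C) = (Csum u - Csum v)%C.
Proof.
  intros Hu Hv. apply is_Cseries_unique.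
  exact (is_series_minus _ _ _ _ (Csum_correct _ Hu) (Csum_correct _ Hv)).
Qed.

Lemma Cmod_sum_n (u : nat -> C) (N : nat) :
  Cmod (sum_n u N) <= sum_n (fun n => Cmod (u n)) N.
Proof.
  induction N as [|N IH].
  - rewrite !sum_O. apply Rle_refl.
  - rewrite !sum_Sn. apply Rle_trans with (1 := Cmod_triangle _ _).
    apply Rplus_le_compat_r, IH.
Qed.

Lemma sum_n_le_Series (u : nat -> R) (N : nat) :
  (forall n, 0 <= u n) -> ex_series u -> sum_n u N <= Series u.
Proof.
  intros H0 Hu.
  apply (is_lim_seq_incr_compare (sum_n u)).
  - apply Series_correct, Hu.
  - intros n. rewrite sum_Sn. unfold plus; simpl. generalize (H0 (S n)). lra.
Qed.

Lemma Cmod_is_Cseries_le (u : nat -> C) (v : nat -> R) (z : C) (w : R) :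
  is_Cseries u z -> is_series v w -> (forall n, Cmod (u n) <= v n) ->
  Cmod z <= w.
Proof.
  intros Hu Hv H.
  apply (filterlim_le (F := eventually) (fun N => Cmod (sum_n u N)) (sum_n v)
    (Finite (Cmod z)) (Finite w)).
  - exists 0%nat. intros N _. apply Rle_trans with (1 := Cmod_sum_n _ _).
    apply sum_n_m_le. apply H.
  - exact (filterlim_comp _ _ _ _ _ _ _ _ Hu (filterlim_norm (V := C_NormedModule) z)).
  - exact Hv.
Qed.

Lemma Cmod_Csum_le (u : nat -> C) (v : nat -> R) :
  (forall n, Cmod (u n) <= v n) -> ex_series v -> Cmod (Csum u) <= Series v.
Proof.
  intros H Hv. apply (Cmod_is_Cseries_le u v).
  - apply Csum_correct; now apply abs_summable_le with v.
  - now apply Series_correct.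
  - exact H.
Qed.

Lemma Csum_incr_1 (u : nat -> C) : abs_summable u ->
  Csum u = (u 0%nat + Csum (fun n => u (S n)))%C.
Proof.
  intros Hu.
  apply injective_projections; simpl;
  apply Series_incr_1, ex_series_Rabs; [now apply ex_series_Re|now apply ex_series_Im].
Qed.

Lemma abs_summable_S (u : nat -> C) :
  abs_summable u <-> abs_summable (fun n => u (S n)).
Proof. apply (ex_series_incr_1 (V := R_NormedModule)). Qed.

(** [sum_n] includes the index [N], so for an absolutely summable [u] this is the sum of the moduli
    over n > N, the explicit error term of all later truncations. *)
Definition tail (u : nat -> C) (N : nat) : R :=
  Series (fun n => Cmod (u n)) - sum_n (fun n => Cmod (u n)) N.

Lemma tail_lim (u : nat -> C) : abs_summable u ->
  forall eps, 0 < eps -> exists N0, forall N, (N0 <= N)%nat -> tail u N < eps.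
Proof.
  intros Hu eps He.
  generalize (proj1 (filterlim_locally _ _) (Series_correct _ Hu) (mkposreal eps He)).
  intros [N0 H]. exists N0. intros N HN. specialize (H N HN).
  unfold ball in H; simpl in H. unfold AbsRing_ball, abs, minus, plus, opp in H; simpl in H.
  apply Rabs_def2 in H. destruct H as [_ H]. unfold tail.
  change (- eps < sum_n (fun n => Cmod (u n)) N - Series (fun n => Cmod (u n))) in H.
  lra.
Qed.

Lemma Cmod_Csum_minus_sum_n (u : nat -> C) (N : nat) : abs_summable u ->
  Cmod (Csum u - sum_n u N) <= tail u N.
Proof.
  intros Hu.
  apply (Cmod_is_Cseries_le (fun n => u (S N + n)%nat) (fun n => Cmod (u (S N + n)%nat))).
  - apply (is_series_incr_n (V := C_NormedModule) u (S N)); [lia|].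
    replace (plus _ _) with (Csum u); [now apply Csum_correct|].
    change (Csum u = Csum u - sum_n u N + sum_n u N)%C. ring.
  - apply (is_series_incr_n (fun n => Cmod (u n)) (S N)); [lia|].
    replace (plus _ _) with (Series (fun n => Cmod (u n))); [now apply Series_correct|].
    change (Series (fun n => Cmod (u n)) = tail u N + sum_n (fun n => Cmod (u n)) N).
    unfold tail. ring.
  - intros n. apply Rle_refl.
Qed.

Lemma sum_n_nonneg (u : nat -> R) (N : nat) :
  (forall n, 0 <= u n) -> 0 <= sum_n u N.
Proof.
  intros H. induction N as [|N IH].
  - rewrite sum_O. apply H.
  - rewrite sum_Sn. apply Rplus_le_le_0_compat; [exact IH|apply H].
Qed.

Lemma Cmod_minus_sym (z w : C) : Cmod (z - w) = Cmod (w - z).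
Proof. rewrite <- Cmod_opp. f_equal. ring. Qed.

Lemma Cmod_le_plus_minus (z w : C) : Cmod w <= Cmod z + Cmod (z - w).
Proof.
  replace w with (z + - (z - w))%C at 1 by ring.
  rewrite <- (Cmod_opp (z - w)). apply Cmod_triangle.
Qed.

(** * The ring of formal power series *)

Definition fps : Type := nat -> C.

Definition fzero : fps := fun _ => RtoC 0.
Definition fconst (c : C) : fps := fun n => match n with O => c | S _ => RtoC 0 end.
Definition fone : fps := fconst (RtoC 1).
Definition fadd (a b : fps) : fps := fun n => (a n + b n)%C.
Definition fopp (a : fps) : fps := fun n => (- a n)%C.
Definition fsub (a b : fps) : fps := fun n => (a n - b n)%C.
Definition fshift (a : fps) : fps := fun n => a (S n).

(** The Cauchy product, by structural recursion on the index: the head of [a] is split off, and the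
    rest is a product with [fshift a]. Inductions on the index therefore keep [a] general. *)
Fixpoint fmul (a b : fps) (n : nat) {struct n} : C :=
  match n with
  | O => (a 0%nat * b 0%nat)%C
  | S m => (a 0%nat * b n + fmul (fshift a) b m)%C
  end.

Lemma fmul_fadd_l (a b c : fps) (n : nat) :
  fmul (fadd a b) c n = (fmul a c n + fmul b c n)%C.
Proof.
  revert a b; induction n as [|n IH]; intros a b; simpl.
  - unfold fadd. ring.
  - change (fshift (fadd a b)) with (fadd (fshift a) (fshift b)).
    rewrite IH. unfold fadd. ring.
Qed.

Lemma fmul_scal_l (x : C) (a b : fps) (n : nat) :
  fmul (fun i => x * a i)%C b n = (x * fmul a b n)%C.
Proof.
  revert a; induction n as [|n IH]; intros a; simpl; [ring|].
  change (fshift (fun i => x * a i)%C) with (fun i => x * fshift a i)%C.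
  rewrite IH. ring.
Qed.

(** The mirror recursion, splitting off the head of [b]; commutativity follows by comparing it with
    the definition. *)
Lemma fmul_S_r (a b : fps) (n : nat) :
  fmul a b (S n) = (a (S n) * b 0%nat + fmul a (fshift b) n)%C.
Proof.
  revert a; induction n as [|n IH]; intros a.
  - simpl. unfold fshift. ring.
  - change (fmul a b (S (S n))) with (a 0%nat * b (S (S n)) + fmul (fshift a) b (S n))%C.
    rewrite IH. change (fshift a (S n)) with (a (S (S n))).
    change (fmul a (fshift b) (S n))
      with (a 0%nat * b (S (S n)) + fmul (fshift a) (fshift b) n)%C.
    ring.
Qed.

Lemma fmul_comm (a b : fps) : fmul a b = fmul b a.
Proof.
  apply functional_extensionality. intros n. revert a b.
  induction n as [|n IH]; intros a b.
  - simpl. ring.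
  - rewrite fmul_S_r, IH. simpl. ring.
Qed.

Lemma fmul_assoc (a b c : fps) : fmul a (fmul b c) = fmul (fmul a b) c.
Proof.
  apply functional_extensionality. intros n. revert a.
  induction n as [|n IH]; intros a.
  - simpl. ring.
  - change (fmul a (fmul b c) (S n))
      with (a 0%nat * fmul b c (S n) + fmul (fshift a) (fmul b c) n)%C.
    change (fmul (fmul a b) c (S n))
      with (a 0%nat * b 0%nat * c (S n) + fmul (fshift (fmul a b)) c n)%C.
    change (fshift (fmul a b))
      with (fadd (fun i => a 0%nat * fshift b i)%C (fmul (fshift a) b)).
    rewrite fmul_fadd_l, fmul_scal_l, IH. simpl. ring.
Qed.

Lemma fmul_fzero_l (a : fps) (n : nat) : fmul fzero a n = RtoC 0.
Proof.
  induction n as [|n IH]; simpl; unfold fzero at 1; [ring|].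
  change (fshift fzero) with fzero. rewrite IH. ring.
Qed.

Lemma fmul_fconst_l (x : C) (a : fps) (n : nat) : fmul (fconst x) a n = (x * a n)%C.
Proof.
  destruct n as [|n]; simpl; [reflexivity|].
  change (fshift (fconst x)) with fzero. rewrite fmul_fzero_l. ring.
Qed.

(** Functional extensionality gives Leibniz equality of whole sequences, so an identity proved by
    [ring] can be rewritten inside [Ev] or [AC]. *)
Lemma fps_ring : ring_theory fzero fone fadd fmul fsub fopp eq.
Proof.
  constructor; intros; try apply functional_extensionality; intros;
    try (unfold fadd, fsub, fopp, fzero; ring).
  - unfold fone. rewrite fmul_fconst_l. ring.
  - now rewrite fmul_comm.
  - now rewrite fmul_assoc.
  - apply fmul_fadd_l.
Qed.

Add Ring fps_ring : fps_ring.

(* The type of [fmul a b] is displayed as [nat -> C], for which no ring is declared. *)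
Ltac fring := match goal with |- ?x = ?y =>
  let H := fresh in
  assert (H : @eq fps (fadd fzero x) (fadd fzero y)) by ring;
  rewrite !(Radd_0_l fps_ring) in H; exact H end.

Fixpoint fpow (a : fps) (n : nat) : fps :=
  match n with O => fone | S m => fmul a (fpow a m) end.

(** The substitution of t z for z. It is multiplicative and moves the circle of radius t to the unit
    circle, where the averages live. *)
Definition fscale (t : C) (a : fps) : fps := fun n => (a n * t ^ n)%C.

Lemma fmul_fscale (t : C) (a b : fps) :
  fmul (fscale t a) (fscale t b) = fscale t (fmul a b).
Proof.
  apply functional_extensionality. intros n. revert a.
  induction n as [|n IH]; intros a; unfold fscale.
  - simpl. ring.
  - simpl. change (fshift (fun n => a n * t ^ n)%C) with (fun n => a (S n) * t ^ S n)%C.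
    replace (fun n => a (S n) * t ^ S n)%C with (fun i => t * fscale t (fshift a) i)%C.
    + rewrite fmul_scal_l. change (fun n => b n * t ^ n)%C with (fscale t b).
      rewrite IH. unfold fscale. simpl. ring.
    + apply functional_extensionality. intros i. unfold fscale, fshift. simpl. ring.
Qed.

Lemma fscale_fone (t : C) : fscale t fone = fone.
Proof.
  apply functional_extensionality. intros [|n]; unfold fscale; simpl; ring.
Qed.

(* Strong recursion is encoded by computing the list of the first [n + 1]
   coefficients at once, as a function that is constant beyond [n]. *)
Fixpoint finv_upto (a : fps) (n : nat) : fps :=
  match n with
  | O => fun _ => (/ a 0%nat)%C
  | S m => fun i => if Nat.leb i m then finv_upto a m i
                    else (- / a 0%nat * fmul (fshift a) (finv_upto a m) m)%C
  end.

Definition finv (a : fps) : fps := fun n => finv_upto a n n.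

(** A coefficient of a product reads only coefficients up to its own index, which is why truncated
    inverses can be extended consistently. *)
Lemma fmul_ext_upto (a b c : fps) (n : nat) :
  (forall i, (i <= n)%nat -> b i = c i) -> fmul a b n = fmul a c n.
Proof.
  revert a; induction n as [|n IH]; intros a H; simpl.
  - now rewrite H.
  - rewrite H by lia. rewrite IH by (intros; apply H; lia). reflexivity.
Qed.

Lemma finv_upto_eq (a : fps) (n i : nat) : (i <= n)%nat -> finv_upto a n i = finv a i.
Proof.
  intros Hi. unfold finv. induction n as [|n IH].
  - now replace i with 0%nat by lia.
  - destruct (Nat.eq_dec i (S n)) as [->|Hn]; [reflexivity|].
    simpl. rewrite (proj2 (Nat.leb_le _ _)) by lia. apply IH. lia.
Qed.

Lemma fmul_finv (a : fps) : a 0%nat <> RtoC 0 -> fmul a (finv a) = fone.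
Proof.
  intros Ha. apply functional_extensionality. intros [|n].
  - unfold finv, fone; simpl. now field.
  - cbn [fmul].
    replace (finv a (S n)) with (- / a 0%nat * fmul (fshift a) (finv a) n)%C.
    + unfold fone; simpl. now field.
    + unfold finv at 2. cbn [finv_upto]. rewrite (proj2 (Nat.leb_gt _ _)) by lia.
      f_equal. apply fmul_ext_upto. intros i Hi. symmetry. now apply finv_upto_eq.
Qed.

Lemma sum_n_S_left {G : AbelianMonoid} (u : nat -> G) (N : nat) :
  sum_n u (S N) = plus (u 0%nat) (sum_n (fun n => u (S n)) N).
Proof.
  induction N as [|N IH].
  - now rewrite sum_Sn, !sum_O.
  - rewrite sum_Sn, IH, sum_Sn. now rewrite plus_assoc.
Qed.

(** The index pairs i + j <= N of the left side form a triangle inside the square i, j <= N of the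
    right side. This finite form of submultiplicativity needs no convergence and carries the
    majorant estimates at the end. *)
Lemma Cmod_sum_fmul_le (a b : fps) (N : nat) :
  sum_n (fun n => Cmod (fmul a b n)) N <=
  sum_n (fun n => Cmod (a n)) N * sum_n (fun n => Cmod (b n)) N.
Proof.
  revert a; induction N as [|N IH]; intros a.
  - rewrite !sum_O. simpl. rewrite Cmod_mult. apply Rle_refl.
  - assert (H1 : sum_n (fun n => Cmod (fmul a b n)) (S N) <=
      Cmod (a 0%nat) * sum_n (fun n => Cmod (b n)) (S N)
      + sum_n (fun n => Cmod (fmul (fshift a) b n)) N).
    { rewrite !sum_n_S_left.
      change (Cmod (fmul a b 0) + sum_n (fun n => Cmod (fmul a b (S n))) N <=
        Cmod (a 0%nat) * (Cmod (b 0%nat) + sum_n (fun n => Cmod (b (S n))) N)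
        + sum_n (fun n => Cmod (fmul (fshift a) b n)) N).
      assert (H : sum_n (fun n => Cmod (fmul a b (S n))) N <=
        Cmod (a 0%nat) * sum_n (fun n => Cmod (b (S n))) N
        + sum_n (fun n => Cmod (fmul (fshift a) b n)) N).
      { clear IH. induction N as [|N IH].
        - rewrite !sum_O. simpl.
          rewrite <- Cmod_mult. apply Cmod_triangle.
        - rewrite !sum_Sn.
          change (sum_n (fun n => Cmod (fmul a b (S n))) N + Cmod (fmul a b (S (S N))) <=
            Cmod (a 0%nat) * (sum_n (fun n => Cmod (b (S n))) N + Cmod (b (S (S N))))
            + (sum_n (fun n => Cmod (fmul (fshift a) b n)) N
               + Cmod (fmul (fshift a) b (S N)))).
          assert (H : Cmod (fmul a b (S (S N))) <=
            Cmod (a 0%nat) * Cmod (b (S (S N))) + Cmod (fmul (fshift a) b (S N))).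
          { rewrite <- Cmod_mult. apply Cmod_triangle. }
          lra. }
      change (fmul a b 0%nat) with (a 0%nat * b 0%nat)%C. rewrite Cmod_mult. lra. }
    apply Rle_trans with (1 := H1).
    rewrite (sum_n_S_left (fun n => Cmod (a n))).
    change (Cmod (a 0%nat) * sum_n (fun n => Cmod (b n)) (S N)
      + sum_n (fun n => Cmod (fmul (fshift a) b n)) N <=
      (Cmod (a 0%nat) + sum_n (fun n => Cmod (fshift a n)) N)
      * sum_n (fun n => Cmod (b n)) (S N)).
    rewrite Rmult_plus_distr_r. apply Rplus_le_compat_l.
    apply Rle_trans with (1 := IH _). apply Rmult_le_compat_l.
    + apply sum_n_nonneg. intros n. apply Cmod_ge_0.
    + rewrite sum_Sn. rewrite <- (Rplus_0_r (sum_n _ N)) at 1.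
      apply Rplus_le_compat_l, Cmod_ge_0.
Qed.

Lemma ex_series_bounded (u : nat -> R) (M : R) :
  (forall n, 0 <= u n) -> (forall N, sum_n u N <= M) -> ex_series u.
Proof.
  intros H0 HM. apply ex_finite_lim_seq_incr with (M := M).
  - intros N. rewrite sum_Sn. rewrite <- (Rplus_0_r (sum_n u N)) at 1.
    apply Rplus_le_compat_l, H0.
  - exact HM.
Qed.

Lemma abs_summable_fmul (a b : fps) :
  abs_summable a -> abs_summable b -> abs_summable (fmul a b).
Proof.
  intros Ha Hb.
  apply (ex_series_bounded _ (Series (fun n => Cmod (a n)) * Series (fun n => Cmod (b n)))).
  - intros n. apply Cmod_ge_0.
  - intros N. apply Rle_trans with (1 := Cmod_sum_fmul_le a b N).
    apply Rmult_le_compat; try (apply sum_n_nonneg; intros; apply Cmod_ge_0);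
      apply sum_n_le_Series; auto using Cmod_ge_0.
Qed.

Lemma Cmod_Csum_fmul_le (a b : fps) : abs_summable a -> abs_summable b ->
  Cmod (Csum (fmul a b)) <=
  Series (fun n => Cmod (a n)) * Series (fun n => Cmod (b n)).
Proof.
  intros Ha Hb.
  apply Rle_trans with (Series (fun n => Cmod (fmul a b n))).
  { apply Cmod_Csum_le; [intros; apply Rle_refl|now apply abs_summable_fmul]. }
  apply (is_lim_seq_le (sum_n (fun n => Cmod (fmul a b n)))
    (fun _ => Series (fun n => Cmod (a n)) * Series (fun n => Cmod (b n)))
    (Finite _) (Finite _)).
  - intros N. apply Rle_trans with (1 := Cmod_sum_fmul_le a b N).
    apply Rmult_le_compat; try (apply sum_n_nonneg; intros; apply Cmod_ge_0);
      apply sum_n_le_Series; auto using Cmod_ge_0.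
  - apply Series_correct. now apply abs_summable_fmul.
  - apply is_lim_seq_const.
Qed.

(** Splitting off the first N + 1 coefficients of [a] leaves a product with the remainder of [a],
    which is at most [tail a N] times the majorant of [b]; the same bound holds for the error in the
    sum of [a]. *)
Lemma Csum_fmul (a b : fps) : abs_summable a -> abs_summable b ->
  Csum (fmul a b) = (Csum a * Csum b)%C.
Proof.
  intros Ha Hb.
  assert (Hsh : forall N, abs_summable (fun n => a (S N + n)%nat)).
  { intros N. now apply (ex_series_incr_n (fun n => Cmod (a n)) (S N)). }
  assert (step : forall c : fps, abs_summable c ->
    Csum (fmul c b) = (c 0%nat * Csum b + Csum (fmul (fshift c) b))%C).
  { intros c Hc.
    assert (Hc' := proj1 (abs_summable_S c) Hc).
    rewrite Csum_incr_1 by now apply abs_summable_fmul.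
    change (fun n => fmul c b (S n))
      with (fun n => (c 0%nat * b (S n) + fmul (fshift c) b n)%C).
    assert (Hb' := proj1 (abs_summable_S b) Hb).
    rewrite (Csum_plus (fun n => c 0%nat * b (S n))%C).
    - rewrite Csum_scal by exact Hb'. rewrite (Csum_incr_1 b) by exact Hb. simpl. ring.
    - now apply abs_summable_scal.
    - now apply abs_summable_fmul. }
  assert (iter : forall N, Csum (fmul a b) =
    (sum_n a N * Csum b + Csum (fmul (fun n => a (S N + n)%nat) b))%C).
  { induction N as [|N IH].
    - rewrite sum_O. now apply step.
    - rewrite IH, (step (fun n => a (S N + n)%nat)) by apply Hsh.
      rewrite sum_Sn.
      change (plus (sum_n a N) (a (S N))) with (sum_n a N + a (S N))%C.
      rewrite Nat.add_0_r.
      replace (fshift (fun n => a (S N + n)%nat)) with (fun n => a (S (S N) + n)%nat).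
      + ring.
      + apply functional_extensionality. intros n. unfold fshift. f_equal. lia. }
  set (B := Series (fun n => Cmod (b n))).
  assert (HB : 0 <= B).
  { apply Rle_trans with (2 := sum_n_le_Series (fun n => Cmod (b n)) 0
      (fun n => Cmod_ge_0 _) Hb). rewrite sum_O. apply Cmod_ge_0. }
  assert (HCB : Cmod (Csum b) <= B) by (apply Cmod_Csum_le; [intros; apply Rle_refl|exact Hb]).
  assert (est : forall N, Cmod (Csum (fmul a b) - Csum a * Csum b) <= 2 * tail a N * B).
  { intros N. rewrite (iter N).
    replace (sum_n a N * Csum b + Csum (fmul (fun n => a (S N + n)%nat) b) - Csum a * Csum b)%C
      with (Csum (fmul (fun n => a (S N + n)%nat) b) - (Csum a - sum_n a N) * Csum b)%C by ring.
    apply Rle_trans with (1 := Cmod_triangle _ _). rewrite Cmod_opp, Cmod_mult.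
    assert (H1 := Cmod_Csum_fmul_le _ _ (Hsh N) Hb). fold B in H1.
    assert (H2 := Cmod_Csum_minus_sum_n a N Ha).
    assert (H3 : Series (fun n => Cmod (a (S N + n)%nat)) = tail a N).
    { unfold tail. rewrite (Series_incr_n (fun n => Cmod (a n)) (S N)); [|lia|exact Ha].
      rewrite <- sum_n_Reals. simpl pred. ring. }
    cbv beta in H1. rewrite H3 in H1.
    assert (H4 : Cmod (Csum a - sum_n a N) * Cmod (Csum b) <= tail a N * B).
    { apply Rmult_le_compat; auto using Cmod_ge_0. }
    lra. }
  destruct (Req_dec (Cmod (Csum (fmul a b) - Csum a * Csum b)) 0) as [E|E].
  - apply Cmod_eq_0 in E.
    replace (Csum (fmul a b)) with (Csum (fmul a b) - Csum a * Csum b + Csum a * Csum b)%C by ring.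
    rewrite E. ring.
  - exfalso. assert (H0 := Cmod_ge_0 (Csum (fmul a b) - Csum a * Csum b)).
    revert est E H0. generalize (Cmod (Csum (fmul a b) - Csum a * Csum b)).
    intros e est E H0. assert (He : 0 < e) by (destruct H0; [assumption|congruence]).
    (* The threshold uses B + 1 because B may be 0; the factor 2 matches the two tails in [est]. *)
    assert (Hpos : 0 < e / (2 * (B + 1))) by (apply Rdiv_lt_0_compat; lra).
    destruct (tail_lim a Ha _ Hpos) as [N0 H].
    specialize (H N0 (le_n _)). specialize (est N0).
    assert (H1 : tail a N0 * (2 * (B + 1)) < e).
    { apply Rmult_lt_compat_r with (r := 2 * (B + 1)) in H; [|lra].
      replace (e / (2 * (B + 1)) * (2 * (B + 1))) with e in H; [exact H|field; lra]. }
    assert (0 <= tail a N0).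
    { apply Rle_trans with (2 := Cmod_Csum_minus_sum_n a N0 Ha), Cmod_ge_0. }
    nra.
Qed.

(** * Power series *)

Definition AC (a : fps) (t : R) : Prop := abs_summable (fscale t a).

Definition Ev (a : fps) (z : C) : C := Csum (fscale z a).

Lemma Cmod_fscale (a : fps) (z : C) (n : nat) :
  Cmod (fscale z a n) = Cmod (a n) * Cmod z ^ n.
Proof. unfold fscale. now rewrite Cmod_mult, Cmod_pow. Qed.

Lemma Cmod_fscale_R (a : fps) (t : R) (n : nat) : 0 <= t ->
  Cmod (fscale t a n) = Cmod (a n) * t ^ n.
Proof. intros Ht. now rewrite Cmod_fscale, Cmod_R, Rabs_pos_eq. Qed.

Lemma AC_ex_series (a : fps) (t : R) : 0 <= t ->
  AC a t <-> ex_series (fun n => Cmod (a n) * t ^ n).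
Proof.
  intros Ht. unfold AC, abs_summable.
  replace (fun n => Cmod (fscale t a n)) with (fun n => Cmod (a n) * t ^ n); [tauto|].
  apply functional_extensionality. intros n. now rewrite Cmod_fscale_R.
Qed.

Lemma AC_le (a : fps) (s t : R) : 0 <= s <= t -> AC a t -> AC a s.
Proof.
  intros Hst Ha. apply AC_ex_series in Ha; [|lra].
  apply abs_summable_le with (2 := Ha). intros n. rewrite Cmod_fscale_R by lra.
  apply Rmult_le_compat_l; [apply Cmod_ge_0|now apply pow_incr].
Qed.

Lemma AC_disk (a : fps) (t : R) (z : C) : Cmod z <= t -> AC a t ->
  abs_summable (fscale z a).
Proof.
  intros Hz Ha. assert (H0 := Cmod_ge_0 z).
  apply (AC_le a (Cmod z) t) in Ha; [|lra].
  apply AC_ex_series in Ha; [|lra]. apply abs_summable_le with (2 := Ha).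
  intros n. rewrite Cmod_fscale. apply Rle_refl.
Qed.

(** Abel's lemma, by comparison with the geometric series of ratio t / s. It lets all convergence
    proofs reduce to bounded coefficients at a slightly larger radius. *)
Lemma AC_bounded (a : fps) (M s t : R) : 0 <= t < s ->
  (forall n, Cmod (a n) * s ^ n <= M) -> AC a t.
Proof.
  intros Ht HM. apply AC_ex_series; [lra|].
  apply (ex_series_le (V := R_CompleteNormedModule) _ (fun n => M * (t / s) ^ n)).
  - intros n. unfold norm; simpl. unfold abs; simpl.
    rewrite Rabs_pos_eq.
    2: { apply Rmult_le_pos; [apply Cmod_ge_0|apply pow_le; lra]. }
    replace (Cmod (a n) * t ^ n) with (Cmod (a n) * s ^ n * (t / s) ^ n).
    + apply Rmult_le_compat_r; [|apply HM]. apply pow_le.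
      apply Rdiv_le_0_compat; lra.
    + unfold Rdiv. rewrite Rpow_mult_distr, pow_inv. field. apply pow_nonzero. lra.
  - apply (ex_series_scal_l M (fun n => (t / s) ^ n)).
    apply ex_series_geom. rewrite Rabs_pos_eq.
    + apply Rmult_lt_reg_r with s; [lra|]. unfold Rdiv. rewrite Rmult_assoc, Rinv_l; lra.
    + apply Rdiv_le_0_compat; lra.
Qed.

Lemma AC_term_le (a : fps) (t : R) : 0 <= t -> AC a t ->
  exists M, 0 <= M /\ forall n, Cmod (a n) * t ^ n <= M.
Proof.
  intros Ht Ha. exists (Series (fun n => Cmod (fscale t a n))).
  assert (H : forall n, Cmod (a n) * t ^ n <= Series (fun n => Cmod (fscale t a n))).
  { intros n. apply Rle_trans with (2 := sum_n_le_Series _ n (fun n => Cmod_ge_0 _) Ha).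
    rewrite <- Cmod_fscale_R by assumption. destruct n as [|n].
    - rewrite sum_O. apply Rle_refl.
    - rewrite sum_Sn. rewrite <- (Rplus_0_l (Cmod _)) at 1. apply Rplus_le_compat_r.
      apply sum_n_nonneg. intros; apply Cmod_ge_0. }
  split; [|exact H]. apply Rle_trans with (2 := H 0%nat).
  apply Rmult_le_pos; [apply Cmod_ge_0|apply pow_le, Ht].
Qed.

Lemma AC_fmul (a b : fps) (t : R) : AC a t -> AC b t -> AC (fmul a b) t.
Proof. unfold AC. rewrite <- fmul_fscale. apply abs_summable_fmul. Qed.

Lemma Ev_fmul (a b : fps) (t : R) (z : C) : Cmod z <= t -> AC a t -> AC b t ->
  Ev (fmul a b) z = (Ev a z * Ev b z)%C.
Proof.
  intros Hz Ha Hb. unfold Ev. rewrite <- fmul_fscale.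
  apply Csum_fmul; eapply AC_disk; eauto.
Qed.

Lemma AC_fadd (a b : fps) (t : R) : AC a t -> AC b t -> AC (fadd a b) t.
Proof.
  unfold AC. intros Ha Hb.
  replace (fscale t (fadd a b)) with (fun n => fscale t a n + fscale t b n)%C.
  - now apply abs_summable_plus.
  - apply functional_extensionality; intros n; unfold fscale, fadd; ring.
Qed.

Lemma Ev_fadd (a b : fps) (t : R) (z : C) : Cmod z <= t -> AC a t -> AC b t ->
  Ev (fadd a b) z = (Ev a z + Ev b z)%C.
Proof.
  intros Hz Ha Hb. unfold Ev. rewrite <- Csum_plus; try (eapply AC_disk; eauto).
  apply Csum_ext. intros n. unfold fscale, fadd. ring.
Qed.

Lemma Csum_finite (u : nat -> C) (N : nat) :
  (forall n, (N < n)%nat -> u n = RtoC 0) -> is_Cseries u (sum_n u N).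
Proof.
  intros H. unfold is_series. apply filterlim_ext_loc with (fun _ => sum_n u N).
  - exists N. intros n Hn. induction Hn as [|n Hn IH]; [reflexivity|].
    rewrite sum_Sn, <- IH, H by lia.
    symmetry. apply Cplus_0_r.
  - apply filterlim_const.
Qed.

Lemma AC_finite (a : fps) (N : nat) (t : R) :
  (forall n, (N < n)%nat -> a n = RtoC 0) -> AC a t.
Proof.
  intros H. apply (ex_series_incr_n (fun n => Cmod (fscale t a n)) (S N)).
  apply (ex_series_ext (fun n => 0 * 0 ^ n)).
  - intros n. unfold fscale. rewrite H by lia.
    replace (RtoC 0 * _)%C with (RtoC 0) by ring. rewrite Cmod_0. apply Rmult_0_l.
  - apply (ex_series_scal_l 0 (fun n => 0 ^ n)), ex_series_geom. rewrite Rabs_R0. lra.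
Qed.

Lemma AC_fconst (c : C) (t : R) : AC (fconst c) t.
Proof. apply AC_finite with 0%nat. intros [|n] H; [lia|reflexivity]. Qed.

Lemma Ev_fconst (c z : C) : Ev (fconst c) z = c.
Proof.
  unfold Ev. apply is_Cseries_unique.
  replace c with (sum_n (fscale z (fconst c)) 0) at 2.
  - apply Csum_finite. intros [|n] H; [lia|]. unfold fscale; simpl. ring.
  - rewrite sum_O. unfold fscale; simpl. cring.
Qed.

Lemma Ev_fone (z : C) : Ev fone z = 1.
Proof. apply Ev_fconst. Qed.

(** The polynomial p + q z. It serves as the factor z - z0, as the Blaschke factor, as
    multiplication by z ([flin 0 1]) and as the Moebius denominator. *)
Definition flin (p q : C) : fps :=
  fun n => match n with O => p | S O => q | _ => RtoC 0 end.

Lemma AC_flin (p q : C) (t : R) : AC (flin p q) t.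
Proof. apply AC_finite with 1%nat. intros [|[|n]] H; [lia|lia|reflexivity]. Qed.

Lemma Ev_flin (p q z : C) : Ev (flin p q) z = (p + q * z)%C.
Proof.
  unfold Ev. apply is_Cseries_unique.
  replace (p + q * z)%C with (sum_n (fscale z (flin p q)) 1).
  - apply Csum_finite. intros [|[|n]] H; [lia|lia|]. unfold fscale; simpl. ring.
  - rewrite sum_Sn, sum_O.
    change (fscale z (flin p q) 0%nat + fscale z (flin p q) 1%nat = p + q * z)%C.
    unfold fscale; simpl. ring.
Qed.

Lemma fmul_flin_S (p q : C) (a : fps) (n : nat) :
  fmul (flin p q) a (S n) = (p * a (S n) + q * a n)%C.
Proof.
  cbn [fmul].
  change (fshift (flin p q)) with (fconst q). now rewrite fmul_fconst_l.
Qed.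

Lemma Ev_fscale (a : fps) (t z : C) : Ev (fscale t a) z = Ev a (t * z)%C.
Proof.
  unfold Ev. apply Csum_ext. intros n. unfold fscale. rewrite Cpow_mult_l. ring.
Qed.

Lemma AC_fscale (a : fps) (s t : R) : AC (fscale s a) t <-> AC a (s * t).
Proof.
  unfold AC.
  replace (fscale t (fscale s a)) with (fscale (s * t)%R a); [tauto|].
  apply functional_extensionality. intros n. unfold fscale.
  rewrite RtoC_mult, Cpow_mult_l. ring.
Qed.

Lemma Ev_0 (a : fps) : Ev a (RtoC 0) = a 0%nat.
Proof.
  unfold Ev. apply is_Cseries_unique.
  replace (a 0%nat) with (sum_n (fscale 0 a) 0).
  - apply Csum_finite. intros [|n] H; [lia|]. unfold fscale; simpl. ring.
  - rewrite sum_O. unfold fscale; simpl. cring.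
Qed.

Lemma Cmod_Ev_le (a : fps) (t : R) (z : C) : Cmod z <= t -> AC a t ->
  Cmod (Ev a z) <= Series (fun n => Cmod (a n) * t ^ n).
Proof.
  intros Hz Ha. assert (H0 := Cmod_ge_0 z). apply Cmod_Csum_le.
  - intros n. rewrite Cmod_fscale. apply Rmult_le_compat_l; [apply Cmod_ge_0|].
    apply pow_incr. lra.
  - apply AC_ex_series; [lra|exact Ha].
Qed.

(** The working notion of an analytic function on the unit disk: a coefficient sequence, evaluated
    by [Ev]. *)
Definition rad1 (a : fps) : Prop := forall t, 0 <= t < 1 -> AC a t.

Lemma is_pseries_rad1 (a : fps) (h : C -> C) :
  (forall z, disk z -> is_pseries (K := C_AbsRing) (V := C_NormedModule) a z (h z)) ->
  rad1 a /\ forall z, disk z -> h z = Ev a z.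
Proof.
  intros H.
  assert (Hpow : forall (z : C) n, pow_n (K := C_Ring) z n = (z ^ n)%C).
  { intros z n. induction n as [|n IH]; [reflexivity|]. simpl. now rewrite IH. }
  assert (Hs : forall z, disk z -> is_Cseries (fscale z a) (h z)).
  { intros z Hz. generalize (H z Hz). unfold is_pseries. apply is_series_ext.
    intros n. change (scal (pow_n (K := C_Ring) z n) (a n)) with (pow_n (K := C_Ring) z n * a n)%C.
    rewrite Hpow. unfold fscale. apply Cmult_comm. }
  split.
  - intros t Ht. set (s := (1 + t) / 2).
    assert (Hsd : disk (RtoC s)).
    { unfold disk, s. rewrite Cmod_R, Rabs_pos_eq; lra. }
    assert (Hb : exists M, forall n, Cmod (a n) * s ^ n <= M).
    { assert (Hlim := filterlim_norm (V := C_NormedModule) (h (RtoC s))).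
      assert (L := filterlim_comp _ _ _ _ _ _ _ _ (Hs _ Hsd) Hlim).
      assert (HB : exists M, forall N, Cmod (sum_n (fscale s a) N) <= M).
      { destruct (filterlim_bounded (fun N => sum_n (fscale s a) N)) as [M HM].
        - exists (h (RtoC s)). apply Hs, Hsd.
        - exists M. exact HM. }
      (* Each term is the difference of two consecutive partial sums, both bounded by M. *)
      destruct HB as [M HM]. exists (2 * M). intros n.
      rewrite <- Cmod_fscale_R by (unfold s; lra).
      assert (HM0 : 0 <= M) by (apply Rle_trans with (2 := HM 0%nat), Cmod_ge_0).
      destruct n as [|n].
      - specialize (HM 0%nat). rewrite sum_O in HM. lra.
      - assert (E : fscale s a (S n) = (sum_n (fscale s a) (S n) - sum_n (fscale s a) n)%C).
        { rewrite sum_Sn.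
          change (fscale s a (S n) = sum_n (fscale s a) n + fscale s a (S n) - sum_n (fscale s a) n)%C.
          ring. }
        rewrite E. apply Rle_trans with (1 := Cmod_triangle _ _). rewrite Cmod_opp.
        generalize (HM (S n)), (HM n). lra. }
    destruct Hb as [M HM]. apply AC_bounded with M s; [unfold s; lra|exact HM].
  - intros z Hz. symmetry. apply is_Cseries_unique, Hs, Hz.
Qed.

Lemma rad1_is_pseries (a : fps) (z : C) : rad1 a -> disk z ->
  is_pseries (K := C_AbsRing) (V := C_NormedModule) a z (Ev a z).
Proof.
  intros Ha Hz.
  assert (Hpow : forall n, pow_n (K := C_Ring) z n = (z ^ n)%C).
  { intros n. induction n as [|n IH]; [reflexivity|]. simpl. now rewrite IH. }
  apply (is_series_ext (fscale z a)).
  - intros n. change (fscale z a n = pow_n (K := C_Ring) z n * a n)%C.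
    rewrite Hpow. apply Cmult_comm.
  - apply Csum_correct, AC_disk with (Cmod z); [apply Rle_refl|].
    apply Ha. split; [apply Cmod_ge_0|exact Hz].
Qed.

(** * Averages over roots of unity *)

Definition cis (x : R) : C := (cos x, sin x).

Lemma cis_plus (x y : R) : cis (x + y) = (cis x * cis y)%C.
Proof.
  unfold cis, Cmult; simpl. rewrite cos_plus, sin_plus. f_equal. ring.
Qed.

Lemma cis_0 : cis 0 = RtoC 1.
Proof. unfold cis. now rewrite cos_0, sin_0. Qed.

Lemma cis_pow (x : R) (n : nat) : (cis x ^ n)%C = cis (INR n * x).
Proof.
  induction n as [|n IH].
  - simpl. now rewrite Rmult_0_l, cis_0.
  - rewrite Cpow_S, IH, <- cis_plus, S_INR. f_equal. ring.
Qed.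

Lemma Cmod_cis (x : R) : Cmod (cis x) = 1.
Proof.
  unfold Cmod, cis, fst, snd. rewrite <- sqrt_1. f_equal.
  generalize (sin2_cos2 x). unfold Rsqr. intros H. rewrite <- H. ring.
Qed.

Lemma Cconj_cis (x : R) : Cconj (cis x) = cis (- x).
Proof. unfold Cconj, cis; simpl. now rewrite cos_neg, sin_neg. Qed.

Lemma cis_2PI_nat (n : nat) : cis (2 * PI * INR n) = RtoC 1.
Proof.
  replace (2 * PI * INR n) with (INR n * (2 * PI)) by ring.
  rewrite <- cis_pow. unfold cis. rewrite cos_2PI, sin_2PI. apply Cpow_1_l.
Qed.

Lemma cis_neq_1 (x : R) : x <> 0 -> - (2 * PI) < x < 2 * PI -> cis x <> RtoC 1.
Proof.
  intros H0 Hx E. apply (f_equal fst) in E. unfold cis, RtoC in E; simpl in E.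
  replace x with (2 * (x / 2)) in E by field. rewrite cos_2a_sin in E.
  assert (Hs : sin (x / 2) = 0) by nra.
  destruct (Rtotal_order x 0) as [H|[H|H]]; [|lra|].
  - assert (0 < sin (- (x / 2))) by (apply sin_gt_0; lra).
    rewrite sin_neg in *. lra.
  - assert (0 < sin (x / 2)) by (apply sin_gt_0; lra). lra.
Qed.

(** With N + 1 points the exponents 0, ..., N are pairwise distinct modulo the number of points, and
    the number of points is never 0. *)
Definition root (N j : nat) : C := cis (2 * PI * INR j / INR (S N)).

Definition avg (N : nat) (F : C -> C) : C :=
  (sum_n (fun j => F (root N j)) N / INR (S N))%C.

Lemma INR_S_neq0 (N : nat) : RtoC (INR (S N)) <> RtoC 0.
Proof.
  intros E. apply RtoC_inj in E. assert (H : 0 < INR (S N)) by (apply lt_0_INR; lia). lra.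
Qed.

Lemma sum_n_geom (x : C) (N : nat) :
  ((1 - x) * sum_n (fun j => x ^ j)%C N = 1 - x ^ S N)%C.
Proof.
  induction N as [|N IH].
  - rewrite sum_O. simpl. cring.
  - rewrite sum_Sn.
    change ((1 - x) * (sum_n (fun j => x ^ j) N + x ^ S N) = 1 - x ^ S (S N))%C.
    rewrite Cmult_plus_distr_l, IH. simpl. ring.
Qed.

Lemma avg_ext (N : nat) (F G : C -> C) :
  (forall j, F (root N j) = G (root N j)) -> avg N F = avg N G.
Proof.
  intros H. unfold avg. f_equal. apply sum_n_ext. exact H.
Qed.

Lemma avg_plus (N : nat) (F G : C -> C) :
  avg N (fun z => F z + G z)%C = (avg N F + avg N G)%C.
Proof.
  unfold avg.
  replace (sum_n (fun j => F (root N j) + G (root N j))%C N)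
    with (sum_n (fun j => F (root N j)) N + sum_n (fun j => G (root N j)) N)%C.
  - field. apply INR_S_neq0.
  - symmetry. exact (sum_n_plus (fun j => F (root N j)) (fun j => G (root N j)) N).
Qed.

Lemma avg_scal (N : nat) (c : C) (F : C -> C) :
  avg N (fun z => c * F z)%C = (c * avg N F)%C.
Proof.
  unfold avg.
  replace (sum_n (fun j => c * F (root N j))%C N)
    with (c * sum_n (fun j => F (root N j)) N)%C.
  - field. apply INR_S_neq0.
  - symmetry. exact (sum_n_mult_l (K := C_Ring) c (fun j => F (root N j)) N).
Qed.

(** The average is a geometric sum of ratio cis (2 PI (m - n) / (N + 1)). For m <> n the angle is
    nonzero and smaller than 2 PI in absolute value, so the ratio is a root of unity other than 1
    and the sum vanishes. *)
Lemma avg_orthogonal (N m n : nat) : (m <= N)%nat -> (n <= N)%nat ->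
  avg N (fun z => z ^ m * Cconj z ^ n)%C = if Nat.eq_dec m n then RtoC 1 else RtoC 0.
Proof.
  intros Hm Hn.
  set (th := 2 * PI * (INR m - INR n) / INR (S N)).
  assert (HN : 0 < INR (S N)) by (apply lt_0_INR; lia).
  assert (E : forall j, (root N j ^ m * Cconj (root N j) ^ n = cis th ^ j)%C).
  { intros j. unfold root. rewrite Cconj_cis, !cis_pow, <- cis_plus. f_equal.
    unfold th. field. lra. }
  unfold avg. rewrite (sum_n_ext _ (fun j => cis th ^ j)%C) by exact E.
  destruct (Nat.eq_dec m n) as [e|ne].
  - assert (T : th = 0) by (unfold th; rewrite e; field; lra).
    rewrite T, cis_0.
    replace (sum_n (fun j => 1 ^ j)%C N) with (RtoC (INR (S N))).
    + field. apply INR_S_neq0.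
    + clear. induction N as [|N IH].
      * rewrite sum_O. reflexivity.
      * rewrite sum_Sn, <- IH, Cpow_1_l, (S_INR (S N)), RtoC_plus. reflexivity.
  - assert (Hx : cis th <> RtoC 1).
    { assert (HP := PI_RGT_0).
      assert (Hm' := le_INR _ _ Hm). assert (Hn' := le_INR _ _ Hn).
      assert (Hm0 := pos_INR m). assert (Hn0 := pos_INR n).
      apply cis_neq_1.
      - unfold th. intros H. apply ne. apply INR_eq.
        assert (PI * (INR m - INR n) = 0).
        { replace (PI * (INR m - INR n)) with
            (2 * PI * (INR m - INR n) / INR (S N) * (INR (S N) / 2)) by (field; lra).
          rewrite H. ring. }
        nra.
      - rewrite S_INR in *. unfold th. rewrite S_INR.
        split; apply Rmult_lt_reg_r with (INR N + 1); try lra;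
        unfold Rdiv; rewrite ?Rmult_assoc, ?Rinv_l; nra. }
    assert (Hpow : (cis th ^ S N = 1)%C).
    { rewrite cis_pow. unfold th.
      replace (INR (S N) * (2 * PI * (INR m - INR n) / INR (S N)))
        with (2 * PI * INR m + - (2 * PI * INR n)) by (field; lra).
      rewrite cis_plus, <- Cconj_cis, !cis_2PI_nat.
      unfold Cconj, Cmult, RtoC; simpl. f_equal; ring. }
    assert (G := sum_n_geom (cis th) N). rewrite Hpow in G.
    replace (sum_n (fun j => cis th ^ j)%C N) with (RtoC 0).
    + field. apply INR_S_neq0.
    + replace (1 - 1)%C with (RtoC 0) in G by ring.
      assert (D : (1 - cis th)%C <> RtoC 0).
      { intros H. apply Hx. replace (cis th) with (1 - (1 - cis th))%C by ring.
        rewrite H. ring. }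
      replace (sum_n (fun j => cis th ^ j)%C N)
        with (/ (1 - cis th) * ((1 - cis th) * sum_n (fun j => cis th ^ j)%C N))%C.
      * rewrite G. ring.
      * field. exact D.
Qed.

Lemma Cmod_root (N j : nat) : Cmod (root N j) = 1.
Proof. apply Cmod_cis. Qed.

Lemma Cmod_avg_le (N : nat) (F : C -> C) (M : R) :
  (forall j, Cmod (F (root N j)) <= M) -> Cmod (avg N F) <= M.
Proof.
  intros H. unfold avg. assert (HN : 0 < INR (S N)) by (apply lt_0_INR; lia).
  rewrite Cmod_div by apply INR_S_neq0. rewrite Cmod_R, Rabs_pos_eq by lra.
  apply Rmult_le_reg_r with (INR (S N)); [exact HN|].
  unfold Rdiv. rewrite Rmult_assoc, Rinv_l, Rmult_1_r by lra.
  apply Rle_trans with (1 := Cmod_sum_n _ _).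
  apply Rle_trans with (sum_n (fun _ => M) N).
  - apply sum_n_m_le. exact H.
  - rewrite sum_n_const. lra.
Qed.

Lemma avg_partial_sum (a : fps) (N n K : nat) : (n <= N)%nat -> (K <= N)%nat ->
  avg N (fun z => sum_n (fscale z a) K * Cconj z ^ n)%C =
  if le_dec n K then a n else RtoC 0.
Proof.
  intros Hn. induction K as [|K IH]; intros HK.
  - rewrite (avg_ext _ _ (fun z => a 0%nat * (z ^ 0 * Cconj z ^ n))%C).
    + rewrite avg_scal, avg_orthogonal by lia.
      destruct (Nat.eq_dec 0 n) as [<-|Hne]; destruct (le_dec _ _); try lia; ring.
    + intros j. rewrite sum_O. unfold fscale. simpl. ring.
  - rewrite (avg_ext _ _ (fun z => sum_n (fscale z a) K * Cconj z ^ n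
      + a (S K) * (z ^ S K * Cconj z ^ n))%C).
    + rewrite avg_plus, avg_scal, avg_orthogonal, IH by lia.
      destruct (Nat.eq_dec (S K) n) as [<-|Hne];
        repeat destruct (le_dec _ _); try lia; ring.
    + intros j. rewrite sum_Sn.
      change ((sum_n (fscale (root N j) a) K + a (S K) * root N j ^ S K)
        * Cconj (root N j) ^ n = sum_n (fscale (root N j) a) K * Cconj (root N j) ^ n
        + a (S K) * (root N j ^ S K * Cconj (root N j) ^ n))%C.
      ring.
Qed.

(** The part of degree at most N is recovered exactly by orthogonality. The coefficients beyond N
    alias onto the average, and contribute at most [tail a N]. *)
Lemma avg_Ev (a : fps) (N n : nat) : abs_summable a -> (n <= N)%nat ->
  Cmod (avg N (fun z => Ev a z * Cconj z ^ n)%C - a n) <= tail a N.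
Proof.
  intros Ha Hn.
  assert (E : avg N (fun z => Ev a z * Cconj z ^ n)%C =
    (avg N (fun z => (Ev a z - sum_n (fscale z a) N) * Cconj z ^ n)%C + a n)%C).
  { replace (a n) with (avg N (fun z => sum_n (fscale z a) N * Cconj z ^ n)%C).
    - rewrite <- avg_plus. apply avg_ext. intros j. ring.
    - rewrite avg_partial_sum by lia. destruct (le_dec n N); [reflexivity|lia]. }
  rewrite E. replace (_ + a n - a n)%C with
    (avg N (fun z => (Ev a z - sum_n (fscale z a) N) * Cconj z ^ n)%C) by ring.
  apply Cmod_avg_le. intros j.
  rewrite Cmod_mult, Cmod_pow, Cmod_conj, Cmod_root, pow1, Rmult_1_r.
  assert (Ez : forall n, Cmod (fscale (root N j) a n) = Cmod (a n)).
  { intros k. rewrite Cmod_fscale, Cmod_root, pow1. ring. }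
  assert (Hz : (fun n => Cmod (fscale (root N j) a n)) = (fun n => Cmod (a n))).
  { apply functional_extensionality. exact Ez. }
  unfold Ev. apply Rle_trans with (tail (fscale (root N j) a) N).
  - apply Cmod_Csum_minus_sum_n. unfold abs_summable. now rewrite Hz.
  - unfold tail. rewrite Hz. apply Rle_refl.
Qed.

(** * Coefficient estimates of Cauchy, Caratheodory and Bohr *)

Lemma Rle_eps (x y : R) : (forall e, 0 < e -> x <= y + e) -> x <= y.
Proof.
  intros H. apply Rnot_lt_le. intros Hlt. specialize (H ((x - y) / 2)). lra.
Qed.

Lemma Cauchy_estimate_1 (a : fps) (M : R) (n : nat) : abs_summable a ->
  (forall z, Cmod z = 1 -> Cmod (Ev a z) <= M) -> Cmod (a n) <= M.
Proof.
  intros Ha HM. apply Rle_eps. intros e He.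
  destruct (tail_lim a Ha e He) as [N0 HN].
  set (N := (N0 + n)%nat). specialize (HN N ltac:(lia)).
  assert (H := avg_Ev a N n Ha ltac:(lia)).
  assert (H1 : Cmod (avg N (fun z => Ev a z * Cconj z ^ n)%C) <= M).
  { apply Cmod_avg_le. intros j.
    rewrite Cmod_mult, Cmod_pow, Cmod_conj, Cmod_root, pow1, Rmult_1_r.
    apply HM, Cmod_root. }
  replace (a n) with (avg N (fun z => Ev a z * Cconj z ^ n)%C
    - (avg N (fun z => Ev a z * Cconj z ^ n)%C - a n))%C by ring.
  apply Rle_trans with (1 := Cmod_triangle _ _). rewrite Cmod_opp. lra.
Qed.

Lemma phase (c : C) : exists p, Cmod p = 1 /\ c = (Cmod c * p)%C.
Proof.
  destruct (Req_dec (Cmod c) 0) as [E|E].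
  - exists (RtoC 1). split; [apply Cmod_1|]. rewrite E. apply Cmod_eq_0 in E. rewrite E. ring.
  - assert (H : RtoC (Cmod c) <> RtoC 0) by (intros H; now apply RtoC_inj in H).
    exists (c / Cmod c)%C. split.
    + rewrite Cmod_div by exact H. rewrite Cmod_R, Rabs_pos_eq by apply Cmod_ge_0.
      now field.
    + now field.
Qed.

Lemma tail_ge_term (a : fps) (N : nat) : abs_summable a -> Cmod (a (S N)) <= tail a N.
Proof.
  intros Ha. assert (H := sum_n_le_Series _ (S N) (fun n => Cmod_ge_0 (a n)) Ha).
  rewrite sum_Sn in H.
  change (sum_n (fun n => Cmod (a n)) N + Cmod (a (S N)) <= Series (fun n => Cmod (a n))) in H.
  unfold tail. lra.
Qed.

(* The functional [F |-> a_0 + v a_n / 2] is the mean of [F] on the circle against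
   the nonnegative weight [1 + Re (v z^-n)], whose own mean is [1]. *)
Lemma Caratheodory_estimate_1 (a : fps) (n : nat) : (1 <= n)%nat -> abs_summable a ->
  (forall z, Cmod z = 1 -> Cmod (Ev a z) <= 1) ->
  Cmod (a n) <= 2 * (1 - Cmod (a 0%nat)).
Proof.
  intros Hn1 Ha HM.
  destruct (phase (a 0%nat)) as [p [Hp Ep]]. destruct (phase (a n)) as [q [Hq Eq]].
  (* This unimodular factor turns the phase of [a n] into that of [a 0], so that the two moduli
     add. *)
  set (v := (p * Cconj q)%C).
  assert (Hv : Cmod v = 1) by (unfold v; rewrite Cmod_mult, Cmod_conj, Hp, Hq; ring).
  assert (Hhalf : Cmod (/ 2)%C = / 2).
  { rewrite Cmod_inv, Cmod_R, Rabs_pos_eq; try lra. intros H; apply RtoC_inj in H; lra. }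
  assert (Hsum : Cmod (a 0%nat + / 2 * v * a n) = Cmod (a 0%nat) + / 2 * Cmod (a n)).
  { rewrite Ep at 1. rewrite Eq at 1.
    replace (Cmod (a 0%nat) * p + / 2 * v * (Cmod (a n) * q))%C
      with (RtoC (Cmod (a 0%nat) + / 2 * Cmod (a n)) * p)%C.
    - rewrite Cmod_mult, Hp, Cmod_R, Rmult_1_r, Rabs_pos_eq; [reflexivity|].
      generalize (Cmod_ge_0 (a 0%nat)), (Cmod_ge_0 (a n)). lra.
    - rewrite RtoC_plus, RtoC_mult, RtoC_inv by lra. unfold v.
      replace (/ 2 * (p * Cconj q) * (Cmod (a n) * q))%C
        with (/ 2 * p * Cmod (a n) * (q * Cconj q))%C by ring.
      rewrite <- Cmod2_conj, Hq. replace (1 ^ 2) with 1 by ring. ring. }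
  enough (H : Cmod (a 0%nat + / 2 * v * a n) <= 1) by lra.
  apply Rle_eps. intros e He.
  assert (He4 : 0 < e / 4) by lra.
  destruct (tail_lim a Ha _ He4) as [N0 HN].
  (* Both N and N - n must lie beyond N0: the second because the coefficient of index N + 1 - n also
     has to be small. Four error terms share e. *)
  set (N := (N0 + n + n)%nat).
  assert (T1 := HN N ltac:(lia)). assert (T2 := HN (N - n)%nat ltac:(lia)).
  assert (A0 := avg_Ev a N 0 Ha ltac:(lia)).
  assert (A1 := avg_Ev a N n Ha ltac:(lia)).
  assert (A2 := avg_Ev a N (S (N - n)) Ha ltac:(lia)).
  assert (A3 := tail_ge_term a (N - n) Ha).
  set (W := fun z => (1 + / 2 * v * Cconj z ^ n + / 2 * Cconj v * z ^ n)%C).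
  (* Being equal to its own modulus states at once that the weight is real and nonnegative. *)
  assert (HW : forall j, RtoC (Cmod (W (root N j))) = W (root N j)).
  { intros j. set (x := (v * Cconj (root N j) ^ n)%C).
    assert (EW : W (root N j) = RtoC (1 + Re x)).
    { rewrite RtoC_plus, re_alt. unfold W, x.
      rewrite Cmult_conj, Cpow_conj, Cconj_conj. field. }
    assert (Hx : Cmod x = 1).
    { unfold x. rewrite Cmod_mult, Cmod_pow, Cmod_conj, Cmod_root, pow1, Hv. ring. }
    rewrite EW, Cmod_R, Rabs_pos_eq; [reflexivity|].
    assert (Hr := re_le_Cmod x). rewrite Hx in Hr. apply Rabs_le_between in Hr. lra. }
  assert (avgW : avg N W = RtoC 1).
  { rewrite (avg_ext _ _ (fun z => z ^ 0 * Cconj z ^ 0 + (/ 2 * v * (z ^ 0 * Cconj z ^ n)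
      + / 2 * Cconj v * (z ^ n * Cconj z ^ 0)))%C).
    - rewrite !avg_plus, !avg_scal, !avg_orthogonal by lia.
      destruct (Nat.eq_dec 0 0), (Nat.eq_dec 0 n), (Nat.eq_dec n 0); try lia. ring.
    - intros j. unfold W. simpl. ring. }
  assert (SFW : Cmod (avg N (fun z => Ev a z * W z)%C) <= 1).
  { assert (HN0 : 0 < INR (S N)) by (apply lt_0_INR; lia).
    rewrite <- Cmod_1, <- avgW. unfold avg. rewrite !Cmod_div by apply INR_S_neq0.
    apply Rmult_le_compat_r.
    { apply Rlt_le, Rinv_0_lt_compat. rewrite Cmod_R, Rabs_pos_eq; lra. }
    apply Rle_trans with (1 := Cmod_sum_n _ _).
    apply Rle_trans with (sum_n (fun j => Cmod (W (root N j))) N).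
    - apply sum_n_m_le. intros j. rewrite Cmod_mult.
      rewrite <- (Rmult_1_l (Cmod (W _))) at 2.
      apply Rmult_le_compat_r; [apply Cmod_ge_0|]. apply HM, Cmod_root.
    - rewrite (sum_n_ext (fun j => W (root N j)) (fun j => RtoC (Cmod (W (root N j)))))
        by (intros; now rewrite HW).
      rewrite sum_n_C. simpl.
      assert (Hs : 0 <= sum_n (fun j => Cmod (W (root N j))) N)
        by (apply sum_n_nonneg; intros; apply Cmod_ge_0).
      apply Rle_trans with (2 := re_le_Cmod _). simpl. rewrite Rabs_pos_eq; [apply Rle_refl|].
      exact Hs. }
  assert (EFW : avg N (fun z => Ev a z * W z)%C =
    (avg N (fun z => Ev a z * Cconj z ^ 0)%C
     + (/ 2 * v * avg N (fun z => Ev a z * Cconj z ^ n)%C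
     + / 2 * Cconj v * avg N (fun z => Ev a z * Cconj z ^ S (N - n))%C))%C).
  { rewrite <- !avg_scal, <- !avg_plus. apply avg_ext. intros j.
    (* On the (N+1)-th roots of unity a positive power is a power of the conjugate. Hence the term
       that would integrate to zero on the circle picks up the coefficient of index N + 1 - n here,
       which is bounded by a tail. *)
    assert (Er : (root N j ^ n = Cconj (root N j) ^ S (N - n))%C).
    { unfold root. rewrite Cconj_cis, !cis_pow.
      assert (HN0 : 0 < INR (S N)) by (apply lt_0_INR; lia).
      rewrite <- (Cmult_1_l (cis (INR (S (N - n)) * _))), <- (cis_2PI_nat j), <- cis_plus.
      f_equal. replace (S (N - n)) with (S N - n)%nat by lia.
      rewrite minus_INR by lia. field. lra. }
    unfold W. rewrite Er. simpl. ring. }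
  rewrite EFW in SFW.
  set (B0 := avg N (fun z => Ev a z * Cconj z ^ 0)%C) in *.
  set (B1 := avg N (fun z => Ev a z * Cconj z ^ n)%C) in *.
  set (B2 := avg N (fun z => Ev a z * Cconj z ^ S (N - n))%C) in *.
  replace (a 0%nat + / 2 * v * a n)%C with
    (B0 + (/ 2 * v * B1 + / 2 * Cconj v * B2)
     + (- (B0 - a 0%nat) + (- (/ 2 * v * (B1 - a n)) + (- (/ 2 * Cconj v * (B2 - a (S (N - n))))
     + - (/ 2 * Cconj v * a (S (N - n)))))))%C by ring.
  apply Rle_trans with (1 := Cmod_triangle _ _).
  apply Rplus_le_compat; [exact SFW|].
  assert (X0 : Cmod (- (B0 - a 0%nat)) <= e / 4) by (rewrite Cmod_opp; lra).
  assert (X1 : Cmod (- (/ 2 * v * (B1 - a n))) <= e / 4).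
  { rewrite Cmod_opp, !Cmod_mult, Hhalf, Hv. lra. }
  assert (X2 : Cmod (- (/ 2 * Cconj v * (B2 - a (S (N - n))))) <= e / 4).
  { rewrite Cmod_opp, !Cmod_mult, Hhalf, Cmod_conj, Hv. lra. }
  assert (X3 : Cmod (- (/ 2 * Cconj v * a (S (N - n)))) <= e / 4).
  { rewrite Cmod_opp, !Cmod_mult, Hhalf, Cmod_conj, Hv. lra. }
  assert (Y1 := Cmod_triangle (- (/ 2 * Cconj v * (B2 - a (S (N - n)))))
    (- (/ 2 * Cconj v * a (S (N - n))))).
  set (r23 := (- (/ 2 * Cconj v * (B2 - a (S (N - n)))) + - (/ 2 * Cconj v * a (S (N - n))))%C) in *.
  assert (Y2 := Cmod_triangle (- (/ 2 * v * (B1 - a n))) r23).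
  set (r123 := (- (/ 2 * v * (B1 - a n)) + r23)%C) in *.
  assert (Y3 := Cmod_triangle (- (B0 - a 0%nat)) r123).
  lra.
Qed.

Lemma Cmod_eq_fscale (a : fps) (t : R) : 0 <= t -> forall M,
  (forall z, Cmod z = t -> Cmod (Ev a z) <= M) ->
  forall z, Cmod z = 1 -> Cmod (Ev (fscale t a) z) <= M.
Proof.
  intros Ht M H z Hz. rewrite Ev_fscale. apply H.
  rewrite Cmod_mult, Hz, Cmod_R, Rabs_pos_eq; lra.
Qed.

Lemma Cauchy_estimate (a : fps) (t M : R) (n : nat) : 0 <= t -> AC a t ->
  (forall z, Cmod z = t -> Cmod (Ev a z) <= M) -> Cmod (a n) * t ^ n <= M.
Proof.
  intros Ht Ha HM. rewrite <- Cmod_fscale_R by exact Ht.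
  apply Cauchy_estimate_1; [exact Ha|]. now apply Cmod_eq_fscale.
Qed.

Lemma Caratheodory_estimate (a : fps) (t : R) (n : nat) : (1 <= n)%nat -> 0 <= t -> AC a t ->
  (forall z, Cmod z = t -> Cmod (Ev a z) <= 1) ->
  Cmod (a n) * t ^ n <= 2 * (1 - Cmod (a 0%nat)).
Proof.
  intros Hn Ht Ha HM. rewrite <- Cmod_fscale_R by exact Ht.
  replace (a 0%nat) with (fscale t a 0%nat) by (unfold fscale; simpl; ring).
  apply Caratheodory_estimate_1; [exact Hn|exact Ha|]. now apply Cmod_eq_fscale.
Qed.

Lemma sum_n_geom_third (N : nat) : sum_n (fun n => (1 / 3) ^ S n) N <= / 2.
Proof.
  assert (H : sum_n (fun n => (1 / 3) ^ S n) N = / 2 * (1 - (1 / 3) ^ S N)).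
  { induction N as [|N IH].
    - rewrite sum_O. simpl. field.
    - rewrite sum_Sn, IH.
      change (/ 2 * (1 - (1 / 3) ^ S N) + (1 / 3) ^ S (S N) = / 2 * (1 - (1 / 3) ^ S (S N))).
      simpl. field. }
  rewrite H. assert (0 <= (1 / 3) ^ S N) by (apply pow_le; lra). lra.
Qed.

(** By Caratheodory the sum is at most A + 2 (1 - A) (1/3 + 1/9 + ...) <= A + (1 - A) = 1, with A =
    |a_0|. *)
Lemma Bohr (a : fps) (t : R) (N : nat) : 0 <= t -> AC a t ->
  (forall z, Cmod z = t -> Cmod (Ev a z) <= 1) ->
  sum_n (fun n => Cmod (a n) * (t / 3) ^ n) N <= 1.
Proof.
  intros Ht Ha HM.
  assert (H0 : Cmod (a 0%nat) <= 1).
  { generalize (Cauchy_estimate a t 1 0 Ht Ha HM). simpl. lra. }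
  destruct N as [|N].
  { rewrite sum_O. simpl. lra. }
  rewrite sum_n_S_left.
  apply Rle_trans with (Cmod (a 0%nat)
    + 2 * (1 - Cmod (a 0%nat)) * sum_n (fun n => (1 / 3) ^ S n) N).
  - apply Rplus_le_compat; [simpl; lra|].
    apply Rle_trans with (sum_n (fun n => 2 * (1 - Cmod (a 0%nat)) * (1 / 3) ^ S n) N).
    + apply sum_n_m_le. intros n.
      replace (t / 3) with (t * (1 / 3)) by field.
      rewrite Rpow_mult_distr, <- Rmult_assoc.
      apply Rmult_le_compat_r; [apply pow_le; lra|].
      apply Caratheodory_estimate; auto. lia.
    + apply Req_le. exact (sum_n_mult_l (K := R_Ring) (2 * (1 - Cmod (a 0%nat)))
        (fun n => (1 / 3) ^ S n) N).
  - assert (H := sum_n_geom_third N). nra.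
Qed.

(** * Differentiability *)

Definition fderiv (a : fps) : fps := fun n => (INR (S n) * a (S n))%C.

(** Reduced to the real power series of the moduli, whose formal derivative has the same radius of
    convergence. *)
Lemma rad1_fderiv (a : fps) : rad1 a -> rad1 (fderiv a).
Proof.
  intros Ha t Ht. set (s := (1 + t) / 2).
  assert (Hs : 0 <= s < 1) by (unfold s; lra).
  destruct (AC_term_le a s (proj1 Hs) (Ha s Hs)) as [M [HM0 HM]].
  assert (Hr : Rbar_lt (Rabs t) (CV_radius (PS_derive (fun n => Cmod (a n))))).
  { rewrite CV_radius_derive.
    apply Rbar_lt_le_trans with (Finite s).
    - rewrite Rabs_pos_eq by lra. simpl. unfold s. lra.
    - apply (CV_radius_bounded (fun n => Cmod (a n))). exists M. intros n.
      rewrite Rabs_pos_eq; [apply HM|].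
      apply Rmult_le_pos; [apply Cmod_ge_0|apply pow_le; lra]. }
  apply CV_disk_inside in Hr. apply abs_summable_le with (2 := Hr).
  intros n. rewrite Cmod_fscale_R by lra. unfold fderiv, PS_derive.
  rewrite Cmod_mult, Cmod_R, !Rabs_mult.
  rewrite (Rabs_pos_eq (Cmod _)) by apply Cmod_ge_0.
  rewrite (Rabs_pos_eq (t ^ n)) by (apply pow_le; lra). apply Rle_refl.
Qed.

Lemma Cmod_pow_minus_le (n : nat) (t : R) (z w : C) : Cmod z <= t -> Cmod w <= t ->
  Cmod (w ^ S n - z ^ S n) <= INR (S n) * t ^ n * Cmod (w - z).
Proof.
  intros Hz Hw. assert (Ht : 0 <= t) by (apply Rle_trans with (2 := Hz), Cmod_ge_0).
  induction n as [|n IH].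
  - simpl. rewrite !Cmult_1_r. lra.
  - replace (w ^ S (S n) - z ^ S (S n))%C with
      (w * (w ^ S n - z ^ S n) + z ^ S n * (w - z))%C by (simpl; ring).
    apply Rle_trans with (1 := Cmod_triangle _ _). rewrite !Cmod_mult, Cmod_pow.
    rewrite (S_INR (S n)).
    assert (H1 : Cmod w * Cmod (w ^ S n - z ^ S n) <= t * (INR (S n) * t ^ n * Cmod (w - z))).
    { apply Rmult_le_compat; auto using Cmod_ge_0. }
    assert (H2 : Cmod z ^ S n * Cmod (w - z) <= t ^ S n * Cmod (w - z)).
    { apply Rmult_le_compat_r; [apply Cmod_ge_0|]. apply pow_incr. split; auto using Cmod_ge_0. }
    simpl in *. lra.
Qed.

(** The constant is the product of the two integers produced by differentiating twice, not half of
    it: summed over n it gives the majorant of [fderiv (fderiv a)]. The induction splits off one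
    factor w. *)
Lemma Cmod_pow_taylor_le (n : nat) (t : R) (z w : C) : Cmod z <= t -> Cmod w <= t ->
  Cmod (w ^ S (S n) - z ^ S (S n) - INR (S (S n)) * z ^ S n * (w - z)) <=
  INR (S (S n)) * INR (S n) * t ^ n * Cmod (w - z) ^ 2.
Proof.
  intros Hz Hw. assert (Ht : 0 <= t) by (apply Rle_trans with (2 := Hz), Cmod_ge_0).
  induction n as [|n IH].
  - replace (w ^ 2 - z ^ 2 - INR 2 * z ^ 1 * (w - z))%C with ((w - z) * (w - z))%C.
    + rewrite Cmod_mult. simpl.
      assert (0 <= Cmod (w - z) * Cmod (w - z)) by (apply Rmult_le_pos; apply Cmod_ge_0). lra.
    + simpl. rewrite RtoC_plus. ring.
  - assert (E : (w ^ S (S (S n)) - z ^ S (S (S n)) - INR (S (S (S n))) * z ^ S (S n) * (w - z) =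
      w * (w ^ S (S n) - z ^ S (S n) - INR (S (S n)) * z ^ S n * (w - z))
      + INR (S (S n)) * z ^ S n * ((w - z) * (w - z)))%C).
    { rewrite (S_INR (S (S n))), RtoC_plus. simpl Cpow. ring. }
    rewrite E. apply Rle_trans with (1 := Cmod_triangle _ _).
    rewrite !Cmod_mult, Cmod_pow, Cmod_R, Rabs_pos_eq by apply pos_INR.
    set (D := Cmod (w - z)) in *. assert (HD : 0 <= D) by apply Cmod_ge_0.
    assert (HI := pos_INR (S (S n))). assert (Htn := pow_le t n Ht).
    match goal with |- Cmod w * ?X + _ <= _ =>
      assert (H1 : Cmod w * X <= t * (INR (S (S n)) * INR (S n) * t ^ n * D ^ 2)) end.
    { apply Rmult_le_compat; auto using Cmod_ge_0. }
    assert (H2 : INR (S (S n)) * Cmod z ^ S n * (D * D) <= INR (S (S n)) * t ^ S n * (D * D)).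
    { apply Rmult_le_compat_r; [nra|]. apply Rmult_le_compat_l; [exact HI|].
      apply pow_incr. split; auto using Cmod_ge_0. }
    apply Rle_trans with (INR (S (S n)) * (INR (S n) + 1) * t ^ S n * D ^ 2).
    + eapply Rle_trans; [apply Rplus_le_compat; [exact H1|exact H2]|].
      apply Req_le. simpl pow. ring.
    + rewrite <- S_INR. rewrite (S_INR (S (S n))).
      assert (0 <= INR (S (S n)) * t ^ S n * D ^ 2).
      { repeat apply Rmult_le_pos; auto using pow_le. simpl. lra. }
      nra.
Qed.

(** The constant is the majorant of the derivative at radius t. A uniform constant is what fixes the
    step length when the reciprocal is continued outwards. *)
Lemma Ev_Lipschitz (a : fps) (t : R) : rad1 a -> 0 <= t < 1 ->
  exists L, 0 <= L /\ forall z w, Cmod z <= t -> Cmod w <= t ->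
    Cmod (Ev a w - Ev a z) <= L * Cmod (w - z).
Proof.
  intros Ha Ht. assert (Hd := rad1_fderiv a Ha t Ht).
  set (L := Series (fun n => Cmod (fscale t (fderiv a) n))).
  exists L. split.
  { apply Rle_trans with (2 := sum_n_le_Series _ 0 (fun n => Cmod_ge_0 _) Hd).
    rewrite sum_O. apply Cmod_ge_0. }
  intros z w Hz Hw.
  assert (Sz := AC_disk a t z Hz (Ha t Ht)). assert (Sw := AC_disk a t w Hw (Ha t Ht)).
  unfold Ev. rewrite <- Csum_minus by assumption.
  rewrite Csum_incr_1.
  - replace (fscale w a 0%nat - fscale z a 0%nat)%C with (RtoC 0) by (unfold fscale; simpl; ring).
    rewrite Cplus_0_l.
    rewrite Rmult_comm. unfold L. rewrite <- Series_scal_l.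
    apply Cmod_Csum_le.
    + intros n. rewrite Cmod_fscale_R by lra. unfold fscale, fderiv.
      replace (a (S n) * w ^ S n - a (S n) * z ^ S n)%C
        with (a (S n) * (w ^ S n - z ^ S n))%C by ring.
      rewrite !Cmod_mult, Cmod_R, Rabs_pos_eq by apply pos_INR.
      assert (H := Cmod_pow_minus_le n t z w Hz Hw).
      apply Rmult_le_compat_l with (r := Cmod (a (S n))) in H; [|apply Cmod_ge_0].
      lra.
    + apply (ex_series_scal_l (Cmod (w - z)) (fun n => Cmod (fscale t (fderiv a) n))), Hd.
  - apply abs_summable_le with (fun n => Cmod (fscale w a n) + Cmod (fscale z a n)).
    + intros n. apply Rle_trans with (1 := Cmod_triangle _ _). rewrite Cmod_opp. lra.
    + exact (ex_series_plus _ _ Sw Sz).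
Qed.

(** A derivative with a quadratic remainder. It is stronger than differentiability, is available for
    every power series, and yields [C_derive] as well as the real partial derivatives without a
    separate limit argument. *)
Definition quad_deriv (F : C -> C) (z l : C) : Prop :=
  exists M d, 0 < d /\ 0 <= M /\ forall w, Cmod (w - z) < d ->
    Cmod (F w - F z - l * (w - z)) <= M * Cmod (w - z) ^ 2.

Lemma Ev_quad_deriv (a : fps) (z : C) : rad1 a -> disk z ->
  quad_deriv (Ev a) z (Ev (fderiv a) z).
Proof.
  intros Ha Hz0. unfold disk in Hz0. assert (H0 := Cmod_ge_0 z).
  set (t := (1 + Cmod z) / 2). assert (Ht : 0 <= t < 1) by (unfold t; lra).
  assert (Hd := rad1_fderiv a Ha). assert (Hdd := rad1_fderiv _ Hd).
  set (M := Series (fun n => Cmod (fscale t (fderiv (fderiv a)) n))).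
  exists M, ((1 - Cmod z) / 2). split; [lra|]. split.
  { apply Rle_trans with (2 := sum_n_le_Series _ 0 (fun n => Cmod_ge_0 _) (Hdd t Ht)).
    rewrite sum_O. apply Cmod_ge_0. }
  intros w Hw.
  assert (Hz : Cmod z <= t) by (unfold t; lra).
  assert (Hwt : Cmod w <= t).
  { replace w with (z + (w - z))%C by ring. apply Rle_trans with (1 := Cmod_triangle _ _).
    unfold t. lra. }
  assert (Sz := AC_disk a t z Hz (Ha t Ht)). assert (Sw := AC_disk a t w Hwt (Ha t Ht)).
  assert (Sd := AC_disk _ t z Hz (Hd t Ht)).
  assert (Sz' := proj1 (abs_summable_S _) Sz). assert (Sw' := proj1 (abs_summable_S _) Sw).
  assert (E0 : fscale w a 0%nat = fscale z a 0%nat) by reflexivity.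
  unfold Ev. rewrite (Csum_incr_1 (fscale w a)), (Csum_incr_1 (fscale z a)) by assumption.
  replace (fscale w a 0%nat + Csum (fun n => fscale w a (S n))
      - (fscale z a 0%nat + Csum (fun n => fscale z a (S n)))
      - Csum (fscale z (fderiv a)) * (w - z))%C
    with (Csum (fun n => fscale w a (S n)) - Csum (fun n => fscale z a (S n))
      - (w - z) * Csum (fscale z (fderiv a)))%C
    by (rewrite E0; ring).
  assert (Smin : forall u v, abs_summable u -> abs_summable v ->
    abs_summable (fun n => u n - v n)%C).
  { intros u v Hu Hv. apply abs_summable_le with (fun n => Cmod (u n) + Cmod (v n)).
    - intros n. apply Rle_trans with (1 := Cmod_triangle _ _). rewrite Cmod_opp. lra.
    - exact (ex_series_plus _ _ Hu Hv). }
  rewrite <- Csum_scal by assumption.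
  rewrite <- Csum_minus, <- Csum_minus; auto using abs_summable_scal.
  (* The linear terms cancel exactly, so the remaining series starts at degree 2, where the
     quadratic bound applies. *)
  rewrite Csum_incr_1 by auto using abs_summable_scal.
  match goal with |- Cmod (?x + _) <= _ => replace x with (RtoC 0) end.
  2: { unfold fscale, fderiv. simpl. ring. }
  rewrite Cplus_0_l.
  rewrite Rmult_comm. unfold M. rewrite <- Series_scal_l.
  apply Cmod_Csum_le.
  - intros n. rewrite Cmod_fscale_R by lra. unfold fscale, fderiv.
    replace (a (S (S n)) * w ^ S (S n) - a (S (S n)) * z ^ S (S n)
        - (w - z) * (INR (S (S n)) * a (S (S n)) * z ^ S n))%C
      with (a (S (S n)) * (w ^ S (S n) - z ^ S (S n) - INR (S (S n)) * z ^ S n * (w - z)))%C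
      by ring.
    assert (H := Cmod_pow_taylor_le n t z w Hz Hwt).
    apply Rmult_le_compat_l with (r := Cmod (a (S (S n)))) in H; [|apply Cmod_ge_0].
    rewrite Cmod_mult. eapply Rle_trans; [exact H|].
    rewrite !Cmod_mult, !Cmod_R, !Rabs_pos_eq by apply pos_INR.
    apply Req_le. ring.
  - apply (ex_series_scal_l (Cmod (w - z) ^ 2)
      (fun n => Cmod (fscale t (fderiv (fderiv a)) n))), Hdd, Ht.
Qed.

(** Cancelling a factor that vanishes at z0 loses the inequality at z0 itself; the Lipschitz bounds
    recover it from the nearby point z0 + d. *)
Lemma Ev_le_by_continuity (a b : fps) (z0 : C) : rad1 a -> rad1 b -> disk z0 ->
  (forall z, disk z -> z <> z0 -> Cmod (Ev a z) <= Cmod (Ev b z)) ->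
  forall z, disk z -> Cmod (Ev a z) <= Cmod (Ev b z).
Proof.
  intros Ha Hb Hz0 H z Hz. destruct (classic (z = z0)) as [->|Hne]; [|now apply H].
  unfold disk in *. assert (H0 := Cmod_ge_0 z0).
  set (t := (1 + Cmod z0) / 2). assert (Ht : 0 <= t < 1) by (unfold t; lra).
  destruct (Ev_Lipschitz a t Ha Ht) as [L1 [HL1 L1H]].
  destruct (Ev_Lipschitz b t Hb Ht) as [L2 [HL2 L2H]].
  apply Rle_eps. intros e He.
  set (d := Rmin (e / (L1 + L2 + 1)) ((1 - Cmod z0) / 2)).
  assert (Hd0 : 0 < d).
  { apply Rmin_glb_lt; [apply Rdiv_lt_0_compat; lra|lra]. }
  assert (Hd1 : d <= (1 - Cmod z0) / 2) by apply Rmin_r.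
  assert (Hd2 : d * (L1 + L2 + 1) <= e).
  { assert (Hd2 : d <= e / (L1 + L2 + 1)) by apply Rmin_l.
    apply Rmult_le_compat_r with (r := L1 + L2 + 1) in Hd2; [|lra].
    replace (e / (L1 + L2 + 1) * (L1 + L2 + 1)) with e in Hd2 by (field; lra). exact Hd2. }
  set (z := (z0 + RtoC d)%C).
  assert (Ed : Cmod (z - z0) = d).
  { replace (z - z0)%C with (RtoC d) by (unfold z; ring).
    rewrite Cmod_R, Rabs_pos_eq; lra. }
  assert (Ez : Cmod z <= t).
  { unfold z. apply Rle_trans with (1 := Cmod_triangle _ _).
    rewrite Cmod_R, Rabs_pos_eq by lra. unfold t. lra. }
  assert (Ez0 : Cmod z0 <= t) by (unfold t; lra).
  specialize (L1H z0 z Ez0 Ez). specialize (L2H z z0 Ez Ez0).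
  rewrite (Cmod_minus_sym z0 z), Ed in L2H.
  rewrite Ed in L1H.
  assert (Hab : Cmod (Ev a z) <= Cmod (Ev b z)).
  { apply H; [lra|]. intros E. rewrite E in Ed.
    replace (z0 - z0)%C with (RtoC 0) in Ed by ring. rewrite Cmod_0 in Ed. lra. }
  assert (T1 := Cmod_le_plus_minus (Ev a z) (Ev a z0)).
  assert (T2 := Cmod_le_plus_minus (Ev b z0) (Ev b z)).
  nra.
Qed.

(** * Reciprocals *)

Lemma Ev_lower_bound (a : fps) (rho : R) : rad1 a -> 0 <= rho < 1 ->
  (forall z, Cmod z <= rho -> Ev a z <> RtoC 0) ->
  exists d, 0 < d /\ forall z, Cmod z <= rho -> d <= Cmod (Ev a z).
Proof.
  intros Ha Hr Hnz. destruct (Ev_Lipschitz a rho Ha Hr) as [L [HL0 HL]].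
  (* At a point of the disk the gauge is so small that the Lipschitz bound keeps |a| above half its
     value there. Outside, it is half the distance to the disk, which excludes such a point as a
     neighbour of a point of the disk. Compactness then bounds the relevant gauges below by one
     d. *)
  assert (Hdelta : forall u v : R, 0 < if Rle_dec (Cmod (u, v)) rho
    then Cmod (Ev a (u, v)) / (4 * (L + 1)) else (Cmod (u, v) - rho) / 2).
  { intros u v. destruct (Rle_dec _ _) as [H|H].
    - apply Rdiv_lt_0_compat; [|lra]. apply Cmod_gt_0, Hnz, H.
    - lra. }
  destruct (compactness_value_2d (- rho) rho (- rho) rho
    (fun u v => mkposreal _ (Hdelta u v))) as [d Hd].
  exists (2 * (L + 1) * d). assert (Hd0 := cond_pos d).
  split; [apply Rmult_lt_0_compat; lra|].
  intros [x y] Hz.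
  assert (Hx : Rabs x <= rho) by (apply Rle_trans with (2 := Hz), (re_le_Cmod (x, y))).
  assert (Hy : Rabs y <= rho) by (apply Rle_trans with (2 := Hz), (im_le_Cmod (x, y))).
  apply Rabs_le_between in Hx, Hy.
  destruct (NNPP _ (Hd x y Hx Hy)) as [u [v [_ [_ [Hu [Hv Hduv]]]]]].
  clear Hd. simpl in Hu, Hv, Hduv.
  set (w := (u, v) : C) in *. set (z := (x, y) : C) in *.
  assert (Hdist : forall e, Rabs (x - u) < e -> Rabs (y - v) < e -> Cmod (z - w) <= 2 * e).
  { intros e H1 H2.
    replace (z - w)%C with (RtoC (x - u) + Ci * RtoC (y - v))%C.
    - apply Rle_trans with (1 := Cmod_triangle _ _).
      rewrite Cmod_mult, Cmod_Ci, !Cmod_R. lra.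
    - apply injective_projections; simpl; ring. }
  destruct (Rle_dec (Cmod w) rho) as [Hw|Hw].
  - assert (Hzw := Hdist _ Hu Hv).
    assert (H1 := HL z w Hz Hw).
    rewrite (Cmod_minus_sym w z), Cmod_minus_sym in H1.
    assert (H2 := Cmod_le_plus_minus (Ev a z) (Ev a w)).
    set (A := Cmod (Ev a w)) in *.
    set (q := A / (4 * (L + 1))) in *.
    assert (EA : A = q * (4 * (L + 1))) by (unfold q; field; lra).
    assert (L * Cmod (z - w) <= L * (2 * q)) by (apply Rmult_le_compat_l; lra).
    assert ((L + 1) * d <= (L + 1) * q) by (apply Rmult_le_compat_l; lra).
    nra.
  - exfalso. assert (Hr0 : 0 <= Cmod w - rho) by lra.
    assert (H1 : Rmax (Rabs (x - u)) (Rabs (y - v)) < (Cmod w - rho) / 2)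
      by (apply Rmax_lub_lt; assumption).
    assert (H2 := Cmod_2Rmax (z - w)%C).
    change (Rmax (Rabs (fst (z - w)%C)) (Rabs (snd (z - w)%C)))
      with (Rmax (Rabs (x - u)) (Rabs (y - v))) in H2.
    assert (H3 := Cmod_le_plus_minus z w).
    assert (H4 : sqrt 2 <= 2).
    { rewrite <- (sqrt_pow2 2) at 2 by lra. apply sqrt_le_1; simpl; lra. }
    assert (0 <= Rmax (Rabs (x - u)) (Rabs (y - v)))
      by (apply Rle_trans with (2 := Rmax_l _ _), Rabs_pos).
    nra.
Qed.

(** Meant for a series [a] not known to converge: at a fixed index only finitely many of its
    coefficients enter. *)
Lemma Cmod_fmul_le (a b : fps) (B : R) (n : nat) : (forall i, Cmod (b i) <= B) ->
  Cmod (fmul a b n) <= B * sum_n (fun i => Cmod (a i)) n.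
Proof.
  intros HB. revert a. induction n as [|n IH]; intros a.
  - rewrite sum_O. simpl. rewrite Cmod_mult, Rmult_comm.
    apply Rmult_le_compat_r; [apply Cmod_ge_0|apply HB].
  - simpl. apply Rle_trans with (1 := Cmod_triangle _ _).
    rewrite sum_n_S_left, Cmod_mult.
    change (Cmod (a 0%nat) * Cmod (b (S n)) + Cmod (fmul (fshift a) b n)
      <= B * (Cmod (a 0%nat) + sum_n (fun i => Cmod (fshift a i)) n)).
    rewrite Rmult_plus_distr_l. apply Rplus_le_compat; [|apply IH].
    rewrite Rmult_comm. apply Rmult_le_compat_r; [apply Cmod_ge_0|apply HB].
Qed.

Lemma AC_fone (t : R) : AC fone t.
Proof. apply AC_fconst. Qed.

Lemma AC_fpow (a : fps) (t : R) (n : nat) : AC a t -> AC (fpow a n) t.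
Proof. intros Ha. induction n as [|n IH]; [apply AC_fone|now apply AC_fmul]. Qed.

Lemma Ev_fpow (a : fps) (t : R) (z : C) (n : nat) : Cmod z <= t -> AC a t ->
  Ev (fpow a n) z = (Ev a z ^ n)%C.
Proof.
  intros Hz Ha. induction n as [|n IH]; [apply Ev_fone|].
  simpl fpow. rewrite (Ev_fmul a (fpow a n) t) by auto using AC_fpow. now rewrite IH.
Qed.

Lemma AC_fopp (a : fps) (t : R) : AC a t -> AC (fopp a) t.
Proof.
  intros Ha. replace (fopp a) with (fmul (fconst (- (1))) a).
  - apply AC_fmul; [apply AC_fconst|exact Ha].
  - apply functional_extensionality. intros n. rewrite fmul_fconst_l. unfold fopp. ring.
Qed.

Lemma Ev_fopp (a : fps) (t : R) (z : C) : Cmod z <= t -> AC a t ->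
  Ev (fopp a) z = (- Ev a z)%C.
Proof.
  intros Hz Ha. replace (fopp a) with (fmul (fconst (- (1))) a).
  - rewrite (Ev_fmul _ _ t) by auto using AC_fconst. rewrite Ev_fconst. ring.
  - apply functional_extensionality. intros n. rewrite fmul_fconst_l. unfold fopp. ring.
Qed.

Lemma AC_fsub (a b : fps) (t : R) : AC a t -> AC b t -> AC (fsub a b) t.
Proof.
  intros Ha Hb. replace (fsub a b) with (fadd a (fopp b)) by ring.
  apply AC_fadd; [exact Ha|now apply AC_fopp].
Qed.

Lemma Ev_fsub (a b : fps) (t : R) (z : C) : Cmod z <= t -> AC a t -> AC b t ->
  Ev (fsub a b) z = (Ev a z - Ev b z)%C.
Proof.
  intros Hz Ha Hb. replace (fsub a b) with (fadd a (fopp b)) by ring.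
  rewrite (Ev_fadd _ _ t), (Ev_fopp _ t) by auto using AC_fopp. ring.
Qed.

(* On the unit circle put [V = 1 / H(t z)] and [Q = - V (H(s z) - H(t z))], so that
   [|V| <= 1 / d] and [|Q| <= 1 / 2]. Then [1 / H(s z)] is the Neumann series
   [V (1 + Q + Q^2 + ...)], each term of which obeys the Cauchy estimate. *)
Lemma finv_step (a : fps) (rho d L s t : R) : rad1 a -> rho < 1 -> 0 < d ->
  (forall z, Cmod z <= rho -> d <= Cmod (Ev a z)) ->
  (forall z w, Cmod z <= rho -> Cmod w <= rho ->
    Cmod (Ev a w - Ev a z) <= L * Cmod (w - z)) ->
  0 <= t <= s -> s <= rho -> L * (s - t) <= d / 2 -> AC (finv a) t ->
  forall n, Cmod (finv a n) * s ^ n <= 2 / d.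
Proof.
  intros Ha Hr Hd Hlow HL Hts Hs Hst Hu n.
  assert (Ha0 : a 0%nat <> RtoC 0).
  { rewrite <- Ev_0. intros E. specialize (Hlow (RtoC 0)).
    rewrite E, Cmod_0 in Hlow. lra. }
  set (u := fscale s (finv a)). set (v := fscale t (finv a)).
  set (hs := fscale s a). set (ht := fscale t a).
  set (q := fopp (fmul v (fsub hs ht))).
  assert (Eu : fmul hs u = fone) by (unfold hs, u; now rewrite fmul_fscale, fmul_finv, fscale_fone).
  assert (Ev' : fmul ht v = fone) by (unfold ht, v; now rewrite fmul_fscale, fmul_finv, fscale_fone).
  (* The identity 1/H_s = 1/H_t - (1/H_s) (1/H_t) (H_s - H_t), purely formal because convergence of
     [u] on the unit circle is what is being proved. *)
  assert (Euq : u = fadd v (fmul u q)).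
  { transitivity (fadd (fsub v (fmul v (fmul hs u))) (fmul u (fmul ht v))).
    - rewrite Eu, Ev'. fring.
    - unfold q. fring. }
  assert (ACa : forall x, 0 <= x <= rho -> AC (fscale x a) 1).
  { intros x Hx. apply AC_fscale. rewrite Rmult_1_r. apply Ha. lra. }
  assert (AChs : AC hs 1) by (apply ACa; lra).
  assert (ACht : AC ht 1) by (apply ACa; lra).
  assert (ACv : AC v 1) by (apply AC_fscale; now rewrite Rmult_1_r).
  assert (ACd : AC (fsub hs ht) 1) by now apply AC_fsub.
  assert (ACq : AC q 1) by (apply AC_fopp, AC_fmul; assumption).
  assert (Hmod : forall x z, 0 <= x -> Cmod z = 1 -> Cmod (x * z) = x).
  { intros x z Hx Hz. rewrite Cmod_mult, Cmod_R, Hz, Rabs_pos_eq; lra. }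
  assert (HV : forall z, Cmod z = 1 -> Cmod (Ev v z) <= / d).
  { intros z Hz. assert (E : (Ev ht z * Ev v z)%C = RtoC 1).
    { rewrite <- (Ev_fmul _ _ 1), Ev' by (auto; lra). apply Ev_fone. }
    apply (f_equal Cmod) in E. rewrite Cmod_mult, Cmod_1 in E.
    assert (H1 : d <= Cmod (Ev ht z)).
    { unfold ht. rewrite Ev_fscale. apply Hlow. rewrite Hmod; lra. }
    apply Rmult_le_reg_l with d; [exact Hd|]. rewrite Rinv_r by lra. rewrite <- E.
    apply Rmult_le_compat_r; [apply Cmod_ge_0|exact H1]. }
  assert (HQ : forall z, Cmod z = 1 -> Cmod (Ev q z) <= / 2).
  { intros z Hz. unfold q.
    rewrite (Ev_fopp _ 1), (Ev_fmul _ _ 1), (Ev_fsub _ _ 1) by (auto using AC_fmul; lra).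
    rewrite Cmod_opp, Cmod_mult. unfold hs, ht. rewrite !Ev_fscale.
    assert (H1 : Cmod (Ev a (s * z) - Ev a (t * z)) <= d / 2).
    { eapply Rle_trans; [apply HL; rewrite Hmod; lra|].
      replace (s * z - t * z)%C with (RtoC (s - t) * z)%C by (rewrite RtoC_minus; ring).
      rewrite Hmod by lra. exact Hst. }
    apply Rle_trans with (/ d * (d / 2)).
    - apply Rmult_le_compat; auto using Cmod_ge_0.
    - apply Req_le. field. lra. }
  assert (Hpow : forall J z, Cmod z = 1 -> Cmod (Ev (fpow q J) z) <= (/ 2) ^ J).
  { intros J z Hz. rewrite (Ev_fpow _ 1) by (auto; lra). rewrite Cmod_pow.
    apply pow_incr. split; [apply Cmod_ge_0|now apply HQ]. }
  assert (Hterm : forall J i, Cmod (fmul v (fpow q J) i) <= / d * (/ 2) ^ J).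
  { intros J i. apply Cauchy_estimate_1.
    - assert (H := AC_fmul _ _ 1 ACv (AC_fpow _ _ J ACq)).
      apply AC_ex_series in H; [|lra]. revert H. apply ex_series_ext.
      intros k. rewrite pow1. apply Rmult_1_r.
    - intros z Hz. rewrite (Ev_fmul _ _ 1) by (auto using AC_fpow; lra).
      rewrite Cmod_mult. apply Rmult_le_compat; auto using Cmod_ge_0. }
  assert (Hq : forall J i, Cmod (fpow q J i) <= (/ 2) ^ J).
  { intros J i. apply Cauchy_estimate_1; [|now apply Hpow].
    assert (H := AC_fpow _ _ J ACq). apply AC_ex_series in H; [|lra].
    revert H. apply ex_series_ext. intros k. rewrite pow1. apply Rmult_1_r. }
  (* Iterating u = v + u q gives J terms, bounded by a geometric sum, and the remainder u q^J. That
     remainder cannot be estimated by values of [u]; its n-th coefficient tends to 0 because the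
     coefficients of q^J are at most 2^-J. *)
  assert (Hind : forall J, Cmod (u n) <=
    2 / d * (1 - (/ 2) ^ J) + Cmod (fmul u (fpow q J) n)).
  { induction J as [|J IH].
    - replace (fmul u (fpow q 0)) with u by (simpl; fring). simpl. lra.
    - assert (E : fmul u (fpow q J) = fadd (fmul v (fpow q J)) (fmul u (fpow q (S J)))).
      { simpl. rewrite Euq at 1. fring. }
      assert (H1 : Cmod (fmul u (fpow q J) n) <=
        Cmod (fmul v (fpow q J) n) + Cmod (fmul u (fpow q (S J)) n)).
      { rewrite E. apply Cmod_triangle. }
      assert (H2 := Hterm J n). simpl ((/ 2) ^ S J).
      replace (2 / d * (1 - / 2 * (/ 2) ^ J))
        with (2 / d * (1 - (/ 2) ^ J) + / d * (/ 2) ^ J) by (field; lra).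
      lra. }
  assert (Eun : Cmod (u n) = Cmod (finv a n) * s ^ n) by (apply Cmod_fscale_R; lra).
  rewrite <- Eun. apply Rle_eps. intros e He.
  set (K := sum_n (fun i => Cmod (u i)) n).
  assert (HK : 0 <= K) by (apply sum_n_nonneg; intros; apply Cmod_ge_0).
  destruct (pow_lt_1_zero (/ 2) ltac:(rewrite Rabs_pos_eq; lra) (e / (K + 1))) as [J HJ].
  { apply Rdiv_lt_0_compat; lra. }
  specialize (HJ J (le_n _)). specialize (Hind J).
  assert (HJ0 : 0 <= (/ 2) ^ J) by (apply pow_le; lra).
  rewrite Rabs_pos_eq in HJ by exact HJ0.
  assert (H1 := Cmod_fmul_le u (fpow q J) _ n (Hq J)). fold K in H1.
  assert (H2 : (/ 2) ^ J * (K + 1) <= e).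
  { apply Rmult_lt_compat_r with (r := K + 1) in HJ; [|lra].
    replace (e / (K + 1) * (K + 1)) with e in HJ by (field; lra). lra. }
  assert (H3 : 0 <= 2 / d) by (apply Rdiv_le_0_compat; lra).
  nra.
Qed.

(** The lower bound d and the constant L are uniform on the closed disk, so each Neumann step gains
    the same length and finitely many steps reach any t < rho. *)
Lemma AC_finv (a : fps) (rho : R) : rad1 a -> 0 <= rho < 1 ->
  (forall z, Cmod z <= rho -> Ev a z <> RtoC 0) ->
  forall t, 0 <= t < rho -> AC (finv a) t.
Proof.
  intros Ha Hr Hnz.
  destruct (Ev_lower_bound a rho Ha Hr Hnz) as [d [Hd Hlow]].
  destruct (Ev_Lipschitz a rho Ha Hr) as [L [HL0 HL]].
  set (eta := d / (2 * (L + 1))).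
  assert (Heta : 0 < eta) by (apply Rdiv_lt_0_compat; lra).
  assert (HLeta : L * eta <= d / 2).
  { assert ((L + 1) * eta = d / 2) by (unfold eta; field; lra). nra. }
  assert (Hind : forall i t, 0 <= t < rho -> t <= INR i * (eta / 2) -> AC (finv a) t).
  { induction i as [|i IH]; intros t Ht Hti.
    - simpl in Hti. replace t with 0 by lra.
      assert (H : AC (fconst (finv a 0%nat)) 0) by apply AC_fconst.
      unfold AC. replace (fscale 0 (finv a)) with (fscale 0 (fconst (finv a 0%nat))); [exact H|].
      apply functional_extensionality. intros [|n]; unfold fscale; simpl; ring.
    - rewrite S_INR in Hti.
      (* The step starts eta / 2 below t and ends beyond t, since [AC] at t needs bounded
         coefficients at some s > t; thus s - t' <= eta, as L eta <= d / 2 requires. *)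
      set (t' := Rmax 0 (t - eta / 2)). set (s := Rmin rho (t + eta / 2)).
      assert (Ht' : 0 <= t' <= t) by (split; [apply Rmax_l|apply Rmax_lub; lra]).
      assert (Hs : t < s) by (apply Rmin_glb_lt; lra).
      assert (Hs1 : s <= t + eta / 2) by apply Rmin_r.
      assert (Ht1 : t - eta / 2 <= t') by apply Rmax_r.
      apply AC_bounded with (2 / d) s; [lra|].
      apply (finv_step a rho d L s t'); auto; try lra.
      + apply Rmin_l.
      + nra.
      + apply IH; [lra|]. apply Rmax_lub; [|lra].
        apply Rmult_le_pos; [apply pos_INR|lra]. }
  intros t Ht. destruct (nfloor_ex (t / (eta / 2))) as [i [_ Hi]].
  { apply Rdiv_le_0_compat; lra. }
  apply (Hind (S i) t Ht). rewrite S_INR.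
  apply Rmult_le_reg_r with (/ (eta / 2)); [apply Rinv_0_lt_compat; lra|].
  rewrite Rmult_assoc, Rinv_r by lra. unfold Rdiv in *. lra.
Qed.

(** * Quotients *)

Lemma rad1_of_bounded (a : fps) (r : R) : r < 1 ->
  (forall s, r < s -> 0 < s < 1 -> exists M, forall n, Cmod (a n) * s ^ n <= M) -> rad1 a.
Proof.
  intros Hr H t Ht. set (s := (1 + Rmax r t) / 2).
  assert (Hm : Rmax r t < 1) by (apply Rmax_lub_lt; lra).
  assert (H1 := Rmax_l r t). assert (H2 := Rmax_r r t).
  destruct (H s) as [M HM]; [unfold s; lra|unfold s; lra|].
  apply AC_bounded with M s; [unfold s; lra|exact HM].
Qed.

Lemma rad1_fmul (a b : fps) : rad1 a -> rad1 b -> rad1 (fmul a b).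
Proof. intros Ha Hb t Ht. apply AC_fmul; auto. Qed.

Lemma rad1_flin (p q : C) : rad1 (flin p q).
Proof. intros t _. apply AC_flin. Qed.

Lemma rad1_shift (a : fps) (k : nat) : rad1 a -> rad1 (fun n => a (k + n)%nat).
Proof.
  intros Ha. apply rad1_of_bounded with 0; [lra|]. intros s _ Hs.
  destruct (AC_term_le a s ltac:(lra) (Ha s ltac:(lra))) as [M [_ HM]].
  exists (M * / s ^ k). intros n. specialize (HM (k + n)%nat). rewrite pow_add in HM.
  assert (Hk : 0 < s ^ k) by (apply pow_lt; lra).
  apply Rmult_le_reg_r with (s ^ k); [exact Hk|].
  rewrite (Rmult_assoc M), Rinv_l by lra. lra.
Qed.

Lemma Ev_mult (a b : fps) (z : C) : rad1 a -> rad1 b -> disk z ->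
  Ev (fmul a b) z = (Ev a z * Ev b z)%C.
Proof.
  intros Ha Hb Hz. assert (H0 := Cmod_ge_0 z).
  apply (Ev_fmul a b (Cmod z)); [lra|apply Ha|apply Hb]; unfold disk in Hz; lra.
Qed.

(** Synthetic division: c_n is the sum of a_(n+1+j) z0^j over j, and a_n = c_(n-1) - z0 c_n. For
    |z0| < s < 1, c_n s^(n+1) is dominated by the majorant of [a] at s. The vanishing at z0 gives
    the constant coefficient. *)
Lemma divide_at_zero (a : fps) (z0 : C) : rad1 a -> disk z0 -> Ev a z0 = RtoC 0 ->
  exists c, rad1 c /\ a = fmul (flin (- z0) 1) c.
Proof.
  intros Ha Hz0 Hroot. assert (H0 := Cmod_ge_0 z0). unfold disk in Hz0.
  set (c := (fun n => Ev (fun j => a (S n + j)%nat) z0) : fps).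
  assert (Hsh : forall k, abs_summable (fscale z0 (fun j => a (k + j)%nat))).
  { intros k. apply AC_disk with (Cmod z0); [lra|]. apply rad1_shift; [exact Ha|lra]. }
  assert (Hrec : forall k, Ev (fun j => a (k + j)%nat) z0 =
    (a k + z0 * Ev (fun j => a (S k + j)%nat) z0)%C).
  { intros k. unfold Ev. rewrite Csum_incr_1, <- Csum_scal by apply Hsh.
    f_equal.
    - unfold fscale. rewrite Nat.add_0_r. simpl. ring.
    - apply Csum_ext. intros n. unfold fscale.
      replace (k + S n)%nat with (S k + n)%nat by lia. simpl. ring. }
  exists c. split.
  - apply rad1_of_bounded with (Cmod z0); [exact Hz0|]. intros s Hs Hs1.
    assert (Has := Ha s ltac:(lra)).
    set (M := Series (fun n => Cmod (fscale s a n))).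
    exists (M * / s). intros n.
    apply Rmult_le_reg_r with s; [lra|]. rewrite Rmult_assoc, (Rmult_assoc M), Rinv_l by lra.
    assert (Hsn : AC (fun j => a (S n + j)%nat) s) by (apply rad1_shift; [exact Ha|lra]).
    assert (H1 : Cmod (c n) <= Series (fun j => Cmod (a (S n + j)%nat) * s ^ j)).
    { apply Cmod_Ev_le; [lra|exact Hsn]. }
    assert (Hs0 : 0 <= s ^ S n) by (apply pow_le; lra).
    apply Rmult_le_compat_l with (r := s ^ S n) in H1; [|exact Hs0].
    rewrite <- Series_scal_l in H1.
    assert (E : M = sum_n (fun i => Cmod (fscale s a i)) n
      + Series (fun j => s ^ S n * (Cmod (a (S n + j)%nat) * s ^ j))).
    { unfold M. rewrite (Series_incr_n _ (S n)) by (try lia; exact Has).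
      rewrite <- sum_n_Reals. f_equal. apply Series_ext. intros j.
      rewrite Cmod_fscale_R by lra. rewrite pow_add. ring. }
    assert (H2 : 0 <= sum_n (fun i => Cmod (fscale s a i)) n)
      by (apply sum_n_nonneg; intros; apply Cmod_ge_0).
    replace (s ^ n * s) with (s ^ S n) by (simpl; ring).
    clearbody M. rewrite E. rewrite Rmult_1_r, Rmult_comm. lra.
  - apply functional_extensionality. intros [|n].
    + simpl. unfold c. specialize (Hrec 0%nat).
      change (fun j => a (0 + j)%nat) with a in Hrec. rewrite Hroot in Hrec.
      replace (a 0%nat) with (a 0%nat + z0 * Ev (fun j => a (1 + j)%nat) z0
        - z0 * Ev (fun j => a (1 + j)%nat) z0)%C by ring.
      rewrite <- Hrec. ring.
    + rewrite fmul_flin_S. unfold c. rewrite (Hrec (S n)). ring.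
Qed.

(** The radius stays below 1 because only finitely many zeros of [h] can be removed; [w] may depend
    on it. *)
Definition has_quotient (rho : R) (g h : fps) : Prop :=
  exists w, g = fmul w h /\ (forall t, 0 <= t < rho -> AC w t) /\
    forall z, Cmod z < rho -> Cmod (Ev w z) <= 1.

Lemma has_quotient_nonvanishing (g h : fps) (rho : R) : rad1 g -> rad1 h -> 0 <= rho < 1 ->
  (forall z, disk z -> Cmod (Ev g z) <= Cmod (Ev h z)) ->
  (forall z, Cmod z <= rho -> Ev h z <> RtoC 0) -> has_quotient rho g h.
Proof.
  intros Hg Hh Hr Hle Hnz.
  assert (Hu := AC_finv h rho Hh Hr Hnz).
  assert (Hh0 : h 0%nat <> RtoC 0).
  { rewrite <- Ev_0. apply Hnz. rewrite Cmod_0. lra. }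
  assert (Hw : forall t, 0 <= t < rho -> AC (fmul g (finv h)) t).
  { intros t Ht. apply AC_fmul; [apply Hg; lra|now apply Hu]. }
  assert (E : g = fmul (fmul g (finv h)) h).
  { transitivity (fmul g (fmul h (finv h))); [|fring].
    rewrite fmul_finv by exact Hh0. fring. }
  exists (fmul g (finv h)). repeat split; [exact E|exact Hw|].
  intros z Hz. assert (H0 := Cmod_ge_0 z).
  assert (H1 : Ev g z = (Ev (fmul g (finv h)) z * Ev h z)%C).
  { rewrite E at 1. apply (Ev_fmul _ _ (Cmod z)); [lra|apply Hw; lra|apply Hh; lra]. }
  assert (H2 : disk z) by (unfold disk; lra).
  specialize (Hle z H2). rewrite H1, Cmod_mult in Hle.
  assert (H3 : 0 < Cmod (Ev h z)) by (apply Cmod_gt_0, Hnz; lra).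
  apply Rmult_le_reg_r with (1 := H3). lra.
Qed.

(* Each zero of [h] in the disk of radius [rho] is divided out by a Blaschke factor
   of the disk of radius [R]: this keeps [|h|] on the circle of radius [R], and
   multiplies [|h(0)|] by at least [R / rho], so it can happen only finitely often. *)
Lemma has_quotient_by_descent (rho R M : R) : 0 < rho < R -> R < 1 ->
  forall (N : nat) (g h : fps), rad1 g -> rad1 h ->
  (forall z, disk z -> Cmod (Ev g z) <= Cmod (Ev h z)) ->
  (forall z, Cmod z = R -> Cmod (Ev h z) <= M) ->
  M < Cmod (h 0%nat) * (R / rho) ^ N -> has_quotient rho g h.
Proof.
  intros Hrho HR N. induction N as [|N IH]; intros g h Hg Hh Hle HM Hlt.
  (* At N = 0 the hypothesis reads M < |h(0)|, against the Cauchy estimate on the circle of radius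
     R. *)
  { exfalso. simpl in Hlt.
    generalize (Cauchy_estimate h R M 0 ltac:(lra) (Hh R ltac:(lra)) HM). simpl. lra. }
  destruct (classic (exists z0, Cmod z0 <= rho /\ Ev h z0 = RtoC 0)) as [[z0 [Hz0 Hroot]]|Hno].
  2: { apply has_quotient_nonvanishing; auto; [lra|].
       intros z Hz E. apply Hno. now exists z. }
  assert (Hd0 : disk z0) by (unfold disk; lra).
  assert (Hgroot : Ev g z0 = RtoC 0).
  { apply Cmod_eq_0. apply Rle_antisym; [|apply Cmod_ge_0].
    rewrite <- Cmod_0, <- Hroot. now apply Hle. }
  destruct (divide_at_zero g z0 Hg Hd0 Hgroot) as [cg [Hcg Eg]].
  destruct (divide_at_zero h z0 Hh Hd0 Hroot) as [ch [Hch Eh]].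
  set (lin := flin (- z0) 1) in *.
  (* On |z| = R one has R^2 = z conj z, so R - conj z0 z / R = (z / R) conj (z - z0) has the modulus
     of z - z0. At the origin it has modulus R, where z - z0 has only |z0| <= rho. *)
  set (beta := flin R (- Cconj z0 / R)%C).
  assert (HRC : RtoC R <> RtoC 0) by (intros H; apply RtoC_inj in H; lra).
  assert (Hlin : rad1 lin) by apply rad1_flin. assert (Hbeta : rad1 beta) by apply rad1_flin.
  assert (Hcle : forall z, disk z -> Cmod (Ev cg z) <= Cmod (Ev ch z)).
  { apply (Ev_le_by_continuity cg ch z0); auto. intros z Hz Hne.
    generalize (Hle z Hz). rewrite Eg, Eh, !Ev_mult, !Cmod_mult by auto.
    unfold lin. rewrite Ev_flin. apply Rmult_le_reg_l. apply Cmod_gt_0.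
    intros H. apply Hne. replace z with (- z0 + 1 * z + z0)%C by ring. rewrite H. ring. }
  destruct (IH (fmul beta cg) (fmul beta ch)) as [w [Ew [ACw Hw]]].
  - now apply rad1_fmul.
  - now apply rad1_fmul.
  - intros z Hz. rewrite !Ev_mult, !Cmod_mult by auto.
    apply Rmult_le_compat_l; [apply Cmod_ge_0|now apply Hcle].
  - intros z Hz. assert (Hzd : disk z) by (unfold disk; lra).
    apply Rle_trans with (2 := HM z Hz). apply Req_le.
    rewrite Eh, !Ev_mult, !Cmod_mult by auto. f_equal.
    unfold lin, beta. rewrite !Ev_flin.
    assert (EzR : (z * Cconj z)%C = (RtoC R * RtoC R)%C).
    { rewrite <- Cmod2_conj, Hz, <- RtoC_mult. f_equal. ring. }
    replace (R + - Cconj z0 / R * z)%C with (z / R * (Cconj (- z0 + 1 * z)))%C.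
    + rewrite Cmod_mult, Cmod_conj, Cmod_div, Hz, Cmod_R, Rabs_pos_eq by (auto; lra).
      field. lra.
    + rewrite Cplus_conj, Cmult_conj, Copp_conj.
      replace (Cconj 1) with (RtoC 1) by (unfold Cconj, RtoC; simpl; f_equal; ring).
      replace (z / R * (- Cconj z0 + 1 * Cconj z))%C
        with ((z * Cconj z) / R - Cconj z0 / R * z)%C by (field; exact HRC).
      rewrite EzR. field. exact HRC.
  - apply Rlt_le_trans with (1 := Hlt).
    replace (fmul beta ch 0%nat) with (R * ch 0%nat)%C by reflexivity.
    replace (h 0%nat) with (- z0 * ch 0%nat)%C by (rewrite Eh; reflexivity).
    rewrite !Cmod_mult, Cmod_opp, Cmod_R, Rabs_pos_eq by lra.
    simpl pow. rewrite <- Rmult_assoc. apply Rmult_le_compat_r.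
    { apply pow_le. apply Rdiv_le_0_compat; lra. }
    assert (H := Cmod_ge_0 (ch 0%nat)).
    apply Rmult_le_reg_r with rho; [lra|].
    replace (Cmod z0 * Cmod (ch 0%nat) * (R / rho) * rho)
      with (R * Cmod (ch 0%nat) * Cmod z0) by (field; lra).
    apply Rmult_le_compat_l; [|exact Hz0]. apply Rmult_le_pos; lra.
  - exists w. repeat split; auto.
    (* The constant term R is nonzero, so [beta] is invertible as a formal series and cancels with
       no convergence argument. *)
    assert (Hb0 : beta 0%nat <> RtoC 0) by exact HRC.
    assert (Ecg : cg = fmul w ch).
    { transitivity (fmul (fmul beta (finv beta)) cg).
      - rewrite fmul_finv by exact Hb0. fring.
      - transitivity (fmul (finv beta) (fmul beta cg)); [fring|].
        rewrite Ew. transitivity (fmul (fmul beta (finv beta)) (fmul w ch)); [fring|].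
        rewrite fmul_finv by exact Hb0. fring. }
    rewrite Eg, Eh, Ecg. fring.
Qed.

(** Since R / rho > 1, some power N of it exceeds the majorant of [h] at R divided by |h(0)|; this N
    limits the number of zeros to be removed. *)
Lemma has_quotient_nonzero_head (rho : R) (g h : fps) : rad1 g -> rad1 h -> 0 < rho < 1 ->
  (forall z, disk z -> Cmod (Ev g z) <= Cmod (Ev h z)) ->
  h 0%nat <> RtoC 0 -> has_quotient rho g h.
Proof.
  intros Hg Hh Hr Hle H0. set (R := (1 + rho) / 2).
  assert (HR : rho < R < 1) by (unfold R; lra).
  set (M := Series (fun n => Cmod (h n) * R ^ n)).
  assert (Hpos : 0 < Cmod (h 0%nat)) by now apply Cmod_gt_0.
  assert (Hx : 1 < R / rho).
  { apply Rmult_lt_reg_r with rho; [lra|]. unfold Rdiv. rewrite Rmult_assoc, Rinv_l; lra. }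
  destruct (Pow_x_infinity (R / rho)) with (b := (M + 1) / Cmod (h 0%nat)) as [N HN].
  { rewrite Rabs_pos_eq; lra. }
  specialize (HN N (le_n _)). rewrite Rabs_pos_eq in HN by (apply pow_le; lra).
  apply has_quotient_by_descent with R M N; auto; try lra.
  - intros z Hz. apply Cmod_Ev_le; [lra|]. apply Hh. lra.
  - apply Rge_le in HN. apply Rmult_le_compat_l with (r := Cmod (h 0%nat)) in HN; [|lra].
    replace (Cmod (h 0%nat) * ((M + 1) / Cmod (h 0%nat))) with (M + 1) in HN by (field; lra).
    lra.
Qed.

Lemma fmul_X_shift (a : fps) : a 0%nat = RtoC 0 -> a = fmul (flin 0 1) (fshift a).
Proof.
  intros H. apply functional_extensionality. intros [|n].
  - simpl. rewrite H. ring.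
  - rewrite fmul_flin_S. unfold fshift. ring.
Qed.

(** A zero of [h] at the origin defeats the count by |h(0)|, so powers of z are cancelled first, by
    induction on the index of some nonzero coefficient. If there is none, [g] vanishes too and the
    quotient is 0. *)
Lemma analytic_quotient (rho : R) (g h : fps) : rad1 g -> rad1 h -> 0 < rho < 1 ->
  (forall z, disk z -> Cmod (Ev g z) <= Cmod (Ev h z)) -> has_quotient rho g h.
Proof.
  intros Hg Hh Hr Hle.
  destruct (classic (exists m, h m <> RtoC 0)) as [[m Hm]|Hall].
  - revert g h Hg Hh Hle Hm. induction m as [|m IH]; intros g h Hg Hh Hle Hm.
    { now apply has_quotient_nonzero_head. }
    destruct (classic (h 0%nat = RtoC 0)) as [Hh0|Hh0].
    2: { now apply has_quotient_nonzero_head. }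
    assert (D0 : disk (RtoC 0)) by (unfold disk; rewrite Cmod_0; lra).
    assert (Hg0 : g 0%nat = RtoC 0).
    { apply Cmod_eq_0, Rle_antisym; [|apply Cmod_ge_0].
      rewrite <- Cmod_0, <- Hh0, <- !Ev_0. now apply Hle. }
    assert (Eg := fmul_X_shift g Hg0). assert (Eh := fmul_X_shift h Hh0).
    assert (Hsg : rad1 (fshift g)) by exact (rad1_shift g 1 Hg).
    assert (Hsh : rad1 (fshift h)) by exact (rad1_shift h 1 Hh).
    destruct (IH (fshift g) (fshift h)) as [w [Ew Hw]]; auto.
    { apply (Ev_le_by_continuity _ _ (RtoC 0)); auto. intros z Hz Hne.
      generalize (Hle z Hz). rewrite (f_equal (fun x => Ev x z) Eg).
      rewrite (f_equal (fun x => Ev x z) Eh).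
      rewrite !Ev_mult, !Cmod_mult by auto using rad1_flin.
      rewrite Ev_flin. apply Rmult_le_reg_l. apply Cmod_gt_0.
      replace (0 + 1 * z)%C with z by ring. exact Hne. }
    exists w. split; [|exact Hw].
    transitivity (fmul (flin 0 1) (fmul w (fshift h))); [now rewrite <- Ew|].
    transitivity (fmul w (fmul (flin 0 1) (fshift h))); [fring|now rewrite <- Eh].
  - assert (Hh0 : forall n, h n = RtoC 0) by (intros n; apply NNPP; intros Hn; apply Hall; now exists n).
    assert (Hh' : forall z, Ev h z = RtoC 0).
    { intros z. rewrite <- (Ev_fconst (RtoC 0) z). f_equal.
      apply functional_extensionality. intros [|n]; apply Hh0. }
    exists (fconst (RtoC 0)). repeat split.
    + apply functional_extensionality. intros n. rewrite fmul_fconst_l.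
      assert (H : Cmod (g n) * (1 / 2) ^ n <= 0).
      { apply Cauchy_estimate; [lra|apply Hg; lra|]. intros z Hz.
        rewrite <- Cmod_0, <- (Hh' z). apply Hle. unfold disk. lra. }
      assert (Hp : 0 < (1 / 2) ^ n) by (apply pow_lt; lra).
      rewrite (Cmod_eq_0 (g n)); [ring|].
      assert (H0 := Cmod_ge_0 (g n)). nra.
    + intros t _. apply AC_fconst.
    + intros z _. rewrite Ev_fconst, Cmod_0. lra.
Qed.

(** * Coefficient sums *)

(** The limit t -> 1. The induction peels one factor t off the power: were y < s^N x, the number m =
    max (s, t), with t halfway between y / (s^N x) and 1, would violate the hypothesis. *)
Lemma pow_lim_1_le (N : nat) (x y : R) : 0 <= x ->
  (forall t, 0 < t < 1 -> t ^ N * x <= y) -> x <= y.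
Proof.
  revert x. induction N as [|N IH]; intros x Hx H.
  - specialize (H (1 / 2)). simpl in H. lra.
  - apply IH; [exact Hx|]. intros s Hs. apply Rnot_lt_le. intros Hlt.
    assert (Hs0 : 0 < s ^ N) by (apply pow_lt; lra).
    assert (Hz : 0 <= s ^ N * x) by (apply Rmult_le_pos; lra).
    assert (Hy : 0 <= y).
    { apply Rle_trans with (2 := H s Hs). apply Rmult_le_pos; [apply pow_le; lra|exact Hx]. }
    set (z := s ^ N * x) in *.
    set (t := (1 + y / z) / 2).
    assert (Hyz : 0 <= y / z < 1).
    { split; [apply Rdiv_le_0_compat; lra|].
      apply Rmult_lt_reg_r with z; [lra|]. unfold Rdiv. rewrite Rmult_assoc, Rinv_l; lra. }
    assert (Ht : 0 < t < 1) by (unfold t; lra).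
    set (m := Rmax s t).
    assert (Hm1 := Rmax_l s t). assert (Hm2 := Rmax_r s t). fold m in Hm1, Hm2.
    assert (Hm : 0 < m < 1) by (split; [lra|apply Rmax_lub_lt; lra]).
    specialize (H m Hm). simpl pow in H.
    assert (H1 : t * z <= m * m ^ N * x).
    { unfold z. rewrite <- Rmult_assoc. apply Rmult_le_compat_r; [exact Hx|].
      apply Rmult_le_compat; [lra|lra|lra|]. apply pow_incr. lra. }
    assert (H2 : t * z = (z + y) / 2) by (unfold t; field; lra).
    lra.
Qed.

(** For n <= N and t < 1 one has t^N <= t^n, so a partial sum passes from radius r to t r at the
    price of t^N. No such uniform factor exists for the full series. *)
Lemma sum_n_scal_pow (u : nat -> R) (t r : R) (N : nat) : (forall n, 0 <= u n) ->
  0 < t < 1 -> 0 <= r ->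
  t ^ N * sum_n (fun n => u n * r ^ n) N <= sum_n (fun n => u n * (t * r) ^ n) N.
Proof.
  intros Hu Ht Hr.
  replace (t ^ N * _) with (sum_n (fun n => t ^ N * (u n * r ^ n)) N)
    by exact (sum_n_mult_l (K := R_Ring) (t ^ N) (fun n => u n * r ^ n) N).
  assert (H : forall K, (K <= N)%nat ->
    sum_n (fun n => t ^ N * (u n * r ^ n)) K <= sum_n (fun n => u n * (t * r) ^ n) K).
  { assert (Hle : forall n, (n <= N)%nat -> t ^ N * (u n * r ^ n) <= u n * (t * r) ^ n).
    { intros n Hn. rewrite Rpow_mult_distr.
      replace (u n * (t ^ n * r ^ n)) with (t ^ n * (u n * r ^ n)) by ring.
      apply Rmult_le_compat_r.
      - apply Rmult_le_pos; [apply Hu|now apply pow_le].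
      - replace N with (n + (N - n))%nat by lia. rewrite pow_add.
        rewrite <- (Rmult_1_r (t ^ n)) at 2. apply Rmult_le_compat_l; [apply pow_le; lra|].
        rewrite <- (pow1 (N - n)). apply pow_incr. lra. }
    induction K as [|K IH]; intros HK.
    - rewrite !sum_O. now apply Hle.
    - rewrite !sum_Sn. apply Rplus_le_compat; [apply IH; lia|now apply Hle]. }
  now apply H.
Qed.

Lemma sum_n_fscale (a : fps) (t : R) (N : nat) : 0 <= t ->
  sum_n (fun n => Cmod (fscale t a n)) N = sum_n (fun n => Cmod (a n) * t ^ n) N.
Proof. intros Ht. apply sum_n_ext. intros n. now apply Cmod_fscale_R. Qed.

Lemma sum_n_pow_le (u : nat -> R) (s t : R) (N : nat) : (forall n, 0 <= u n) ->
  0 <= s <= t -> sum_n (fun n => u n * s ^ n) N <= sum_n (fun n => u n * t ^ n) N.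
Proof.
  intros Hu Hst. apply sum_n_m_le. intros n.
  apply Rmult_le_compat_l; [apply Hu|now apply pow_incr].
Qed.

Lemma fshift_fmul_X (c : fps) : fshift (fmul (flin 0 1) c) = c.
Proof.
  apply functional_extensionality. intros n. unfold fshift. rewrite fmul_flin_S. ring.
Qed.

Lemma Moebius_modulus (a w : C) :
  Cmod (1 - Cconj a * w) ^ 2 - Cmod (w - a) ^ 2 = (1 - Cmod a ^ 2) * (1 - Cmod w ^ 2).
Proof. rewrite !Cmod2_alt. destruct a as [a1 a2], w as [w1 w2]. simpl. ring. Qed.

Lemma Cmod_le_1_Moebius (a w : C) : Cmod a <= 1 -> Cmod w <= 1 ->
  Cmod (w - a) <= Cmod (1 - Cconj a * w).
Proof.
  intros Ha Hw. assert (H0 := Cmod_ge_0 a). assert (H1 := Cmod_ge_0 w).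
  assert (E := Moebius_modulus a w).
  assert (H2 : 0 <= (1 - Cmod a ^ 2) * (1 - Cmod w ^ 2)) by (apply Rmult_le_pos; nra).
  assert (H3 := Cmod_ge_0 (w - a)). assert (H4 := Cmod_ge_0 (1 - Cconj a * w)).
  nra.
Qed.

(* With [w] the quotient of [a - a_0] by [1 - conj a_0 a] and [w = z phi], the shifted
   series [x = (a - a_0) / z] satisfies [x = phi (1 - |a_0|^2 - conj a_0 z x)], and
   Bohr's inequality for [phi] turns this into a linear inequality for the majorant of [x]. *)
Lemma bounded_shift_sum (a : fps) (r : R) (N : nat) : rad1 a ->
  (forall z, disk z -> Cmod (Ev a z) <= 1) -> 0 <= r <= 1 / 3 ->
  (1 - r * Cmod (a 0%nat)) * sum_n (fun n => Cmod (a (S n)) * r ^ n) N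
    <= 1 - Cmod (a 0%nat) ^ 2.
Proof.
  intros Ha Hle Hr. set (A := Cmod (a 0%nat)).
  assert (HA0 : 0 <= A) by apply Cmod_ge_0.
  assert (HA1 : A <= 1).
  { unfold A. rewrite <- Ev_0. apply Hle. unfold disk. rewrite Cmod_0. lra. }
  assert (HX : 0 <= sum_n (fun n => Cmod (a (S n)) * r ^ n) N).
  { apply sum_n_nonneg. intros n. apply Rmult_le_pos; [apply Cmod_ge_0|apply pow_le; lra]. }
  destruct (Rle_lt_or_eq_dec A 1 HA1) as [HA|HA].
  (* For A = 1 the denominator 1 - conj a_0 a vanishes at the origin and cannot be divided out
     there; the Caratheodory bound 2 (1 - A) = 0 kills all further coefficients directly. *)
  2: { assert (Hz : forall n, Cmod (a (S n)) = 0).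
       { intros n. assert (H := Caratheodory_estimate a (1 / 2) (S n) ltac:(lia) ltac:(lra)
           (Ha (1 / 2) ltac:(lra))).
         fold A in H. rewrite HA in H.
         assert (Hp : 0 < (1 / 2) ^ S n) by (apply pow_lt; lra).
         assert (H0 := Cmod_ge_0 (a (S n))).
         assert (H1 : Cmod (a (S n)) * (1 / 2) ^ S n <= 2 * (1 - 1)).
         { apply H. intros z Hz. apply Hle. unfold disk. lra. }
         nra. }
       rewrite (sum_n_ext _ (fun _ => 0)) by (intros n; rewrite Hz; rring).
       rewrite sum_n_const, HA. lra. }
  (* N factors t are lost in passing from r to t r, and one more in the bound 1 / t for [phi]. *)
  apply pow_lim_1_le with (S N).
  { apply Rmult_le_pos; [nra|exact HX]. }
  intros t Ht. set (rho := (1 + t) / 2).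
  set (x := fshift a).
  set (hh := fsub fone (fmul (fconst (Cconj (a 0%nat))) a)).
  assert (Hx : rad1 x) by exact (rad1_shift a 1 Ha).
  assert (Hxx : rad1 (fmul (flin 0 1) x)) by (apply rad1_fmul; [apply rad1_flin|exact Hx]).
  assert (Ea : a = fadd (fconst (a 0%nat)) (fmul (flin 0 1) x)).
  { apply functional_extensionality. intros [|n]; unfold fadd.
    - simpl. ring.
    - rewrite fmul_flin_S. unfold x, fshift. simpl. ring. }
  assert (Hca : rad1 (fmul (fconst (Cconj (a 0%nat))) a)).
  { intros s Hs. apply AC_fmul; [apply AC_fconst|now apply Ha]. }
  assert (Hhh : rad1 hh).
  { intros s Hs. apply AC_fsub; [apply AC_fone|now apply Hca]. }
  destruct (analytic_quotient rho (fmul (flin 0 1) x) hh) as [w [Ew [ACw Hw]]]; auto.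
  { unfold rho; lra. }
  { intros z Hz. assert (Hz' := Hz). unfold disk in Hz'. assert (H0 := Cmod_ge_0 z).
    assert (E1 : Ev (fmul (flin 0 1) x) z = (Ev a z - a 0%nat)%C).
    { rewrite (f_equal (fun y => Ev y z) Ea).
      rewrite (Ev_fadd _ _ (Cmod z)), Ev_fconst by
        (try lra; try apply AC_fconst; apply Hxx; lra). ring. }
    assert (E2 : Ev hh z = (1 - Cconj (a 0%nat) * Ev a z)%C).
    { unfold hh. rewrite (Ev_fsub _ _ (Cmod z)), Ev_fone by
        (try lra; try apply AC_fone; apply Hca; lra).
      rewrite (Ev_fmul _ _ (Cmod z)), Ev_fconst by
        (try lra; try apply AC_fconst; apply Ha; lra). reflexivity. }
    rewrite E1, E2. apply Cmod_le_1_Moebius; [exact HA1|now apply Hle]. }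
  assert (Ehh : hh = fsub (fconst (RtoC (1 - A ^ 2)))
    (fmul (flin 0 1) (fmul (fconst (Cconj (a 0%nat))) x))).
  { unfold hh. rewrite (f_equal (fmul (fconst (Cconj (a 0%nat)))) Ea).
    transitivity (fsub (fsub fone (fmul (fconst (Cconj (a 0%nat))) (fconst (a 0%nat))))
      (fmul (flin 0 1) (fmul (fconst (Cconj (a 0%nat))) x))); [fring|].
    f_equal. apply functional_extensionality. intros n. unfold fsub, fone.
    rewrite fmul_fconst_l. destruct n as [|n]; simpl; [|ring].
    rewrite RtoC_minus. unfold A.
    replace (Cmod (a 0%nat) * (Cmod (a 0%nat) * 1)) with (Cmod (a 0%nat) ^ 2) by (simpl; ring).
    rewrite Cmod2_conj. ring. }
  assert (HA2 : 0 < 1 - A ^ 2) by nra.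
  (* At the origin z x vanishes while [hh] equals 1 - A^2 > 0, so the quotient vanishes there. *)
  assert (Hw0 : w 0%nat = RtoC 0).
  { assert (Eh0 : hh 0%nat = RtoC (1 - A ^ 2)).
    { rewrite (f_equal (fun y : fps => y 0%nat) Ehh).
      change ((1 - A ^ 2)%R - 0 * fmul (fconst (Cconj (a 0%nat))) x 0 = (1 - A ^ 2)%R)%C. ring. }
    assert (E : (0 * x 0%nat)%C = (w 0%nat * hh 0%nat)%C)
      by exact (f_equal (fun y : fps => y 0%nat) Ew).
    rewrite Eh0 in E.
    replace (w 0%nat) with (w 0%nat * RtoC (1 - A ^ 2) / RtoC (1 - A ^ 2))%C.
    - rewrite <- E. field. intros H; apply RtoC_inj in H; lra.
    - field. intros H; apply RtoC_inj in H; lra. }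
  set (phi := fshift w).
  assert (Ewp := fmul_X_shift w Hw0). fold phi in Ewp.
  assert (Exp : x = fmul phi hh).
  { rewrite <- (fshift_fmul_X x), Ew, (f_equal (fun y => fmul y hh) Ewp).
    rewrite <- fmul_assoc. apply fshift_fmul_X. }
  assert (ACphi : AC phi t).
  { destruct (AC_term_le w ((rho + t) / 2)) as [M [_ HM]]; [unfold rho; lra| |].
    { apply ACw. unfold rho. lra. }
    apply AC_bounded with (M * / ((rho + t) / 2)) ((rho + t) / 2); [unfold rho; lra|].
    intros n. specialize (HM (S n)). simpl in HM.
    apply Rmult_le_reg_r with ((rho + t) / 2); [unfold rho; lra|].
    rewrite (Rmult_assoc M), Rinv_l by (unfold rho; lra). unfold phi, fshift. lra. }
  (* From |z phi| <= 1 the circle |z| = t gives only |phi| <= 1 / t, so Bohr's inequality is applied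
     to t phi. The missing factor is recovered as t -> 1, in place of the Schwarz lemma. *)
  assert (Hphi : sum_n (fun n => Cmod (phi n) * (t / 3) ^ n) N <= / t).
  { assert (HB := Bohr (fmul (fconst t) phi) t N ltac:(lra)
      ltac:(apply AC_fmul; [apply AC_fconst|exact ACphi])).
    assert (Et : sum_n (fun n => Cmod (fmul (fconst t) phi n) * (t / 3) ^ n) N =
      t * sum_n (fun n => Cmod (phi n) * (t / 3) ^ n) N).
    { rewrite (sum_n_ext _ (fun n => t * (Cmod (phi n) * (t / 3) ^ n))).
      - exact (sum_n_mult_l (K := R_Ring) t (fun n => Cmod (phi n) * (t / 3) ^ n) N).
      - intros n. rewrite fmul_fconst_l, Cmod_mult, Cmod_R, Rabs_pos_eq by lra. rring. }
    rewrite Et in HB. apply Rmult_le_reg_l with t; [lra|]. rewrite Rinv_r by lra.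
    apply HB. intros z Hz.
    assert (Hwz : Cmod (Ev w z) <= 1) by (apply Hw; unfold rho; lra).
    rewrite (f_equal (fun y => Ev y z) Ewp) in Hwz.
    rewrite (Ev_fmul _ _ t), Ev_flin, Cmod_mult in Hwz by (try lra; auto using AC_flin).
    replace (0 + 1 * z)%C with z in Hwz by ring.
    rewrite (Ev_fmul _ _ t), Ev_fconst, Cmod_mult, Cmod_R, Rabs_pos_eq
      by (try lra; auto using AC_fconst). rewrite <- Hz at 1. exact Hwz. }
  set (p := t * r). assert (Hp : 0 <= p <= t / 3) by (unfold p; nra).
  set (X := sum_n (fun n => Cmod (x n) * p ^ n) N).
  assert (HX0 : 0 <= X).
  { apply sum_n_nonneg. intros n. apply Rmult_le_pos; [apply Cmod_ge_0|apply pow_le; lra]. }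
  assert (Hhp : sum_n (fun n => Cmod (fscale p hh n)) N <= 1 - A ^ 2 + A * p * X).
  { rewrite Ehh.
    set (y := fmul (fconst (Cconj (a 0%nat))) x).
    assert (Hy : forall n, Cmod (y n) = A * Cmod (x n)).
    { intros n. unfold y. rewrite fmul_fconst_l, Cmod_mult, Cmod_conj. reflexivity. }
    assert (Hh0 : Cmod (fscale p (fsub (fconst (1 - A ^ 2)%R) (fmul (flin 0 1) y)) 0%nat)
      = 1 - A ^ 2).
    { rewrite Cmod_fscale_R by lra. unfold fsub. simpl.
      replace (RtoC (1 - A * (A * 1)) - 0 * y 0%nat)%C with (RtoC (1 - A * (A * 1))) by ring.
      rewrite Cmod_R, Rabs_pos_eq; lra. }
    assert (HhS : forall n, Cmod (fscale p (fsub (fconst (1 - A ^ 2)%R) (fmul (flin 0 1) y)) (S n))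
      = A * p * (Cmod (x n) * p ^ n)).
    { intros n. rewrite Cmod_fscale_R by lra. unfold fsub. rewrite fmul_flin_S.
      change (fconst (1 - A ^ 2)%R (S n)) with (RtoC 0).
      replace (0 - (0 * y (S n) + 1 * y n))%C with (- y n)%C by ring.
      rewrite Cmod_opp, Hy. simpl. ring. }
    destruct N as [|N'].
    - rewrite sum_O, Hh0. rewrite <- (Rplus_0_r (1 - A ^ 2)) at 1.
      apply Rplus_le_compat_l, Rmult_le_pos; [nra|exact HX0].
    - rewrite sum_n_S_left, Hh0.
      apply Rplus_le_compat_l. rewrite (sum_n_ext _ _ _ HhS).
      apply Rle_trans with (A * p * sum_n (fun n => Cmod (x n) * p ^ n) N').
      + apply Req_le. exact (sum_n_mult_l (K := R_Ring) (A * p) (fun n => Cmod (x n) * p ^ n) N').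
      + apply Rmult_le_compat_l; [nra|]. unfold X. rewrite sum_Sn.
        rewrite <- (Rplus_0_r (sum_n _ N')) at 1. apply Rplus_le_compat_l.
        apply Rmult_le_pos; [apply Cmod_ge_0|apply pow_le; lra]. }
  (* The majorant of x = phi [hh] is at most 1 / t times that of [hh], which again contains X with
     the factor A p; X is isolated at the end. *)
  assert (Hmain : t * X <= 1 - A ^ 2 + A * p * X).
  { apply Rle_trans with (2 := Hhp).
    set (H := sum_n (fun n => Cmod (fscale p hh n)) N) in *.
    assert (HH0 : 0 <= H) by (apply sum_n_nonneg; intros; apply Cmod_ge_0).
    assert (H1 : X <= / t * H).
    { unfold X. rewrite <- sum_n_fscale by lra. rewrite Exp, <- fmul_fscale.
      apply Rle_trans with (1 := Cmod_sum_fmul_le _ _ N). apply Rmult_le_compat_r; [exact HH0|].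
      rewrite sum_n_fscale by lra. apply Rle_trans with (2 := Hphi).
      apply sum_n_pow_le; [intros; apply Cmod_ge_0|exact Hp]. }
    apply Rmult_le_reg_l with (/ t); [apply Rinv_0_lt_compat; lra|].
    rewrite <- Rmult_assoc, Rinv_l by lra. lra. }
  assert (Hpow := sum_n_scal_pow (fun n => Cmod (x n)) t r N (fun n => Cmod_ge_0 _) Ht ltac:(lra)).
  fold p in Hpow. fold X in Hpow. cbv beta in Hpow.
  change (sum_n (fun n => Cmod (x n) * r ^ n) N)
    with (sum_n (fun n => Cmod (a (S n)) * r ^ n) N) in Hpow.
  set (Y := sum_n (fun n => Cmod (a (S n)) * r ^ n) N) in *.
  simpl pow at 1.
  assert (H1 : 0 <= 1 - r * A) by nra.
  apply Rle_trans with (t * (1 - r * A) * X).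
  - replace (t * t ^ N * ((1 - r * A) * Y)) with (t * (1 - r * A) * (t ^ N * Y)) by ring.
    apply Rmult_le_compat_l; [apply Rmult_le_pos; lra|exact Hpow].
  - unfold p in Hmain. lra.
Qed.

(** Used with d_i = (i+1) a_(i+1) p^i and c = n + 1: the weights i + 1 <= n + 1 are pulled out of
    the convolution. The real sequences are cast to C to reuse [fmul], hence the real part. *)
Lemma Cmod_fmul_majorant (w d : fps) (y : nat -> R) (c : R) (n : nat) :
  (forall i, (i <= n)%nat -> Cmod (d i) <= c * y i) ->
  Cmod (fmul w d n) <= c * Re (fmul (fun i => RtoC (Cmod (w i))) (fun i => RtoC (y i)) n).
Proof.
  revert w. induction n as [|n IH]; intros w H; simpl fmul.
  - rewrite Cmod_mult. simpl. specialize (H 0%nat (le_n _)).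
    apply Rmult_le_compat_l with (r := Cmod (w 0%nat)) in H; [lra|apply Cmod_ge_0].
  - apply Rle_trans with (1 := Cmod_triangle _ _). rewrite Cmod_mult.
    change (Re (?u + ?v)%C) with (Re u + Re v).
    assert (H1 := IH (fshift w) (fun i Hi => H i (le_S _ _ Hi))).
    assert (H2 := H (S n) (le_n _)).
    apply Rmult_le_compat_l with (r := Cmod (w 0%nat)) in H2; [|apply Cmod_ge_0].
    change (fshift (fun i => RtoC (Cmod (w i)))) with (fun i => RtoC (Cmod (fshift w i))).
    replace (Re (Cmod (w 0%nat) * y (S n))) with (Cmod (w 0%nat) * y (S n)) by (simpl; ring).
    lra.
Qed.

Lemma dilatation_shift_sum (k : R) (a b : fps) (r : R) (N : nat) : 0 <= k ->
  rad1 a -> rad1 b ->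
  (forall z, disk z -> Cmod (Ev (fderiv b) z) <= k * Cmod (Ev (fderiv a) z)) ->
  0 <= r <= 1 / 3 ->
  sum_n (fun n => Cmod (b (S n)) * r ^ n) N <=
  k * sum_n (fun n => Cmod (a (S n)) * r ^ n) N.
Proof.
  intros Hk Ha Hb Hle Hr.
  apply pow_lim_1_le with N.
  { apply sum_n_nonneg. intros n. apply Rmult_le_pos; [apply Cmod_ge_0|apply pow_le; lra]. }
  intros t Ht. set (rho := (1 + t) / 2).
  assert (Ha' := rad1_fderiv a Ha). assert (Hb' := rad1_fderiv b Hb).
  assert (Hka : rad1 (fmul (fconst k) (fderiv a))).
  { intros s Hs. apply AC_fmul; [apply AC_fconst|now apply Ha']. }
  destruct (analytic_quotient rho (fderiv b) (fmul (fconst k) (fderiv a))) as [w [Ew [ACw Hw]]];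
    auto.
  { unfold rho; lra. }
  { intros z Hz. assert (Hz' := Hz). unfold disk in Hz'. assert (H0 := Cmod_ge_0 z).
    rewrite (Ev_fmul _ _ (Cmod z)), Ev_fconst, Cmod_mult, Cmod_R, Rabs_pos_eq by
      (try lra; try apply AC_fconst; apply Ha'; lra). now apply Hle. }
  assert (HB := Bohr w t N ltac:(lra) (ACw t ltac:(unfold rho; lra))
    (fun z Hz => Hw z ltac:(unfold rho; lra))).
  set (p := t * r). assert (Hp : 0 <= p <= t / 3) by (unfold p; nra).
  assert (Hpow := sum_n_scal_pow (fun n => Cmod (b (S n))) t r N (fun n => Cmod_ge_0 _) Ht
    ltac:(lra)).
  apply Rle_trans with (1 := Hpow). fold p.
  set (W := fun i => RtoC (Cmod (fscale p w i))).
  set (Y := fun i => RtoC (Cmod (a (S i)) * p ^ i)).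
  (* Both sides are compared after multiplication by n + 1, which is the weight of b_(n+1) in g' and
     the largest weight of an a_(j+1) in the convolution. *)
  assert (Hterm : forall n, Cmod (b (S n)) * p ^ n <= k * Cmod (fmul W Y n)).
  { intros n.
    assert (HS : 0 < INR (S n)) by (apply lt_0_INR; lia).
    assert (H1 : Cmod (fmul (fscale p w) (fscale p (fderiv a)) n) <=
      INR (S n) * Re (fmul W Y n)).
    { apply Cmod_fmul_majorant. intros i Hi. rewrite Cmod_fscale_R by lra.
      unfold fderiv. rewrite Cmod_mult, Cmod_R, Rabs_pos_eq by apply pos_INR.
      rewrite Rmult_assoc. apply Rmult_le_compat_r.
      - apply Rmult_le_pos; [apply Cmod_ge_0|apply pow_le; lra].
      - apply le_INR. lia. }
    assert (H2 : INR (S n) * (Cmod (b (S n)) * p ^ n) =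
      k * Cmod (fmul (fscale p w) (fscale p (fderiv a)) n)).
    { rewrite fmul_fscale.
      assert (E : fderiv b n = (k * fmul w (fderiv a) n)%C).
      { rewrite (f_equal (fun y : fps => y n) Ew), <- fmul_fconst_l.
        assert (E' : fmul w (fmul (fconst k) (fderiv a)) = fmul (fconst k) (fmul w (fderiv a)))
          by fring.
        now rewrite E'. }
      apply (f_equal Cmod) in E. rewrite Cmod_mult, Cmod_R, (Rabs_pos_eq k) in E by exact Hk.
      unfold fderiv at 1 in E. rewrite Cmod_mult, Cmod_R, Rabs_pos_eq in E by apply pos_INR.
      rewrite Cmod_fscale_R by lra. rewrite <- !Rmult_assoc. now rewrite E. }
    assert (H3 := Rle_trans _ _ _ (Rle_abs _) (re_le_Cmod (fmul W Y n))).
    apply Rmult_le_reg_l with (INR (S n)); [exact HS|]. rewrite H2.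
    apply Rmult_le_compat_l with (r := k) in H1; [|exact Hk].
    apply Rmult_le_compat_l with (r := k * INR (S n)) in H3; [|nra].
    lra. }
  apply Rle_trans with (k * sum_n (fun n => Cmod (fmul W Y n)) N).
  { apply Rle_trans with (sum_n (fun n => k * Cmod (fmul W Y n)) N).
    - apply sum_n_m_le. exact Hterm.
    - apply Req_le. exact (sum_n_mult_l (K := R_Ring) k (fun n => Cmod (fmul W Y n)) N). }
  apply Rmult_le_compat_l; [exact Hk|].
  apply Rle_trans with (1 := Cmod_sum_fmul_le W Y N).
  assert (HW : sum_n (fun n => Cmod (W n)) N <= 1).
  { apply Rle_trans with (2 := HB).
    rewrite (sum_n_ext _ (fun n => Cmod (w n) * p ^ n)).
    - apply sum_n_pow_le; [intros; apply Cmod_ge_0|exact Hp].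
    - intros n. unfold W. rewrite Cmod_R, Rabs_pos_eq by apply Cmod_ge_0.
      apply Cmod_fscale_R; lra. }
  assert (HY : sum_n (fun n => Cmod (Y n)) N <= sum_n (fun n => Cmod (a (S n)) * r ^ n) N).
  { rewrite (sum_n_ext _ (fun n => Cmod (a (S n)) * p ^ n)).
    - apply sum_n_pow_le; [intros; apply Cmod_ge_0|unfold p; nra].
    - intros n. unfold Y. apply eq_trans with (1 := Cmod_R _), Rabs_pos_eq.
      apply Rmult_le_pos; [apply Cmod_ge_0|apply pow_le; lra]. }
  rewrite <- (Rmult_1_l (sum_n (fun n => Cmod (a (S n)) * r ^ n) N)).
  apply Rmult_le_compat; auto; apply sum_n_nonneg; intros; apply Cmod_ge_0.
Qed.

Lemma Series_le_bound (u : nat -> R) (M : R) : (forall n, 0 <= u n) ->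
  (forall N, sum_n u N <= M) -> ex_series u /\ Series u <= M.
Proof.
  intros H0 HM. assert (Hu := ex_series_bounded u M H0 HM). split; [exact Hu|].
  apply (is_lim_seq_le (sum_n u) (fun _ => M) (Finite _) (Finite _)).
  - exact HM.
  - now apply Series_correct.
  - apply is_lim_seq_const.
Qed.

Lemma bohr_bound (k : R) (a b : fps) (r : R) : 0 <= k -> rad1 a -> rad1 b ->
  (forall z, disk z -> Cmod (Ev a z) <= 1) ->
  (forall z, disk z -> Cmod (Ev (fderiv b) z) <= k * Cmod (Ev (fderiv a) z)) ->
  0 <= r <= 1 / 3 ->
  ex_series (fun n => Cmod (a (S n)) * r ^ S n) /\
  ex_series (fun n => Cmod (b (S n)) * r ^ S n) /\
  bohr_lhs k a b r <= 1.
Proof.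
  intros Hk Ha Hb Hbd Hle Hr. set (A := Cmod (a 0%nat)).
  assert (HA0 : 0 <= A) by apply Cmod_ge_0.
  assert (HA1 : A <= 1).
  { unfold A. rewrite <- Ev_0. apply Hbd. unfold disk. rewrite Cmod_0. lra. }
  assert (HD : 0 < 1 - r * A) by nra.
  assert (Hfac : forall (c : fps) N, sum_n (fun n => Cmod (c (S n)) * r ^ S n) N =
    r * sum_n (fun n => Cmod (c (S n)) * r ^ n) N).
  { intros c N. rewrite (sum_n_ext _ (fun n => r * (Cmod (c (S n)) * r ^ n))).
    - exact (sum_n_mult_l (K := R_Ring) r (fun n => Cmod (c (S n)) * r ^ n) N).
    - intros n. simpl. rring. }
  set (T := (1 - A ^ 2) / (1 - r * A)).
  assert (Hsa : forall N, sum_n (fun n => Cmod (a (S n)) * r ^ n) N <= T).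
  { intros N. assert (H := bounded_shift_sum a r N Ha Hbd Hr). fold A in H.
    apply Rmult_le_reg_l with (1 - r * A); [exact HD|].
    apply Rle_trans with (1 := H). apply Req_le. unfold T. field. lra. }
  assert (Hnn : forall (c : fps) n, 0 <= Cmod (c (S n)) * r ^ S n).
  { intros c n. apply Rmult_le_pos; [apply Cmod_ge_0|apply pow_le; lra]. }
  destruct (Series_le_bound _ (r * T) (Hnn a)) as [Xa Sa].
  { intros N. rewrite Hfac. apply Rmult_le_compat_l; [lra|apply Hsa]. }
  destruct (Series_le_bound _ (r * (k * T)) (Hnn b)) as [Xb Sb].
  { intros N. rewrite Hfac. apply Rmult_le_compat_l; [lra|].
    apply Rle_trans with (1 := dilatation_shift_sum k a b r N Hk Ha Hb Hle Hr).
    apply Rmult_le_compat_l; [exact Hk|apply Hsa]. }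
  repeat split; auto. unfold bohr_lhs. fold A.
  (* The first summand is 1 minus exactly the sum of the two bounds r T and k r T. *)
  replace ((1 - r * (A + (k + 1) * (1 - A ^ 2))) / (1 - r * A))
    with (1 - (k + 1) * (r * T)) by (unfold T; field; lra).
  lra.
Qed.

(** * Wirtinger derivatives *)

Lemma ball_Cmod (z w : C) (e : R) : Cmod (w - z) < e -> ball z e w.
Proof. exact (C_NormedModule_mixin_compat1 z w e). Qed.

(** Balls of C are squares for the maximum of the two components; the factor sqrt 2 is rounded up to
    2. *)
Lemma Cmod_ball (z w : C) (e : posreal) : ball z e w -> Cmod (w - z) < 2 * e.
Proof.
  intros H. apply Rlt_le_trans with (1 := C_NormedModule_mixin_compat2 z w e H).
  apply Rmult_le_compat_r; [apply Rlt_le, cond_pos|].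
  rewrite <- (sqrt_pow2 2) at 2 by lra. apply sqrt_le_1; simpl; lra.
Qed.

Lemma locally_Cmod (z : C) (d : R) (P : C -> Prop) : 0 < d ->
  (forall w, Cmod (w - z) < d -> P w) -> locally z P.
Proof.
  intros Hd H. exists (mkposreal (d / 2) ltac:(lra)). intros w Hw.
  apply H. apply Cmod_ball in Hw. simpl in Hw. lra.
Qed.

Lemma locally_Cmod_inv (z : C) (P : C -> Prop) : locally z P ->
  exists d, 0 < d /\ forall w, Cmod (w - z) < d -> P w.
Proof.
  intros [e He]. exists e. split; [apply cond_pos|]. intros w Hw. now apply He, ball_Cmod.
Qed.

Lemma quad_deriv_C_derive (F : C -> C) (z l : C) : quad_deriv F z l -> C_derive F z = l.
Proof.
  intros [M [d [Hd [HM H]]]]. apply is_C_lim_unique. apply filterlim_locally. intros eps.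
  assert (He := cond_pos eps).
  assert (Hq : 0 < eps / (M + 1)) by (apply Rdiv_lt_0_compat; lra).
  apply (locally_Cmod z (Rmin d (eps / (M + 1)))); [now apply Rmin_glb_lt|].
  intros w Hw Hne.
  assert (H1 := Rlt_le_trans _ _ _ Hw (Rmin_l _ _)).
  assert (H2 := Rlt_le_trans _ _ _ Hw (Rmin_r _ _)).
  assert (Hwz : (w - z)%C <> RtoC 0).
  { intros E. apply Hne. replace w with (w - z + z)%C by ring. rewrite E. apply Cplus_0_l. }
  assert (Hpos := proj1 (Cmod_gt_0 _) Hwz).
  apply ball_Cmod.
  replace ((F w - F z) / (w - z) - l)%C with ((F w - F z - l * (w - z)) / (w - z))%C
    by (field; exact Hwz).
  rewrite Cmod_div by exact Hwz.
  apply Rmult_lt_reg_r with (1 := Hpos). unfold Rdiv. rewrite Rmult_assoc, Rinv_l by lra.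
  apply Rmult_lt_compat_r with (r := M + 1) in H2; [|lra].
  replace (eps / (M + 1) * (M + 1)) with (pos eps) in H2 by (field; lra).
  specialize (H w H1). nra.
Qed.

Lemma quad_derive_R (phi : R -> R) (x l M d : R) : 0 < d -> 0 <= M ->
  (forall t, Rabs (t - x) < d -> Rabs (phi t - phi x - l * (t - x)) <= M * (t - x) ^ 2) ->
  is_derive phi x l.
Proof.
  intros Hd HM H. apply is_derive_Reals. intros eps He.
  assert (Hq : 0 < eps / (M + 1)) by (apply Rdiv_lt_0_compat; lra).
  assert (Hm : 0 < Rmin d (eps / (M + 1))) by now apply Rmin_glb_lt.
  exists (mkposreal _ Hm). intros s Hs0 Hs. simpl in Hs.
  assert (H1 := Rlt_le_trans _ _ _ Hs (Rmin_l _ _)).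
  assert (H2 := Rlt_le_trans _ _ _ Hs (Rmin_r _ _)).
  specialize (H (x + s)). replace (x + s - x) with s in H by ring. specialize (H H1).
  replace ((phi (x + s) - phi x) / s - l) with ((phi (x + s) - phi x - l * s) / s)
    by (field; exact Hs0).
  assert (Hpos := Rabs_pos_lt s Hs0).
  unfold Rdiv. rewrite Rabs_mult, Rabs_inv.
  apply Rmult_lt_reg_r with (1 := Hpos). rewrite Rmult_assoc, Rinv_l by lra.
  apply Rmult_lt_compat_r with (r := M + 1) in H2; [|lra].
  replace (eps / (M + 1) * (M + 1)) with eps in H2 by (field; lra).
  rewrite <- pow2_abs in H. nra.
Qed.

Lemma Cconj_R (x : R) : Cconj (RtoC x) = RtoC x.
Proof. unfold Cconj, RtoC; simpl. f_equal. ring. Qed.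

Lemma Cconj_Ci : Cconj Ci = (- Ci)%C.
Proof. apply injective_projections; simpl; ring. Qed.

(** The increment is linear in w - z and its conjugate. The second part is written with q inside the
    conjugate, so that q = g' for f = h + conj g, and f_zbar = conj q. *)
Definition quad_wirtinger (f : C -> C) (z p q : C) : Prop :=
  exists M d, 0 < d /\ 0 <= M /\ forall w, Cmod (w - z) < d ->
    Cmod (f w - f z - (p * (w - z) + Cconj (q * (w - z)))) <= M * Cmod (w - z) ^ 2.

(** Along a horizontal line w - z is real and passes through the conjugation; along a vertical one,
    in the next lemma, it is imaginary and changes sign. *)
Lemma quad_wirtinger_partial_x (f : C -> C) (z p q : C) : quad_wirtinger f z p q ->
  partial_x f z = (p + Cconj q)%C.
Proof.
  intros [M [d [Hd [HM H]]]].
  assert (Hw : forall t, ((t, Im z) - z)%C = RtoC (t - Re z)).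
  { intros t. destruct z as [x y]. apply injective_projections; simpl; ring. }
  assert (Hz : f (Re z, Im z) = f z) by (now destruct z).
  assert (Hb : forall t, Rabs (t - Re z) < d ->
    Cmod (f (t, Im z) - f z - (p + Cconj q) * RtoC (t - Re z)) <= M * (t - Re z) ^ 2).
  { intros t Ht. specialize (H (t, Im z)). rewrite Hw, Cmod_R, pow2_abs in H.
    replace ((p + Cconj q) * RtoC (t - Re z))%C
      with (p * RtoC (t - Re z) + Cconj (q * RtoC (t - Re z)))%C; [now apply H|].
    set (s := RtoC (t - _)). rewrite !Cmult_conj. unfold s. rewrite Cconj_R, ?Cconj_Ci. ring. }
  unfold partial_x. apply injective_projections; simpl fst; simpl snd; apply is_derive_unique;
    apply quad_derive_R with M d; auto; intros t Ht; apply Rle_trans with (2 := Hb t Ht);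
    rewrite Hz; [eapply Rle_trans; [|apply re_le_Cmod]|eapply Rle_trans; [|apply im_le_Cmod]];
    apply Req_le; apply (f_equal Rabs); simpl; unfold Re, Im; simpl; ring.
Qed.

Lemma quad_wirtinger_partial_y (f : C -> C) (z p q : C) : quad_wirtinger f z p q ->
  partial_y f z = (Ci * p - Ci * Cconj q)%C.
Proof.
  intros [M [d [Hd [HM H]]]].
  assert (Hw : forall t, ((Re z, t) - z)%C = (Ci * RtoC (t - Im z))%C).
  { intros t. destruct z as [x y]. apply injective_projections; simpl; ring. }
  assert (Hz : f (Re z, Im z) = f z) by (now destruct z).
  assert (Hb : forall t, Rabs (t - Im z) < d ->
    Cmod (f (Re z, t) - f z - (Ci * p - Ci * Cconj q) * RtoC (t - Im z)) <= M * (t - Im z) ^ 2).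
  { intros t Ht. specialize (H (Re z, t)).
    rewrite Hw, Cmod_mult, Cmod_Ci, Cmod_R, Rmult_1_l, pow2_abs in H.
    replace ((Ci * p - Ci * Cconj q) * RtoC (t - Im z))%C
      with (p * (Ci * RtoC (t - Im z)) + Cconj (q * (Ci * RtoC (t - Im z))))%C; [now apply H|].
    set (s := RtoC (t - _)). rewrite !Cmult_conj. unfold s. rewrite Cconj_R, ?Cconj_Ci. ring. }
  unfold partial_y. apply injective_projections; simpl fst; simpl snd; apply is_derive_unique;
    apply quad_derive_R with M d; auto; intros t Ht; apply Rle_trans with (2 := Hb t Ht);
    rewrite Hz; [eapply Rle_trans; [|apply re_le_Cmod]|eapply Rle_trans; [|apply im_le_Cmod]];
    apply Req_le; apply (f_equal Rabs); simpl; unfold Re, Im; simpl; ring.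
Qed.

Lemma quad_wirtinger_derivs (f : C -> C) (z p q : C) : quad_wirtinger f z p q ->
  d_z f z = p /\ d_zbar f z = Cconj q.
Proof.
  intros H. unfold d_z, d_zbar.
  rewrite (quad_wirtinger_partial_x f z p q H), (quad_wirtinger_partial_y f z p q H).
  assert (H2 : RtoC 2 <> RtoC 0) by (intros E; apply RtoC_inj in E; lra).
  assert (Hi : (Ci * Ci)%C = (- (1))%C) by (apply injective_projections; simpl; ring).
  split.
  - replace (p + Cconj q - Ci * (Ci * p - Ci * Cconj q))%C
      with (p + Cconj q - (Ci * Ci) * (p - Cconj q))%C by ring.
    rewrite Hi. now field.
  - replace (p + Cconj q + Ci * (Ci * p - Ci * Cconj q))%C
      with (p + Cconj q + (Ci * Ci) * (p - Cconj q))%C by ring.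
    rewrite Hi. now field.
Qed.

Lemma disk_ball (z w : C) : disk z -> Cmod (w - z) < 1 - Cmod z -> disk w.
Proof.
  intros Hz Hw. unfold disk. generalize (Cmod_le_plus_minus z w).
  rewrite Cmod_minus_sym. lra.
Qed.

Lemma harmonic_quad_wirtinger (f h g : C -> C) (z p q : C) : disk z ->
  (forall w, disk w -> f w = (h w + Cconj (g w))%C) ->
  quad_deriv h z p -> quad_deriv g z q -> quad_wirtinger f z p q.
Proof.
  intros Hz Hf [M1 [d1 [Hd1 [HM1 H1]]]] [M2 [d2 [Hd2 [HM2 H2]]]].
  assert (Hzd : 0 < 1 - Cmod z) by (unfold disk in Hz; lra).
  exists (M1 + M2), (Rmin (1 - Cmod z) (Rmin d1 d2)).
  split; [now repeat apply Rmin_glb_lt|]. split; [lra|]. intros w Hw.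
  assert (A0 := Rlt_le_trans _ _ _ Hw (Rmin_l _ _)).
  assert (A1 := Rlt_le_trans _ _ _ Hw (Rmin_r _ _)).
  specialize (H1 w (Rlt_le_trans _ _ _ A1 (Rmin_l _ _))).
  specialize (H2 w (Rlt_le_trans _ _ _ A1 (Rmin_r _ _))).
  rewrite (Hf w), (Hf z) by (auto; now apply disk_ball with z).
  replace (h w + Cconj (g w) - (h z + Cconj (g z)) - (p * (w - z) + Cconj (q * (w - z))))%C
    with (h w - h z - p * (w - z) + Cconj (g w - g z - q * (w - z)))%C
    by (rewrite !Cminus_conj; ring).
  apply Rle_trans with (1 := Cmod_triangle _ _). rewrite Cmod_conj. lra.
Qed.

Lemma quad_deriv_ext_disk (F G : C -> C) (z l : C) : disk z ->
  (forall w, disk w -> F w = G w) -> quad_deriv F z l -> quad_deriv G z l.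
Proof.
  intros Hz HFG [M [d [Hd [HM H]]]].
  assert (Hzd : 0 < 1 - Cmod z) by (unfold disk in Hz; lra).
  exists M, (Rmin (1 - Cmod z) d). split; [now apply Rmin_glb_lt|]. split; [exact HM|].
  intros w Hw. rewrite <- !HFG.
  - apply H, (Rlt_le_trans _ _ _ Hw), Rmin_r.
  - exact Hz.
  - apply disk_ball with z; [exact Hz|]. apply (Rlt_le_trans _ _ _ Hw), Rmin_l.
Qed.

(** With p = |h'| and q = |g'|, sense preservation makes p - q positive, so the quotient bound (p +
    q) / (p - q) <= K can be cleared to (K + 1) q <= (K - 1) p. *)
Lemma quasiconformal_dilatation (K : R) (f h g : C -> C) (a b : fps) :
  harmonic_mapping f h g a b -> quasiconformal K f h g ->
  dilatation_le ((K - 1) / (K + 1)) h g.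
Proof.
  intros [Hh [Hg [_ Hf]]] [HK [Hsp [_ Hdil]]] z Hz.
  destruct (is_pseries_rad1 a h Hh) as [Ra Eh]. destruct (is_pseries_rad1 b g Hg) as [Rb Eg].
  assert (Qh : quad_deriv h z (Ev (fderiv a) z)).
  { apply (quad_deriv_ext_disk (Ev a)); auto using Ev_quad_deriv. intros; now rewrite Eh. }
  assert (Qg : quad_deriv g z (Ev (fderiv b) z)).
  { apply (quad_deriv_ext_disk (Ev b)); auto using Ev_quad_deriv. intros; now rewrite Eg. }
  destruct (quad_wirtinger_derivs f z _ _ (harmonic_quad_wirtinger f h g z _ _ Hz Hf Qh Qg))
    as [E1 E2].
  specialize (Hsp z Hz). specialize (Hdil z Hz).
  rewrite E1, E2, Cmod_conj in Hdil.
  rewrite (quad_deriv_C_derive _ _ _ Qh), (quad_deriv_C_derive _ _ _ Qg) in *.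
  set (p := Cmod (Ev (fderiv a) z)) in *. set (q := Cmod (Ev (fderiv b) z)) in *.
  assert (Hp : 0 <= p) by apply Cmod_ge_0. assert (Hq : 0 <= q) by apply Cmod_ge_0.
  assert (Hpq : 0 < p - q) by nra.
  apply Rmult_le_compat_r with (r := p - q) in Hdil; [|lra].
  unfold Rdiv in Hdil at 1. rewrite Rmult_assoc, Rinv_l in Hdil by lra.
  apply Rmult_le_reg_r with (K + 1); [lra|].
  replace ((K - 1) / (K + 1) * p * (K + 1)) with ((K - 1) * p) by (field; lra).
  lra.
Qed.

Lemma bohr_harmonic (k : R) (f h g : C -> C) (a b : nat -> C) :
  harmonic_mapping f h g a b -> 0 <= k -> dilatation_le k h g ->
  (forall z, disk z -> Cmod (h z) <= 1) ->
  forall r, 0 <= r <= 1 / 3 ->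
    ex_series (fun n => Cmod (a (S n)) * r ^ S n) /\
    ex_series (fun n => Cmod (b (S n)) * r ^ S n) /\
    bohr_lhs k a b r <= 1.
Proof.
  intros [Hh [Hg _]] Hk Hdil Hbd r Hr.
  destruct (is_pseries_rad1 a h Hh) as [Ra Eh]. destruct (is_pseries_rad1 b g Hg) as [Rb Eg].
  apply bohr_bound; auto.
  - intros z Hz. rewrite <- Eh by exact Hz. now apply Hbd.
  - intros z Hz. specialize (Hdil z Hz).
    rewrite (quad_deriv_C_derive h z (Ev (fderiv a) z)),
      (quad_deriv_C_derive g z (Ev (fderiv b) z)) in Hdil; [exact Hdil| |].
    + apply (quad_deriv_ext_disk (Ev b)); auto using Ev_quad_deriv. intros; now rewrite Eg.
    + apply (quad_deriv_ext_disk (Ev a)); auto using Ev_quad_deriv. intros; now rewrite Eh.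
Qed.

(** * The extremal maps *)

Lemma Moebius_denominator (a z : C) : disk a -> disk z ->
  1 - Cmod a <= Cmod (1 + Cconj a * z).
Proof.
  unfold disk. intros Ha Hz. assert (H0 := Cmod_ge_0 a). assert (H1 := Cmod_ge_0 z).
  assert (H := Cmod_le_plus_minus (1 + Cconj a * z) 1).
  replace (1 + Cconj a * z - 1)%C with (Cconj a * z)%C in H by ring.
  rewrite Cmod_1, Cmod_mult, Cmod_conj in H. nra.
Qed.

Lemma Moebius_denominator_neq0 (a z : C) : disk a -> disk z ->
  (1 + Cconj a * z)%C <> RtoC 0.
Proof.
  intros Ha Hz. apply Cmod_gt_0. assert (H := Moebius_denominator a z Ha Hz).
  unfold disk in Ha. lra.
Qed.

Lemma disk_opp (a : C) : disk a -> disk (- a).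
Proof. unfold disk. now rewrite Cmod_opp. Qed.

Lemma extremal_h_disk (a0 z : C) : disk a0 -> disk z -> disk (extremal_h a0 z).
Proof.
  intros Ha Hz. assert (Hn := Moebius_denominator_neq0 a0 z Ha Hz).
  unfold disk, extremal_h. rewrite Cmod_div by exact Hn.
  assert (Hp := proj1 (Cmod_gt_0 _) Hn).
  apply Rmult_lt_reg_r with (1 := Hp). unfold Rdiv. rewrite Rmult_assoc, Rinv_l by lra.
  assert (E := Moebius_modulus (- a0) z). rewrite Copp_conj, Cmod_opp in E.
  replace (1 - - Cconj a0 * z)%C with (1 + Cconj a0 * z)%C in E by ring.
  replace (z - - a0)%C with (z + a0)%C in E by ring.
  unfold disk in *. assert (H0 := Cmod_ge_0 a0). assert (H1 := Cmod_ge_0 z).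
  assert (0 < (1 - Cmod a0 ^ 2) * (1 - Cmod z ^ 2)) by (apply Rmult_lt_0_compat; nra).
  assert (H3 := Cmod_ge_0 (z + a0)). nra.
Qed.

Lemma Cmult_conj_Cmod2 (c : C) : (Cconj c * c)%C = RtoC (Cmod c ^ 2).
Proof. rewrite Cmod2_conj. ring. Qed.

Lemma extremal_h_opp_inv (a0 z : C) : disk a0 -> disk z ->
  extremal_h (- a0) (extremal_h a0 z) = z.
Proof.
  intros Ha Hz. assert (Hn := Moebius_denominator_neq0 a0 z Ha Hz).
  assert (Hn' := Moebius_denominator_neq0 (- a0) _ (disk_opp _ Ha) (extremal_h_disk a0 z Ha Hz)).
  unfold extremal_h in *. rewrite Copp_conj in *.
  assert (Hd : (1 - Cconj a0 * a0)%C <> RtoC 0).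
  { rewrite Cmult_conj_Cmod2, <- RtoC_minus. intros E. apply RtoC_inj in E.
    assert (H0 := Cmod_ge_0 a0). unfold disk in Ha. nra. }
  field. split; [exact Hn|].
  replace (1 + Cconj a0 * z + - Cconj a0 * (z + a0))%C with (1 - Cconj a0 * a0)%C by ring.
  exact Hd.
Qed.

Definition extremal_h' (a0 z : C) : C :=
  (RtoC (1 - Cmod a0 ^ 2) / ((1 + Cconj a0 * z) * (1 + Cconj a0 * z)))%C.

Lemma extremal_h'_neq0 (a0 z : C) : disk a0 -> disk z -> extremal_h' a0 z <> RtoC 0.
Proof.
  intros Ha Hz E. assert (Hn := Moebius_denominator_neq0 a0 z Ha Hz).
  unfold extremal_h' in E. apply (f_equal (fun x => x * ((1 + Cconj a0 * z) * (1 + Cconj a0 * z)))%C) in E.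
  replace (RtoC (1 - Cmod a0 ^ 2) / ((1 + Cconj a0 * z) * (1 + Cconj a0 * z))
    * ((1 + Cconj a0 * z) * (1 + Cconj a0 * z)))%C with (RtoC (1 - Cmod a0 ^ 2)) in E
    by (field; exact Hn).
  rewrite Cmult_0_l in E. apply RtoC_inj in E.
  assert (H0 := Cmod_ge_0 a0). unfold disk in Ha. nra.
Qed.

(** The remainder is exactly - h'(z) conj a_0 / (1 + conj a_0 w) times (w - z)^2, and the
    denominator is at least 1 - |a_0|. *)
Lemma extremal_h_quad_deriv (a0 z : C) : disk a0 -> disk z ->
  quad_deriv (extremal_h a0) z (extremal_h' a0 z).
Proof.
  intros Ha Hz. assert (Hn := Moebius_denominator_neq0 a0 z Ha Hz).
  assert (Hz' := Hz). assert (Ha' := Ha). unfold disk in Hz', Ha'.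
  exists (Cmod (extremal_h' a0 z * Cconj a0) / (1 - Cmod a0)), (1 - Cmod z).
  split; [lra|]. split.
  { apply Rdiv_le_0_compat; [apply Cmod_ge_0|lra]. }
  intros w Hw. assert (Hwd := disk_ball z w Hz Hw).
  assert (Hnw := Moebius_denominator_neq0 a0 w Ha Hwd).
  assert (Hlow := Moebius_denominator a0 w Ha Hwd).
  replace (extremal_h a0 w - extremal_h a0 z - extremal_h' a0 z * (w - z))%C
    with (- (extremal_h' a0 z * Cconj a0 / (1 + Cconj a0 * w)) * ((w - z) * (w - z)))%C.
  - rewrite Cmod_mult, Cmod_opp, Cmod_div, (Cmod_mult (w - z)) by exact Hnw.
    replace (Cmod (w - z) * Cmod (w - z)) with (Cmod (w - z) ^ 2) by ring.
    apply Rmult_le_compat_r; [apply pow_le, Cmod_ge_0|].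
    apply Rmult_le_compat_l; [apply Cmod_ge_0|]. apply Rinv_le_contravar; lra.
  - unfold extremal_h, extremal_h'. rewrite RtoC_minus, <- Cmult_conj_Cmod2.
    field. now split.
Qed.

Definition extremal_a (a0 : C) : fps := fun n =>
  match n with
  | O => a0
  | S m => (RtoC (1 - Cmod a0 ^ 2) * (- Cconj a0) ^ m)%C
  end.

Definition extremal_b (a0 : C) (lam : R) : fps :=
  fmul (fconst lam) (fsub (extremal_a a0) (fconst a0)).

Lemma Cmod_extremal_a_S (a0 : C) (n : nat) : disk a0 ->
  Cmod (extremal_a a0 (S n)) = (1 - Cmod a0 ^ 2) * Cmod a0 ^ n.
Proof.
  intros Ha. unfold disk in Ha. assert (H0 := Cmod_ge_0 a0). simpl extremal_a.
  rewrite Cmod_mult, Cmod_pow, Cmod_opp, Cmod_conj, Cmod_R, Rabs_pos_eq; [reflexivity|nra].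
Qed.

Lemma rad1_extremal_a (a0 : C) : disk a0 -> rad1 (extremal_a a0).
Proof.
  intros Ha t Ht. assert (H0 := Cmod_ge_0 a0). assert (Ha' := Ha). unfold disk in Ha'.
  apply AC_bounded with 1 1; [lra|]. intros n. rewrite pow1, Rmult_1_r.
  destruct n as [|n]; [simpl; lra|]. rewrite Cmod_extremal_a_S by exact Ha.
  assert (H1 : Cmod a0 ^ n <= 1) by (rewrite <- (pow1 n); apply pow_incr; lra).
  assert (H2 : 0 <= Cmod a0 ^ n) by now apply pow_le.
  assert (H3 : 0 <= Cmod a0 ^ 2 <= 1) by nra. nra.
Qed.

(** Multiplying the coefficients by 1 + conj a_0 z telescopes the geometric part and leaves a_0 +
    z. *)
Lemma Ev_extremal_a (a0 z : C) : disk a0 -> disk z -> Ev (extremal_a a0) z = extremal_h a0 z.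
Proof.
  intros Ha Hz. assert (Hn := Moebius_denominator_neq0 a0 z Ha Hz).
  assert (E : fmul (flin 1 (Cconj a0)) (extremal_a a0) = flin a0 1).
  { apply functional_extensionality. intros [|[|n]].
    - simpl. ring.
    - rewrite fmul_flin_S.
      change (1 * (RtoC (1 - Cmod a0 ^ 2) * 1) + Cconj a0 * a0 = 1)%C.
      rewrite RtoC_minus, <- Cmult_conj_Cmod2. ring.
    - rewrite fmul_flin_S. simpl. ring. }
  assert (E' := Ev_mult (flin 1 (Cconj a0)) (extremal_a a0) z
    (rad1_flin _ _) (rad1_extremal_a a0 Ha) Hz).
  rewrite E, !Ev_flin in E'. unfold extremal_h.
  replace (z + a0)%C with (a0 + 1 * z)%C by ring. rewrite E'. field. exact Hn.
Qed.

Lemma rad1_extremal_b (a0 : C) (lam : R) : disk a0 -> rad1 (extremal_b a0 lam).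
Proof.
  intros Ha t Ht. apply AC_fmul; [apply AC_fconst|].
  apply AC_fsub; [now apply rad1_extremal_a|apply AC_fconst].
Qed.

Lemma Ev_extremal_b (a0 z : C) (lam : R) : disk a0 -> disk z ->
  Ev (extremal_b a0 lam) z = extremal_g lam a0 z.
Proof.
  intros Ha Hz. assert (Hz' := Hz). unfold disk in Hz'. assert (H0 := Cmod_ge_0 z).
  assert (Ra := rad1_extremal_a a0 Ha (Cmod z) ltac:(lra)).
  unfold extremal_b, extremal_g.
  rewrite (Ev_fmul _ _ (Cmod z)), (Ev_fsub _ _ (Cmod z)), !Ev_fconst, Ev_extremal_a
    by (auto using AC_fconst, AC_fsub; lra).
  reflexivity.
Qed.

Lemma extremal_b_S (a0 : C) (lam : R) (n : nat) :
  extremal_b a0 lam (S n) = (lam * extremal_a a0 (S n))%C.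
Proof.
  unfold extremal_b. rewrite fmul_fconst_l. unfold fsub. simpl fconst. ring.
Qed.

Lemma extremal_harmonic (a0 : C) (lam : R) : disk a0 ->
  harmonic_mapping (extremal_f lam a0) (extremal_h a0) (extremal_g lam a0)
    (extremal_a a0) (extremal_b a0 lam).
Proof.
  intros Ha. repeat split.
  - intros z Hz. rewrite <- Ev_extremal_a by assumption.
    apply rad1_is_pseries; [now apply rad1_extremal_a|exact Hz].
  - intros z Hz. rewrite <- Ev_extremal_b by assumption.
    apply rad1_is_pseries; [now apply rad1_extremal_b|exact Hz].
  - unfold extremal_b. rewrite fmul_fconst_l. unfold fsub. simpl. ring.
Qed.

Lemma quad_deriv_scal_minus (F : C -> C) (z l c x : C) : quad_deriv F z l ->
  quad_deriv (fun w => x * (F w - c))%C z (x * l)%C.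
Proof.
  intros [M [d [Hd [HM H]]]]. exists (Cmod x * M), d. split; [exact Hd|]. split.
  { apply Rmult_le_pos; [apply Cmod_ge_0|exact HM]. }
  intros w Hw. specialize (H w Hw).
  replace (x * (F w - c) - x * (F z - c) - x * l * (w - z))%C
    with (x * (F w - F z - l * (w - z)))%C by ring.
  rewrite Cmod_mult, Rmult_assoc. apply Rmult_le_compat_l; [apply Cmod_ge_0|exact H].
Qed.

Lemma extremal_g_quad_deriv (lam : R) (a0 z : C) : disk a0 -> disk z ->
  quad_deriv (extremal_g lam a0) z (lam * extremal_h' a0 z)%C.
Proof. intros Ha Hz. now apply quad_deriv_scal_minus, extremal_h_quad_deriv. Qed.

Lemma extremal_dilatation (k lam : R) (a0 : C) : disk a0 -> 0 <= lam <= k ->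
  dilatation_le k (extremal_h a0) (extremal_g lam a0).
Proof.
  intros Ha Hl z Hz.
  rewrite (quad_deriv_C_derive _ _ _ (extremal_h_quad_deriv a0 z Ha Hz)).
  rewrite (quad_deriv_C_derive _ _ _ (extremal_g_quad_deriv lam a0 z Ha Hz)).
  rewrite Cmod_mult, Cmod_R, Rabs_pos_eq by lra.
  apply Rmult_le_compat_r; [apply Cmod_ge_0|lra].
Qed.

(** * The extremal maps as quasiconformal homeomorphisms *)

Definition locally_Lipschitz_at (F : C -> C) (z : C) : Prop :=
  exists M d, 0 < d /\ 0 <= M /\
    forall w, Cmod (w - z) < d -> Cmod (F w - F z) <= M * Cmod (w - z).

Lemma locally_Lipschitz_filterlim (F : C -> C) (z : C) : locally_Lipschitz_at F z ->
  filterlim F (locally z) (locally (F z)).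
Proof.
  intros [M [d [Hd [HM H]]]]. apply filterlim_locally. intros eps.
  assert (He := cond_pos eps).
  assert (Hq : 0 < eps / (M + 1)) by (apply Rdiv_lt_0_compat; lra).
  apply (locally_Cmod z (Rmin d (eps / (M + 1)))); [now apply Rmin_glb_lt|].
  intros w Hw.
  assert (H1 := Rlt_le_trans _ _ _ Hw (Rmin_l _ _)).
  assert (H2 := Rlt_le_trans _ _ _ Hw (Rmin_r _ _)).
  apply ball_Cmod. apply Rle_lt_trans with (1 := H w H1).
  apply Rmult_lt_compat_r with (r := M + 1) in H2; [|lra].
  replace (eps / (M + 1) * (M + 1)) with (pos eps) in H2 by (field; lra).
  assert (H3 := Cmod_ge_0 (w - z)). nra.
Qed.

Lemma locally_Lipschitz_continuous_on (D : C -> Prop) (F : C -> C) :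
  (forall z, D z -> locally_Lipschitz_at F z) -> continuous_on D F.
Proof.
  intros H z Hz P HP. apply filter_le_within.
  exact (locally_Lipschitz_filterlim F z (H z Hz) P HP).
Qed.

Lemma locally_Lipschitz_comp (F G : C -> C) (z : C) : locally_Lipschitz_at F z ->
  locally_Lipschitz_at G (F z) -> locally_Lipschitz_at (fun w => G (F w)) z.
Proof.
  intros [M1 [d1 [Hd1 [HM1 H1]]]] [M2 [d2 [Hd2 [HM2 H2]]]].
  assert (Hq : 0 < d2 / (M1 + 1)) by (apply Rdiv_lt_0_compat; lra).
  exists (M2 * M1), (Rmin d1 (d2 / (M1 + 1))). split; [now apply Rmin_glb_lt|].
  split; [now apply Rmult_le_pos|]. intros w Hw.
  assert (A1 := Rlt_le_trans _ _ _ Hw (Rmin_l _ _)).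
  assert (A2 := Rlt_le_trans _ _ _ Hw (Rmin_r _ _)).
  specialize (H1 w A1).
  apply Rmult_lt_compat_r with (r := M1 + 1) in A2; [|lra].
  replace (d2 / (M1 + 1) * (M1 + 1)) with d2 in A2 by (field; lra).
  assert (H3 := Cmod_ge_0 (w - z)).
  assert (H4 : Cmod (F w - F z) < d2) by nra.
  apply Rle_trans with (1 := H2 _ H4). rewrite Rmult_assoc.
  now apply Rmult_le_compat_l.
Qed.

Lemma quad_deriv_locally_Lipschitz (F : C -> C) (z l : C) : quad_deriv F z l ->
  locally_Lipschitz_at F z.
Proof.
  intros [M [d [Hd [HM H]]]]. exists (Cmod l + M * d), d. split; [exact Hd|].
  assert (Hl := Cmod_ge_0 l). split; [nra|]. intros w Hw. specialize (H w Hw).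
  assert (H0 := Cmod_ge_0 (w - z)).
  replace (F w - F z)%C with (l * (w - z) + (F w - F z - l * (w - z)))%C by ring.
  apply Rle_trans with (1 := Cmod_triangle _ _). rewrite Cmod_mult.
  assert (Cmod (w - z) ^ 2 <= d * Cmod (w - z)) by nra.
  assert (M * Cmod (w - z) ^ 2 <= M * (d * Cmod (w - z))) by now apply Rmult_le_compat_l.
  lra.
Qed.

(* [extremal_f lam a0] is the real-affine map [u |-> u + lam conj (u - a0)] after
   [extremal_h a0]; this is the inverse of the affine map. *)
Definition affine_inv (lam : R) (a0 w : C) : C :=
  (a0 + (w - a0 - lam * Cconj (w - a0)) / RtoC (1 - lam ^ 2))%C.

Lemma RtoC_1_minus_sqr_neq0 (lam : R) : 0 <= lam < 1 -> RtoC (1 - lam ^ 2) <> RtoC 0.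
Proof. intros Hl E. apply RtoC_inj in E. nra. Qed.

Lemma affine_inv_l (lam : R) (a0 u : C) : 0 <= lam < 1 ->
  affine_inv lam a0 (u + lam * Cconj (u - a0))%C = u.
Proof.
  intros Hl. assert (Hn := RtoC_1_minus_sqr_neq0 lam Hl). unfold affine_inv.
  replace (u + lam * Cconj (u - a0) - a0)%C with (u - a0 + lam * Cconj (u - a0))%C by ring.
  rewrite Cplus_conj, Cmult_conj, Cconj_conj, Cconj_R.
  replace (u - a0 + lam * Cconj (u - a0) - lam * (Cconj (u - a0) + lam * (u - a0)))%C
    with (RtoC (1 - lam ^ 2) * (u - a0))%C
    by (rewrite RtoC_minus, RtoC_pow; simpl; ring).
  field. exact Hn.
Qed.

Lemma affine_inv_r (lam : R) (a0 w : C) : 0 <= lam < 1 ->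
  (affine_inv lam a0 w + lam * Cconj (affine_inv lam a0 w - a0))%C = w.
Proof.
  intros Hl. assert (Hn := RtoC_1_minus_sqr_neq0 lam Hl). unfold affine_inv.
  replace w with (a0 + (w - a0))%C at 5 by ring. generalize (w - a0)%C. intros s.
  replace (a0 + (s - lam * Cconj s) / RtoC (1 - lam ^ 2) - a0)%C
    with ((s - lam * Cconj s) / RtoC (1 - lam ^ 2))%C by ring.
  rewrite Cdiv_conj, Cminus_conj, Cmult_conj, Cconj_conj, !Cconj_R by exact Hn.
  rewrite RtoC_minus, RtoC_pow in *. field. exact Hn.
Qed.

Lemma affine_inv_convex (lam : R) (a0 p q : C) (t : R) : 0 <= lam < 1 ->
  affine_inv lam a0 (p + t * (q - p))%C =
  ((1 - t)%R * affine_inv lam a0 p + t * affine_inv lam a0 q)%C.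
Proof.
  intros Hl. assert (Hn := RtoC_1_minus_sqr_neq0 lam Hl). unfold affine_inv.
  rewrite !Cminus_conj, Cplus_conj, Cmult_conj, Cminus_conj, Cconj_R.
  rewrite !RtoC_minus in *. field. exact Hn.
Qed.

Lemma affine_inv_Lipschitz (lam : R) (a0 z : C) : 0 <= lam < 1 ->
  locally_Lipschitz_at (affine_inv lam a0) z.
Proof.
  intros Hl. assert (Hn := RtoC_1_minus_sqr_neq0 lam Hl).
  assert (Hpos : 0 < 1 - lam ^ 2) by nra.
  exists ((1 + lam) / (1 - lam ^ 2)), 1. split; [lra|]. split.
  { apply Rdiv_le_0_compat; lra. }
  intros w _. unfold affine_inv.
  replace (a0 + (w - a0 - lam * Cconj (w - a0)) / RtoC (1 - lam ^ 2) -
      (a0 + (z - a0 - lam * Cconj (z - a0)) / RtoC (1 - lam ^ 2)))%C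
    with ((w - z - lam * Cconj (w - z)) / RtoC (1 - lam ^ 2))%C
    by (rewrite !Cminus_conj; field; exact Hn).
  rewrite Cmod_div by exact Hn. rewrite (Cmod_R (1 - lam ^ 2)), Rabs_pos_eq by lra.
  unfold Rdiv. rewrite Rmult_assoc, (Rmult_comm (/ _)), <- Rmult_assoc.
  apply Rmult_le_compat_r; [apply Rlt_le, Rinv_0_lt_compat; lra|].
  apply Rle_trans with (1 := Cmod_triangle _ _).
  rewrite Cmod_opp, Cmod_mult, Cmod_conj, Cmod_R, Rabs_pos_eq by lra. lra.
Qed.

Lemma open_preimage_disk (F : C -> C) : (forall z, locally_Lipschitz_at F z) ->
  open (fun w => disk (F w)).
Proof.
  intros HF w Hw.
  assert (Hd : 0 < 1 - Cmod (F w)) by (unfold disk in Hw; lra).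
  assert (H := locally_Lipschitz_filterlim F w (HF w)).
  apply (H (fun u => disk u)). apply locally_Cmod with (1 := Hd).
  intros u Hu. now apply disk_ball with (F w).
Qed.

(** On the segment from a point of U to a point of V, let m be the supremum of the parameters
    landing in U. If the point at m is in U, openness would pass beyond m unless m = 1, where the
    endpoint lies in V. If it is in V, so are parameters of U just below m. *)
Lemma convex_connected (A : C -> Prop) :
  (forall p q t, A p -> A q -> 0 <= t <= 1 -> A (p + RtoC t * (q - p))%C) ->
  connected_set A.
Proof.
  intros Hconv U V HU HV Hcov [p [Ap Up]] [q [Aq Vq]].
  set (s := fun t : R => (p + RtoC t * (q - p))%C).
  assert (Hs : forall W : C -> Prop, open W -> forall t, W (s t) ->
    exists d, 0 < d /\ forall t', Rabs (t' - t) < d -> W (s t')).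
  { intros W HW t Ht. destruct (locally_Cmod_inv _ _ (HW _ Ht)) as [d [Hd H]].
    assert (Hc := Cmod_ge_0 (q - p)).
    assert (Hq : 0 < d / (Cmod (q - p) + 1)) by (apply Rdiv_lt_0_compat; lra).
    exists (d / (Cmod (q - p) + 1)). split; [exact Hq|]. intros t' Ht'. apply H.
    replace (s t' - s t)%C with (RtoC (t' - t) * (q - p))%C
      by (unfold s; rewrite RtoC_minus; ring).
    rewrite Cmod_mult, Cmod_R.
    apply Rmult_lt_compat_r with (r := Cmod (q - p) + 1) in Ht'; [|lra].
    replace (d / (Cmod (q - p) + 1) * (Cmod (q - p) + 1)) with d in Ht' by (field; lra).
    assert (H0 := Rabs_pos (t' - t)). nra. }
  set (E := fun t => 0 <= t <= 1 /\ U (s t)).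
  assert (s0 : s 0 = p) by (unfold s; ring). assert (s1 : s 1 = q) by (unfold s; ring).
  assert (E0 : E 0) by (split; [lra|now rewrite s0]).
  destruct (completeness E) as [m [Hub Hlub]].
  { exists 1. intros t [Ht _]. lra. }
  { now exists 0. }
  assert (Hm : 0 <= m <= 1) by (split; [now apply Hub|apply Hlub; intros t [Ht _]; lra]).
  assert (Am : A (s m)) by now apply Hconv.
  destruct (Hcov _ Am) as [Um|Vm].
  - destruct (Req_dec m 1) as [->|Hm1].
    + exists (s 1). rewrite s1 in *. auto.
    + exfalso. destruct (Hs U HU m Um) as [d [Hd H]].
      set (t := Rmin 1 (m + d / 2)).
      assert (Ht1 : t <= 1) by apply Rmin_l. assert (Ht2 : t <= m + d / 2) by apply Rmin_r.
      assert (Ht3 : m < t) by (apply Rmin_glb_lt; lra).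
      assert (Et : E t).
      { split; [lra|]. apply H. rewrite Rabs_pos_eq; lra. }
      generalize (Hub t Et). lra.
  - destruct (Hs V HV m Vm) as [d [Hd H]].
    destruct (classic (exists t, E t /\ m - d < t)) as [[t [[Ht Ut] Hmt]]|Hno].
    + exists (s t). split; [now apply Hconv|]. split; [exact Ut|].
      apply H. assert (t <= m) by (apply Hub; now split). apply Rabs_def1; lra.
    + exfalso. assert (m <= m - d); [|lra]. apply Hlub. intros t Et.
      apply Rnot_lt_le. intros Hlt. apply Hno. now exists t.
Qed.

Lemma disk_convex (p q : C) (t : R) : disk p -> disk q -> 0 <= t <= 1 ->
  disk ((1 - t)%R * p + t * q)%C.
Proof.
  unfold disk. intros Hp Hq Ht. apply Rle_lt_trans with (1 := Cmod_triangle _ _).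
  rewrite !Cmod_mult, !Cmod_R, !Rabs_pos_eq by lra.
  destruct (Req_dec t 0) as [->|Hne]; [lra|].
  assert ((1 - t) * Cmod p <= (1 - t) * 1) by (apply Rmult_le_compat_l; lra).
  assert (t * Cmod q < t * 1) by (apply Rmult_lt_compat_l; lra). lra.
Qed.

Lemma extremal_f_affine (lam : R) (a0 z : C) :
  extremal_f lam a0 z = (extremal_h a0 z + lam * Cconj (extremal_h a0 z - a0))%C.
Proof. unfold extremal_f, extremal_g. now rewrite Cmult_conj, Cconj_R. Qed.

Lemma extremal_quasiconformal (K lam : R) (a0 : C) : disk a0 -> 1 <= K ->
  0 <= lam <= (K - 1) / (K + 1) ->
  quasiconformal K (extremal_f lam a0) (extremal_h a0) (extremal_g lam a0).
Proof.
  intros Ha HK Hlk.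
  assert (HlK : lam * (K + 1) <= K - 1).
  { destruct Hlk as [_ H]. apply Rmult_le_compat_r with (r := K + 1) in H; [|lra].
    replace ((K - 1) / (K + 1) * (K + 1)) with (K - 1) in H by (field; lra). exact H. }
  (* A finite K keeps lam strictly below 1, which makes the affine map invertible. *)
  assert (Hl : 0 <= lam < 1) by (split; [lra|nra]).
  split; [exact HK|]. split; [|split].
  - intros z Hz.
    rewrite (quad_deriv_C_derive _ _ _ (extremal_h_quad_deriv a0 z Ha Hz)).
    rewrite (quad_deriv_C_derive _ _ _ (extremal_g_quad_deriv lam a0 z Ha Hz)).
    rewrite Cmod_mult, Cmod_R, Rabs_pos_eq, Rpow_mult_distr by lra.
    assert (H0 := proj1 (Cmod_gt_0 _) (extremal_h'_neq0 a0 z Ha Hz)).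
    assert (0 < Cmod (extremal_h' a0 z) ^ 2) by now apply pow_lt.
    assert (lam ^ 2 < 1) by nra. nra.
  (* The image is the interior of an ellipse, written as a preimage of the disk under the inverse
     affine map: it is open by continuity and connected by convexity. *)
  - exists (fun w => disk (affine_inv lam a0 w)). split.
    + split; [|split].
      * exists (RtoC 0 + lam * Cconj (RtoC 0 - a0))%C. rewrite affine_inv_l by exact Hl.
        unfold disk. rewrite Cmod_0. lra.
      * apply open_preimage_disk. intros z. now apply affine_inv_Lipschitz.
      * apply convex_connected. intros p q t Hp Hq Ht.
        rewrite affine_inv_convex by exact Hl. now apply disk_convex.
    + exists (fun w => extremal_h (- a0) (affine_inv lam a0 w)). split; [|split; [|split]].
      * intros z Hz. rewrite extremal_f_affine, affine_inv_l by exact Hl.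
        split; [now apply extremal_h_disk|now apply extremal_h_opp_inv].
      * intros w Hw. split; [apply extremal_h_disk; [now apply disk_opp|exact Hw]|].
        rewrite extremal_f_affine.
        assert (E := extremal_h_opp_inv (- a0) _ (disk_opp _ Ha) Hw).
        replace (- - a0)%C with a0 in E by ring. rewrite E. now apply affine_inv_r.
      * apply locally_Lipschitz_continuous_on. intros z Hz.
        destruct (quad_deriv_locally_Lipschitz _ _ _ (extremal_h_quad_deriv a0 z Ha Hz))
          as [M [d [Hd [HM H]]]].
        exists (2 * M), d. split; [exact Hd|]. split; [lra|]. intros w Hw. specialize (H w Hw).
        rewrite !extremal_f_affine.
        replace (extremal_h a0 w + lam * Cconj (extremal_h a0 w - a0)
            - (extremal_h a0 z + lam * Cconj (extremal_h a0 z - a0)))%C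
          with (extremal_h a0 w - extremal_h a0 z
            + lam * Cconj (extremal_h a0 w - extremal_h a0 z))%C
          by (rewrite !Cminus_conj; ring).
        apply Rle_trans with (1 := Cmod_triangle _ _).
        rewrite Cmod_mult, Cmod_conj, Cmod_R, Rabs_pos_eq by lra.
        assert (H0 := Cmod_ge_0 (extremal_h a0 w - extremal_h a0 z)). nra.
      * apply locally_Lipschitz_continuous_on. intros w Hw.
        apply locally_Lipschitz_comp; [now apply affine_inv_Lipschitz|].
        apply quad_deriv_locally_Lipschitz with (extremal_h' (- a0) (affine_inv lam a0 w)).
        apply extremal_h_quad_deriv; [now apply disk_opp|exact Hw].
  - intros z Hz.
    destruct (quad_wirtinger_derivs (extremal_f lam a0) z _ _
      (harmonic_quad_wirtinger _ _ _ z _ _ Hz (fun w _ => eq_refl)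
        (extremal_h_quad_deriv a0 z Ha Hz) (extremal_g_quad_deriv lam a0 z Ha Hz))) as [E1 E2].
    rewrite E1, E2, Cmod_conj, Cmod_mult, Cmod_R, Rabs_pos_eq by lra.
    assert (H0 := proj1 (Cmod_gt_0 _) (extremal_h'_neq0 a0 z Ha Hz)).
    set (p := Cmod (extremal_h' a0 z)) in *.
    assert (Hd : 0 < p - lam * p) by nra.
    apply Rmult_le_reg_r with (1 := Hd). unfold Rdiv. rewrite Rmult_assoc, Rinv_l by lra.
    nra.
Qed.

(** Both series are geometric with ratio r |a_0|, so the deficit from 1 is an exact multiple of k -
    lam and vanishes linearly as lam -> k. *)
Lemma extremal_bohr_lhs (k lam r : R) (a0 : C) : disk a0 -> 0 <= lam -> 0 <= r <= 1 / 3 ->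
  bohr_lhs k (extremal_a a0) (extremal_b a0 lam) r =
  1 + (lam - k) * (r * (1 - Cmod a0 ^ 2) / (1 - r * Cmod a0)).
Proof.
  intros Ha Hl Hr. assert (H0 := Cmod_ge_0 a0). assert (Ha' := Ha). unfold disk in Ha'.
  set (A := Cmod a0) in *. assert (HrA : 0 <= r * A < 1) by nra.
  assert (Sa : Series (fun n => Cmod (extremal_a a0 (S n)) * r ^ S n) =
    r * (1 - A ^ 2) / (1 - r * A)).
  { apply is_series_unique.
    apply (is_series_ext (fun n => (r * (1 - A ^ 2)) * (r * A) ^ n)).
    - intros n. rewrite Cmod_extremal_a_S by exact Ha. fold A.
      rewrite Rpow_mult_distr. simpl. rring.
    - apply (is_series_scal (r * (1 - A ^ 2)) (fun n => (r * A) ^ n)), is_series_geom.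
      rewrite Rabs_pos_eq; lra. }
  assert (Sb : Series (fun n => Cmod (extremal_b a0 lam (S n)) * r ^ S n) =
    lam * (r * (1 - A ^ 2) / (1 - r * A))).
  { rewrite <- Sa, <- Series_scal_l. apply Series_ext. intros n.
    rewrite extremal_b_S, Cmod_mult, Cmod_R, Rabs_pos_eq by exact Hl. ring. }
  unfold bohr_lhs. rewrite Sa, Sb. simpl extremal_a. fold A. field. lra.
Qed.

Lemma extremal_limit (k r : R) (a0 : C) : disk a0 -> 0 <= r <= 1 / 3 ->
  filterlim (fun lam => bohr_lhs k (extremal_a a0) (extremal_b a0 lam) r)
    (within (fun lam => 0 <= lam <= k) (locally k)) (locally 1).
Proof.
  intros Ha Hr. set (T := r * (1 - Cmod a0 ^ 2) / (1 - r * Cmod a0)).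
  apply filterlim_locally. intros eps. assert (He := cond_pos eps).
  assert (Hq : 0 < eps / (Rabs T + 1)).
  { apply Rdiv_lt_0_compat; [exact He|]. generalize (Rabs_pos T). lra. }
  exists (mkposreal _ Hq). intros lam Hball Hlam.
  change (Rabs (lam - k) < eps / (Rabs T + 1)) in Hball.
  change (Rabs (bohr_lhs k (extremal_a a0) (extremal_b a0 lam) r - 1) < eps).
  rewrite extremal_bohr_lhs by (auto; lra). fold T.
  replace (1 + (lam - k) * T - 1) with ((lam - k) * T) by ring. rewrite Rabs_mult.
  assert (HT := Rabs_pos T). assert (Hd := Rabs_pos (lam - k)).
  apply Rmult_lt_compat_r with (r := Rabs T + 1) in Hball; [|lra].
  replace (eps / (Rabs T + 1) * (Rabs T + 1)) with (pos eps) in Hball by (field; lra).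
  nra.
Qed.

Theorem theorem2p5 :
  (forall (k : R) (f h g : C -> C) (a b : nat -> C),
     harmonic_mapping f h g a b ->
     (exists K : R, 1 <= K /\ k = (K - 1) / (K + 1) /\ quasiconformal K f h g)
     \/ (0 <= k <= 1 /\ dilatation_le k h g) ->
     (forall z : C, disk z -> Cmod (h z) <= 1) ->
     forall r : R, 0 <= r <= 1 / 3 ->
       ex_series (fun n : nat => Cmod (a (S n)) * r ^ S n) /\
       ex_series (fun n : nat => Cmod (b (S n)) * r ^ S n) /\
       bohr_lhs k a b r <= 1)
  /\
  (forall (k : R) (a0 : C), 0 <= k <= 1 -> disk a0 ->
     exists (a : nat -> C) (b : R -> nat -> C),
       a 0%nat = a0 /\
       (forall z : C, disk z -> Cmod (extremal_h a0 z) <= 1) /\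
       (forall lam : R, 0 <= lam <= k ->
          harmonic_mapping (extremal_f lam a0) (extremal_h a0)
            (extremal_g lam a0) a (b lam) /\
          dilatation_le k (extremal_h a0) (extremal_g lam a0) /\
          (forall K : R, 1 <= K -> k = (K - 1) / (K + 1) ->
             quasiconformal K (extremal_f lam a0) (extremal_h a0)
               (extremal_g lam a0))) /\
       (forall r : R, 0 <= r <= 1 / 3 ->
          filterlim (fun lam : R => bohr_lhs k a (b lam) r)
            (within (fun lam : R => 0 <= lam <= k) (locally k))
            (locally 1))).
Proof.
  split.
  - intros k f h g a b Hf Hk Hbd r Hr.
    apply (bohr_harmonic k f h g); auto.
    + destruct Hk as [[K [HK [-> _]]]|[Hk _]]; [|lra].
      apply Rdiv_le_0_compat; lra.
    + destruct Hk as [[K [_ [-> HK]]]|[_ Hk]]; [|exact Hk].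
      now apply (quasiconformal_dilatation K f h g a b).
  - intros k a0 Hk Ha. exists (extremal_a a0), (extremal_b a0).
    split; [reflexivity|]. split; [|split].
    + intros z Hz. apply Rlt_le. now apply extremal_h_disk.
    + intros lam Hlam. split; [|split].
      * now apply extremal_harmonic.
      * now apply extremal_dilatation.
      * intros K HK ->. now apply extremal_quasiconformal.
    + intros r Hr. now apply extremal_limit.
Qed.
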